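(* Let $\mathcal H\to\Delta^*$ be an admissible unipotent variation of graded-polarized mixed Hodge structure over the punctured disk and let $v$ be a flat (global) section of $\mathcal H$. Then the mixed Hodge norm $\|v\|$ is bounded (near the puncture $s=0$).
   Context: $\Delta^*$ is the punctured unit disk with coordinate $s$. A graded-polarized mixed Hodge structure $(F,W)$ on a real vector space (complexification $V$) with increasing filtration $W$ and forms $Q_k$ on $\mathrm{Gr}^W_k$ is a decreasing filtration $F$ of $V$ inducing pure weight-$k$ Hodge structures on $\mathrm{Gr}^W_k$ polarized by $Q_k$. Deligne bigrading: the unique $V=\bigoplus I^{p,q}$ with $F^p=\bigoplus_{a\ge p}I^{a,b}$, $W_k\otimes\mathbb C=\bigoplus_{a+b\le k}I^{a,b}$, $\overline{I^{p,q}}\equiv I^{q,p}$ mod $\bigoplus_{a<p,b<q}I^{a,b}$. The mixed Hodge metric makes the $I^{p,q}$ mutually orthogonal and on $I^{p,q}\simeq H^{p,q}\subset \mathrm{Gr}^W_{p+q}\otimes\mathbb C$ equals $Q_{p+q}(Cx,\bar y)$ with $C=i^{p-q}$. It gives a hermitian metric on a variation, fibre by fibre. A variation of graded-polarized mixed Hodge structure is a local system with flat $W$ and flat polarizations on $\mathrm{Gr}^W$, and a holomorphic Hodge filtration satisfying Griffiths transversality, giving a graded-polarized mixed Hodge structure on every fibre. It is unipotent (Hain–Zucker) if its monodromy representation is unipotent and, equivalently over an algebraic base, the variations of pure Hodge structure induced on $\mathrm{Gr}^W$ are constant; over $\Delta^*$ unipotent means: the induced variations on $\mathrm{Gr}^W$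 are constant, so that the monodromy $T=e^N$ acts trivially on $\mathrm{Gr}^W$. Admissibility over $\Delta^*$ with unipotent monodromy $T=e^N$: lifting the period map to $F(z)$ on the upper half plane ($s=e^{2\pi iz}$), $e^{-zN}.F(z)$, viewed as a function of $s$, has a limit in the compact dual $\check D$ (the orbit of the classifying space under the complex automorphism group of the graded-polarized data) as $s\to0$, and the relative weight filtration $M(N,W)$ exists, i.e. the increasing filtration $M$ with $NM_k\subset M_{k-2}$ inducing on $\mathrm{Gr}^W_k$ the monodromy weight filtration of $N$ centered at $k$. Flat means flat for the Gauss–Manin connection.
   Formalization: In the definition of the Deligne bigrading used for the mixed Hodge metric, the conjugate of I^{p,q} is congruent to I^{q,p} modulo the sum of I^{a,b} with a<q, b<p; the bounds a<p, b<q as written are transposed, and with them the unique bigrading need not exist. *)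

(* Defs.v *)
From HB Require Import structures.
From mathcomp Require Import all_boot all_order all_algebra.
From mathcomp Require Import complex.
From mathcomp Require Import all_classical all_reals all_analysis.

Set Implicit Arguments.
Unset Strict Implicit.
Unset Printing Implicit Defensive.

Import Order.TTheory GRing.Theory Num.Theory numFieldNormedType.Exports.

Local Open Scope ring_scope.
Local Open Scope classical_set_scope.

(* Conventions.
   - The real vector spaces are R^n ('rV[R]_n, row vectors) and their
     complexifications are 'rV[R[i]]_n; linear maps act on the right, x *m A.
   - A subspace is the row space of a square matrix; matrices representing
     subspaces are only meaningful up to (_ :=: _)%MS.
   - A subspace of Gr^W_k = W_k / W_(k-1) is represented by its preimage in W_k,
     and a bilinear form on Gr^W_k by a form on W_k whose radical contains
     W_(k-1).
   - R[i]^o is R[i] with its topology and its normed R[i]-module structure, so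
     that derivable is complex differentiability. *)

Section LinearAlgebra.
Variables (R : realType) (n : nat).
Local Notation C := R[i].

Definition cplx m (A : 'M[R]_(m, n)) : 'M[C]_(m, n) := map_mx (real_complex R) A.

Definition conjM m (A : 'M[C]_(m, n)) : 'M[C]_(m, n) := map_mx Num.conj A.

Definition bil (K : fieldType) (B : 'M[K]_n) (x y : 'rV[K]_n) : K :=
  (x *m B *m y^T) 0 0.

Definition sesq (B : 'M[C]_n) (x y : 'rV[C]_n) : C := bil B x (conjM y).

Definition increasing_filtration (W : int -> 'M[R]_n) : Prop :=
  [/\ forall k l, k <= l -> (W k <= W l)%MS,
      exists k, (W k :=: (0 : 'M[R]_n))%MS
    & exists k, (W k :=: 1%:M)%MS].

Definition decreasing_filtration (F : int -> 'M[C]_n) : Prop :=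
  [/\ forall p q, p <= q -> (F q <= F p)%MS,
      exists p, (F p :=: (0 : 'M[C]_n))%MS
    & exists p, (F p :=: 1%:M)%MS].

(* exp N; all the terms omitted from the series vanish for N nilpotent. *)
Definition nilexp (K : fieldType) (N : 'M[K]_n) : 'M[K]_n :=
  \sum_(k < n) (k`!%:R)^-1 *: N ^+ k.

(* Convergence, as s -> 0, of subspaces A s to B in the Grassmannian, whose
   topology is the quotient of the topology on bases. *)
Definition subspace_cvg0 (A : C -> 'M[C]_n) (B : 'M[C]_n) : Prop :=
  exists b : C -> 'M[C]_(\rank B, n),
    (forall i j,
       (b s i j : C^o) @[s --> (0 : C^o)^'] --> (row_base B i j : C^o)) /\
    \forall s \near (0 : C^o)^', (b s :=: A s)%MS.

End LinearAlgebra.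

Section MixedHodge.
Variables (R : realType) (n : nat).
Local Notation C := R[i].

Implicit Types (W Q : int -> 'M[R]_n) (F : int -> 'M[C]_n).

(* F^p Gr^W_k *)
Definition grF W F (k p : int) : 'M[C]_n :=
  ((F p :&: cplx (W k)) + cplx (W (k - 1)))%MS.

(* H^(p,q) inside Gr^W_(p+q) *)
Definition hodge_component W F (p q : int) : 'M[C]_n :=
  (grF W F (p + q) p :&: conjM (grF W F (p + q) q))%MS.

Definition graded_forms W Q : Prop :=
  forall k,
    (forall x y, (x <= W k)%MS -> (y <= W k)%MS ->
       bil (Q k) y x = (-1) ^ k * bil (Q k) x y) /\
    (forall x y, (x <= W (k - 1))%MS -> (y <= W k)%MS -> bil (Q k) x y = 0).

Definition pure_on_Gr W F : Prop :=
  forall k p : int,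
    (grF W F k p + conjM (grF W F k (k - p + 1)) :=: cplx (W k))%MS /\
    (grF W F k p :&: conjM (grF W F k (k - p + 1)) :=: cplx (W (k - 1)))%MS.

(* Riemann-Hodge bilinear relations on each Gr^W_k, with C = i^(p-q) on
   H^(p,q). *)
Definition polarized_by W Q F : Prop :=
  (forall (k p : int) x y,
     (x <= grF W F k p)%MS -> (y <= grF W F k (k - p + 1))%MS ->
     bil (cplx (Q k)) x y = 0) /\
  (forall (p q : int) x,
     (x <= hodge_component W F p q)%MS -> ~~ (x <= cplx (W (p + q - 1)))%MS ->
     0 < ('i%C : C) ^ (p - q) * sesq (cplx (Q (p + q))) x x).

Definition graded_polarized_mhs W Q F : Prop :=
  [/\ increasing_filtration W, graded_forms W Q, decreasing_filtration F,
      pure_on_Gr W F & polarized_by W Q F].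

Definition hodge_number W F (p q : int) : nat :=
  (\rank (hodge_component W F p q) - \rank (W (p + q - 1)%R))%N.

(* The conjugate of I^(p,q) and I^(q,p) agree modulo the sum of the I^(a,b) with
   a < q and b < p: the bounds on (a, b) are those attached to I^(q,p), which is
   what makes the bigrading exist and be unique.  The list s only serves to
   write sums over Z x Z as finite ones. *)
Definition deligne_bigrading W F (I : int -> int -> 'M[C]_n) : Prop :=
  exists s : seq (int * int),
  [/\ uniq s /\ (forall p q, (p, q) \notin s -> I p q = 0),
      mxdirect (\sum_(ab <- s) I ab.1 ab.2)%MS /\
        (\sum_(ab <- s) I ab.1 ab.2 :=: 1%:M)%MS,
      forall p, (F p :=: \sum_(ab <- s | (p <= ab.1)%R) I ab.1 ab.2)%MS,
      forall k, (cplx (W k) :=: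
                 \sum_(ab <- s | (ab.1 + ab.2 <= k)%R) I ab.1 ab.2)%MS
    & forall p q,
        let low := (\sum_(ab <- s | (ab.1 < q)%R && (ab.2 < p)%R) I ab.1 ab.2)%MS in
        (conjM (I p q) + low :=: I q p + low)%MS].

(* h is the Gram matrix of the mixed Hodge metric. *)
Definition mixed_hodge_metric W Q F (h : 'M[C]_n) : Prop :=
  exists2 I, deligne_bigrading W F I &
    (forall p q p' q' x y, (p, q) != (p', q') ->
       (x <= I p q)%MS -> (y <= I p' q')%MS -> sesq h x y = 0) /\
    (forall p q x y, (x <= I p q)%MS -> (y <= I p q)%MS ->
       sesq h x y = ('i%C : C) ^ (p - q) * sesq (cplx (Q (p + q))) x y).

Definition metric_norm (h : 'M[C]_n) (x : 'rV[C]_n) : R :=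
  Num.sqrt (complex.Re (sesq h x x)).

(* Classifying space of the graded-polarized mixed Hodge structures with Hodge
   numbers hn. *)
Definition classifying_space W Q (hn : int -> int -> nat) F : Prop :=
  graded_polarized_mhs W Q F /\ forall p q, hodge_number W F p q = hn p q.

Definition graded_automorphism W Q (g : 'M[C]_n) : Prop :=
  [/\ g \in unitmx, forall k, (cplx (W k) *m g :=: cplx (W k))%MS
    & forall k x y, (x <= cplx (W k))%MS -> (y <= cplx (W k))%MS ->
        bil (cplx (Q k)) (x *m g) (y *m g) = bil (cplx (Q k)) x y].

Definition compact_dual W Q hn F : Prop :=
  exists F0 g, [/\ classifying_space W Q hn F0, graded_automorphism W Q g
                 & forall p, (F p :=: F0 p *m g)%MS].

(* M_j Gr^W_k *)
Definition grM (W M : int -> 'M[R]_n) (k j : int) : 'M[R]_n :=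
  ((M j :&: W k) + W (k - 1))%MS.

(* The last two clauses say that N^j : Gr^M_(k+j) Gr^W_k -> Gr^M_(k-j) Gr^W_k is
   onto, respectively one-to-one, for all j >= 0. *)
Definition relative_weight_filtration (N : 'M[R]_n) W (M : int -> 'M[R]_n) :
    Prop :=
  [/\ increasing_filtration M,
      forall k, (W k *m N <= W k)%MS,
      forall k, (M k *m N <= M (k - 2))%MS,
      forall (k : int) (j : nat),
        (grM W M k (k + j%:Z) *m N ^+ j + grM W M k (k - j%:Z - 1)%R
           :=: grM W M k (k - j%:Z))%MS
    & forall (k : int) (j : nat) (x : 'rV[R]_n),
        (x <= grM W M k (k + j%:Z))%MS ->
        (x *m N ^+ j <= grM W M k (k - j%:Z - 1))%MS ->
        (x <= grM W M k (k + j%:Z - 1))%MS].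

End MixedHodge.

Section Variations.
Variable R : realType.
Local Notation C := R[i].

Definition punctured_disk : set C := [set s | 0 < `|s| < 1].

Definition upper_half_plane : set C := [set z | 0 < complex.Im z].

(* z |-> exp (2 i pi z) *)
Definition covering (z : C) : C :=
  let t := 2 * pi * complex.Re z in
  (expR (- (2 * pi * complex.Im z)))%:C%C * (cos t +i* sin t)%C.

(* A local system of n-dimensional real vector spaces on the punctured disk: its
   fibres are identified (linearly, but otherwise arbitrarily) with R^n, and
   transport a s is the identification of the fibre at a with the fibre at s
   given by the local trivialization near a.  It is meaningful only for a in the
   punctured disk and s close to a. *)
Record local_system (n : nat) := LocalSystem {
  transport :> C -> C -> 'M[R]_n;
  transport_id : forall a, punctured_disk a -> transport a a = 1%:M;
  transport_unit : forall a, punctured_disk a ->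
    \forall s \near (a : C^o), transport a s \in unitmx;
  transport_comp : forall a, punctured_disk a ->
    \forall b \near (a : C^o), \forall s \near (b : C^o),
      transport a s = transport a b *m transport b s }.

Section Data.
Variables (n : nat) (P : local_system n).

Definition flat_filtration (W : C -> int -> 'M[R]_n) : Prop :=
  forall a, punctured_disk a -> forall k, \forall s \near (a : C^o),
    (W s k :=: W a k *m P a s)%MS.

Definition flat_forms (W Q : C -> int -> 'M[R]_n) : Prop :=
  forall a, punctured_disk a -> forall k, \forall s \near (a : C^o),
    forall x y, (x <= W a k)%MS -> (y <= W a k)%MS ->
      bil (Q s k) (x *m P a s) (y *m P a s) = bil (Q a k) x y.

(* The filtration at s, transported to the fibre at a. *)
Definition transported (F : C -> int -> 'M[C]_n) (a s : C) (p : int) :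
    'M[C]_n :=
  F s p *m cplx (invmx (P a s)).

Definition holomorphic_near m (f : C -> 'M[C]_(m, n)) (a : C) : Prop :=
  forall i j, \forall s \near (a : C^o),
    derivable (fun t : C^o => f t i j : C^o) s 1.

Definition holomorphic_filtration (F : C -> int -> 'M[C]_n) : Prop :=
  forall a, punctured_disk a -> forall p,
  exists2 b : C -> 'M[C]_(\rank (F a p), n), holomorphic_near b a &
    \forall s \near (a : C^o), row_free (b s) /\
      (b s :=: transported F a s p)%MS.

(* In flat coordinates near a the Gauss-Manin connection is d/ds. *)
Definition griffiths_transversality (F : C -> int -> 'M[C]_n) : Prop :=
  forall a, punctured_disk a -> forall p (f : C -> 'rV[C]_n),
    holomorphic_near f a ->
    (\forall s \near (a : C^o), (f s <= transported F a s p)%MS) ->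
    (\row_j (fun t : C^o => f t 0 j : C^o)^`() a <= F a (p - 1))%MS.

End Data.

Record gpvmhs (n : nat) := GPVMHS {
  vL :> local_system n;
  vW : C -> int -> 'M[R]_n;
  vQ : C -> int -> 'M[R]_n;
  vF : C -> int -> 'M[C]_n;
  vW_flat : flat_filtration vL vW;
  vQ_flat : flat_forms vL vW vQ;
  vF_holomorphic : holomorphic_filtration vL vF;
  vF_transversal : griffiths_transversality vL vF;
  v_mhs : forall s, punctured_disk s ->
    graded_polarized_mhs (vW s) (vQ s) (vF s) }.

Section Admissible.
Variables (n : nat) (H : gpvmhs n).

Definition flat_section (v : C -> 'rV[C]_n) : Prop :=
  forall a, punctured_disk a ->
    \forall s \near (a : C^o), v s = v a *m cplx (vL H a s).

(* Each Gr^W_k is isomorphic, through the maps induced by the t s, to a constant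
   variation of Hodge structure. *)
Definition unipotent_variation : Prop :=
  forall k, exists (t : C -> 'M[R]_n) (L : int -> 'M[C]_n),
  forall a, punctured_disk a ->
    [/\ (vW H a k :&: kermx (t a) :=: vW H a (k - 1))%MS,
        \forall s \near (a : C^o),
          vW H a k *m vL H a s *m t s = vW H a k *m t a
      & forall p, ((vF H a p :&: cplx (vW H a k)) *m cplx (t a) :=: L p)%MS].

(* A flat frame of the pull-back of the local system to the upper half plane:
   the rows of Phi z form a basis of the fibre at covering z. *)
Definition flat_frame (Phi : C -> 'M[R]_n) : Prop :=
  forall z, upper_half_plane z ->
    Phi z \in unitmx /\
    \forall w \near (z : C^o),
      Phi w = Phi z *m vL H (covering z) (covering w).

(* The data of the variation in the coordinates given by the frame Phi;
   liftF Phi is the lifted period map. *)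
Definition liftW (Phi : C -> 'M[R]_n) z k : 'M[R]_n :=
  vW H (covering z) k *m invmx (Phi z).

Definition liftQ (Phi : C -> 'M[R]_n) z k : 'M[R]_n :=
  Phi z *m vQ H (covering z) k *m (Phi z)^T.

Definition liftF (Phi : C -> 'M[R]_n) z p : 'M[C]_n :=
  vF H (covering z) p *m cplx (invmx (Phi z)).

(* The equation says that F (z + 1) = exp(N).F(z) for the lifted period map. *)
Definition monodromy_logarithm (Phi : C -> 'M[R]_n) (N : 'M[R]_n) : Prop :=
  (exists k, N ^+ k = 0) /\
  forall z, upper_half_plane z -> Phi z = nilexp N *m Phi (z + 1).

Definition limit_hodge_filtration (Phi : C -> 'M[R]_n) (N : 'M[R]_n)
    (Finf : int -> 'M[C]_n) : Prop :=
  exists psi : C -> int -> 'M[C]_n,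
    (forall z, upper_half_plane z -> forall p,
       (psi (covering z) p :=: liftF Phi z p *m nilexp (- z *: cplx N))%MS) /\
    forall p, subspace_cvg0 (psi^~ p) (Finf p).

(* liftW and liftQ do not depend on z, as W and Q are flat. *)
Definition admissible : Prop :=
  exists (Phi : C -> 'M[R]_n) (N : 'M[R]_n),
  [/\ flat_frame Phi, monodromy_logarithm Phi N,
      exists2 Finf, limit_hodge_filtration Phi N Finf &
        forall z, upper_half_plane z ->
          compact_dual (liftW Phi z) (liftQ Phi z)
            (hodge_number (liftW Phi z) (liftF Phi z)) Finf
    & exists M, forall z, upper_half_plane z ->
        relative_weight_filtration N (liftW Phi z) M].

End Admissible.
End Variations.

(* Main.v *)
Require Import Defs.
From HB Require Import structures.
From mathcomp Require Import all_boot all_order all_algebra.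
From mathcomp Require Import perm complex.
From mathcomp Require Import all_classical all_reals all_analysis.
From mathcomp Require Import ring lra zify.
Import Order.TTheory GRing.Theory Num.Theory numFieldNormedType.Exports.
Local Open Scope ring_scope.
Local Open Scope classical_set_scope.

Set Implicit Arguments.
Unset Strict Implicit.
Unset Printing Implicit Defensive.

(** In a multivalued flat frame the section v is a constant vector c, and the
    metric on I^(p,q) is given by the flat form Q_(p+q). The norm of v is
    therefore bounded if the components of c in the Deligne bigradings of the
    fibres, written in the frame, are bounded; and they are bounded if the
    moving subspaces I^(p,q) approach independent subspaces
    ([bounded_components]).

    The vector c is invariant under the monodromy, so N c = 0 and applying the
    untwisting e^(-zN) leaves c unchanged ([flatten_section]). As N acts
    trivially on Gr^W, it does not change the values of the forms on the
    components either ([sesq_flat]). What has to be followed is thus the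
    bigrading of the untwisted structures e^(-zN).(F, W), which is built from
    the untwisted filtration psi(s) and from the untwisted conjugate of F.

    The first converges to Finf, exponentially in Im z, since psi is a
    holomorphic function of s ([rapid_decay], [frame_rapid]). The second is
    obtained from the conjugate of psi(s) by the twist e^(-2i Im(z) N), which
    does not converge but grows only polynomially. By Deligne's formula
      I^(p,q) = F^p :&: W_k :&: U,
      U = conj F^q :&: W_k + \sum_(i > 0) conj F^(q-i+1) :&: W_(k-i),  k = p + q,
    the conjugate enters through U only, and the limit value of U is stable
    under N, hence under the twist ([Uinf_N]): an exponentially small error
    survives a polynomial twist ([lower_twist]). The stability of U combines
    two facts. Griffiths transversality passes to the limit as
    N Finf^p <= Finf^(p-1) ([Finf_N]); and the relative weight filtration of
    an N acting trivially on Gr^W can only be W, so that N W_k <= W_(k-2)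
    ([W_N2]).

    Finally Finf induces on Gr^W the Hodge filtration of the fibres, because
    that filtration is constant ([Finf_gr]). It is therefore opposed to its
    conjugate on each Gr^W_k, and this is enough for the subspaces given by
    Deligne's formula to be independent ([J_indep]). *)

(** * Complex derivatives and real estimates *)

Section Cabs.
Variable R : realType.
Local Notation C := R[i].

(** The modulus as an element of R, so that estimates take place in an
    ordered field. *)
Definition cabs (z : C) : R := complex.Re `|z|.

Lemma cabsE (z : C) : `|z| = (cabs z)%:C%C.
Proof. by rewrite /cabs normc_def. Qed.

Lemma cabs_ge0 (z : C) : 0 <= cabs z.
Proof. by rewrite -ler0c -cabsE normr_ge0. Qed.

Lemma cabs0 : cabs 0 = 0.
Proof. by rewrite /cabs normr0. Qed.

Lemma cabs1 : cabs 1 = 1.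
Proof. by rewrite /cabs normr1. Qed.

Lemma cabs_eq0 (z : C) : (cabs z == 0) = (z == 0).
Proof. by rewrite -(inj_eq (@complexI R)) -cabsE normr_eq0. Qed.

Lemma cabs_gt0 (z : C) : (0 < cabs z) = (z != 0).
Proof. by rewrite lt_neqAle cabs_ge0 andbT eq_sym cabs_eq0. Qed.

Lemma cabsM (x y : C) : cabs (x * y) = cabs x * cabs y.
Proof. by apply: (@complexI R); rewrite rmorphM /= -!cabsE normrM. Qed.

Lemma cabsV (x : C) : cabs x^-1 = (cabs x)^-1.
Proof. by apply: (@complexI R); rewrite fmorphV /= -!cabsE normfV. Qed.

Lemma cabsX (x : C) k : cabs (x ^+ k) = cabs x ^+ k.
Proof. by apply: (@complexI R); rewrite rmorphXn /= -!cabsE normrX. Qed.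

Lemma cabsN (x : C) : cabs (- x) = cabs x.
Proof. by rewrite /cabs normrN. Qed.

Lemma cabsBC (x y : C) : cabs (x - y) = cabs (y - x).
Proof. by rewrite /cabs distrC. Qed.

Lemma cabsD (x y : C) : cabs (x + y) <= cabs x + cabs y.
Proof. by rewrite -lecR rmorphD /= -!cabsE ler_normD. Qed.

Lemma cabsB (x y : C) : cabs (x - y) <= cabs x + cabs y.
Proof. by rewrite -(cabsN y) cabsD. Qed.

Lemma cabs_real (x : R) : cabs x%:C%C = `|x|.
Proof. by rewrite /cabs normc_def /= expr0n /= addr0 sqrtr_sqr. Qed.

Lemma cabsi : cabs 'i%C = 1.
Proof. by rewrite /cabs normc_def /= expr0n /= add0r expr1n sqrtr1. Qed.

Lemma cabs_Re (z : C) : `|complex.Re z| <= cabs z.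
Proof. by rewrite /cabs normc_def /= -sqrtr_sqr ler_wsqrtr // lerDl sqr_ge0. Qed.

Lemma cabs_Im (z : C) : `|complex.Im z| <= cabs z.
Proof. by rewrite /cabs normc_def /= -sqrtr_sqr ler_wsqrtr // lerDr sqr_ge0. Qed.

Lemma cabs_mk (x y : R) : cabs (x +i* y)%C <= `|x| + `|y|.
Proof.
rewrite [X in cabs X]complexE /= (le_trans (cabsD _ _)) // cabsM cabsi mul1r.
by rewrite !cabs_real.
Qed.

Lemma cabs_conj (z : C) : cabs (conjc z) = cabs z.
Proof. by case: z => a b; rewrite /cabs !normc_def /= sqrrN. Qed.

Lemma cabs_sum I (r : seq I) (P : pred I) (F : I -> C) :
  cabs (\sum_(i <- r | P i) F i) <= \sum_(i <- r | P i) cabs (F i).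
Proof.
elim/big_ind2: _ => [|x1 x2 y1 y2 h1 h2|//]; first by rewrite cabs0.
exact: le_trans (cabsD _ _) (lerD h1 h2).
Qed.

Lemma posC (e : C) : 0 < e -> exists2 r : R, 0 < r & e = r%:C%C.
Proof.
case: e => a b; rewrite ltcE /= => /andP[/eqP -> a0].
by exists a.
Qed.

Lemma nearC (z : C) (P : C -> Prop) :
  (\forall t \near (z : C^o), P t) <->
  exists2 d : R, 0 < d & forall t, cabs (t - z) < d -> P t.
Proof.
split.
  move=> /nbhs_ballP[e /posC[d d0 ->]] H; exists d => // t td.
  by apply: H; rewrite /ball /= cabsE ltcR cabsBC.
move=> [d d0 H]; apply/nbhs_ballP; exists d%:C%C => /=; first by rewrite ltcR.
by move=> t; rewrite /ball /= cabsE ltcR cabsBC; exact: H.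
Qed.

Lemma near0C (P : C -> Prop) :
  (\forall t \near (0 : C^o)^', P t) <->
  exists2 d : R, 0 < d & forall t, 0 < cabs t < d -> P t.
Proof.
split.
  move=> /(nearC 0 (fun t => t != 0 -> P t))[d d0 H]; exists d => // t /andP[t0 td].
  by apply: H; rewrite ?subr0 // -cabs_gt0.
move=> [d d0 H]; apply/(nearC 0 (fun t => t != 0 -> P t)); exists d => // t.
by rewrite subr0 => td t0; apply: H; rewrite td cabs_gt0 t0.
Qed.

Lemma cvg0C (f : C -> C) (l : C) :
  ((f s : C^o) @[s --> (0 : C^o)^'] --> (l : C^o)) <->
  forall e, 0 < e -> exists2 d : R, 0 < d & forall t, 0 < cabs t < d -> cabs (f t - l) <= e.
Proof.
split.
  move=> /cvgrPdist_le H e e0; have := H e%:C%C; rewrite ltcR => /(_ e0).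
  move=> /near0C[d d0 {}H]; exists d => // t td.
  by have := H t td; rewrite cabsE lecR cabsBC.
move=> H; apply/cvgrPdist_le => _ /posC[e e0 ->].
apply/near0C; have [d d0 {}H] := H e e0; exists d => // t td.
by rewrite cabsE lecR cabsBC H.
Qed.

(** The form of differentiability from which estimates are read off;
    [is_derive_cderiv] identifies it with [is_derive]. *)
Definition cderiv (f : C -> C) (z d : C) : Prop :=
  forall e, 0 < e -> exists2 r : R, 0 < r &
    forall t, cabs (t - z) < r ->
      cabs (f t - f z - d * (t - z)) <= e * cabs (t - z).

Lemma is_derive_cderiv (f : C -> C) (z d : C) :
  is_derive (z : C^o) 1 (f : C^o -> C^o) d <-> cderiv f z d.
Proof.
have key (h : C) : h != 0 ->
    cabs (h^-1 *: (f (h + z) - f z) - d) * cabs h = cabs (f (h + z) - f z - d * h).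
  by move=> h0; rewrite -cabsM mulrBl /GRing.scale /= mulrAC mulVf // mul1r.
split.
  move=> [/cvg_ex[l Hl] Hd] e e0.
  have {Hd}dl : d = l by rewrite -Hd; apply: cvg_lim Hl; exact: norm_hausdorff.
  rewrite {}dl in key *.
  have /cvg0C := Hl => /(_ e e0)[r r0 H].
  exists r => // t tr.
  have [->|tz] := eqVneq t z; first by rewrite !subrr mulr0 subr0 cabs0 mulr0.
  have := H (t - z); rewrite cabs_gt0 subr_eq0 tz tr => /(_ isT).
  have E : ((t - z) *: (1 : C^o) : C^o) = t - z by rewrite /GRing.scale /= mulr1.
  rewrite E => {}H.
  have := key (t - z); rewrite subr_eq0 tz addrNK => /(_ isT) <-.
  by rewrite ler_wpM2r ?cabs_ge0 //; move: H; rewrite /= subrK.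
move=> H.
have Hl : (fun h : C^o => h^-1 *: (f (h *: (1 : C^o) + z) - f z) : C^o) @ (0 : C^o)^' --> (d : C^o).
  apply/cvg0C => e e0; have [r r0 {}H] := H e e0; exists r => // t /andP[t0 tr].
  have E : (t *: (1 : C^o) : C^o) = t by rewrite /GRing.scale /= mulr1.
  rewrite E -(ler_pM2r t0) key -?cabs_gt0 //.
  by have := H (t + z); rewrite addrK; exact.
split; first by apply/cvg_ex; exists d.
by apply: cvg_lim Hl; exact: norm_hausdorff.
Qed.

Lemma derivable_cderiv (f : C -> C) (z : C) :
  derivable (f : C^o -> C^o) (z : C^o) 1 -> exists d, cderiv f z d.
Proof. by move=> /derivableP/is_derive_cderiv; exists ('D_1 (f : C^o -> C^o) (z : C^o)). Qed.

Lemma cderiv_continuous (f : C -> C) (z d : C) : cderiv f z d ->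
  forall e, 0 < e -> exists2 r : R, 0 < r & forall t, cabs (t - z) < r -> cabs (f t - f z) <= e.
Proof.
move=> H e e0.
have [r r0 {}H] := H 1 ltr01.
have M0 : 0 < 1 + cabs d by rewrite ltr_wpDr ?cabs_ge0.
exists (Order.min r (e / (1 + cabs d))); first by rewrite lt_min r0 divr_gt0.
move=> t; rewrite lt_min => /andP[/H {}H te].
have -> : f t - f z = (f t - f z - d * (t - z)) + d * (t - z) by rewrite subrK.
apply: (le_trans (cabsD _ _)); rewrite cabsM.
apply: (le_trans (lerD H (lexx _))).
by rewrite -mulrDl mulrC -ler_pdivlMr // ltW.
Qed.

Lemma cderivD (f g : C -> C) z df dg : cderiv f z df -> cderiv g z dg ->
  cderiv (fun t => f t + g t) z (df + dg).
Proof. by rewrite -!is_derive_cderiv => ? ?; exact: is_deriveD. Qed.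

Lemma cderivM (f g : C -> C) z df dg : cderiv f z df -> cderiv g z dg ->
  cderiv (fun t => f t * g t) z (df * g z + f z * dg).
Proof.
rewrite -!is_derive_cderiv => ? ?.
have H : is_derive (z : C^o) 1 ((f : C^o -> C^o) * (g : C^o -> C^o)) (f z *: dg + g z *: df) by exact: is_deriveM.
apply: is_derive_eq H _.
by rewrite /GRing.scale /= [RHS]addrC [df * _]mulrC.
Qed.

Lemma cderiv_cst (c z : C) : cderiv (fun=> c) z 0.
Proof. by apply/is_derive_cderiv; exact: is_derive_cst. Qed.

Lemma cderiv_id (z : C) : cderiv id z 1.
Proof. by apply/is_derive_cderiv; exact: is_derive_id. Qed.

Lemma cderivN (f : C -> C) z df : cderiv f z df -> cderiv (fun t => - f t) z (- df).
Proof. by rewrite -!is_derive_cderiv => ?; exact: is_deriveN. Qed.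

Lemma cderivB (f g : C -> C) z df dg : cderiv f z df -> cderiv g z dg ->
  cderiv (fun t => f t - g t) z (df - dg).
Proof. by move=> hf hg; apply: cderivD => //; exact: cderivN. Qed.

Lemma cderivV (f : C -> C) z df : f z != 0 -> cderiv f z df ->
  exists d, cderiv (fun t => (f t)^-1) z d.
Proof.
move=> fz; rewrite -is_derive_cderiv => -[Hf _].
exact: derivable_cderiv (derivableV fz Hf).
Qed.

Lemma cderiv_comp (f g : C -> C) z df dg : cderiv g z dg -> cderiv f (g z) df ->
  cderiv (fun t => f (g t)) z (df * dg).
Proof.
move=> Hg Hf e e0.
have K0 : 0 < 1 + cabs dg by rewrite ltr_wpDr ?cabs_ge0.
have D0 : 0 < 1 + cabs df by rewrite ltr_wpDr ?cabs_ge0.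
have e1 : 0 < e / 2 / (1 + cabs dg) by rewrite !divr_gt0.
have e2 : 0 < e / 2 / (1 + cabs df) by rewrite !divr_gt0.
have [r1 r10 H1] := Hf _ e1.
have r10' : 0 < r1 / 2 by rewrite divr_gt0.
have [r2 r20 H2] := cderiv_continuous Hg r10'.
have [r3 r30 H3] := Hg _ e2.
have [r4 r40 H4] := Hg _ ltr01.
exists (Order.min r2 (Order.min r3 r4)); first by rewrite !lt_min r20 r30.
move=> t; rewrite !lt_min => /and3P[/H2 {}H2 /H3 {}H3 /H4 {}H4].
have {}H1 := H1 (g t) (le_lt_trans H2 _).
have {}H1 : cabs (f (g t) - f (g z) - df * (g t - g z)) <= e / 2 / (1 + cabs dg) * cabs (g t - g z).
  by apply: H1; rewrite ltr_pdivrMr // mulr_natr mulr2n ltr_pwDl.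
have B : cabs (g t - g z) <= (1 + cabs dg) * cabs (t - z).
  have -> : g t - g z = (g t - g z - dg * (t - z)) + dg * (t - z) by rewrite subrK.
  by apply: (le_trans (cabsD _ _)); rewrite cabsM mulrDl lerD.
have -> : f (g t) - f (g z) - df * dg * (t - z) =
  (f (g t) - f (g z) - df * (g t - g z)) + df * (g t - g z - dg * (t - z)).
  by ring.
apply: (le_trans (cabsD _ _)); rewrite cabsM.
have -> : e * cabs (t - z) = e / 2 * cabs (t - z) + e / 2 * cabs (t - z).
  by rewrite -mulrDl -splitr.
apply: lerD.
  apply: (le_trans H1); rewrite -[e / 2 / _ * _]mulrA; apply: ler_wpM2l.
    by rewrite divr_ge0 // ltW.
  by rewrite ler_pdivrMl.
apply: (@le_trans _ _ (cabs df * (e / 2 / (1 + cabs df) * cabs (t - z)))).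
  by rewrite ler_wpM2l ?cabs_ge0.
rewrite mulrA ler_wpM2r ?cabs_ge0 // mulrCA ger_pMr ?divr_gt0 //.
by rewrite ler_pdivrMr // mul1r lerDr.
Qed.

End Cabs.

(** * Integrals of complex functions along segments *)

Section SegmentIntegral.
Variable R : realType.
Local Notation C := R[i].
Local Notation mu := (@lebesgue_measure R).

Definition ccont (a b : R) (g : R -> C) : Prop :=
  forall x, a <= x <= b -> forall e, 0 < e -> exists2 r : R, 0 < r &
    forall t, a <= t <= b -> `|t - x| < r -> cabs (g t - g x) <= e.

Definition seg_int (a b : R) (g : R -> C) : C :=
  (\int[mu]_(x in `[a, b]) (complex.Re (g x)) +i*
   \int[mu]_(x in `[a, b]) (complex.Im (g x)))%C.

Lemma within_cont (a b : R) (g : R -> R) :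
  (forall x, a <= x <= b -> forall e, 0 < e -> exists2 r : R, 0 < r &
    forall t, a <= t <= b -> `|t - x| < r -> `|g t - g x| <= e) ->
  {within `[a, b], continuous (g : R -> R^o)}.
Proof.
move=> H; apply/subspace_continuousP => x; rewrite /= in_itv /= => xab.
apply/cvgrPdist_le => e e0; have [r r0 {}H] := H x xab e e0.
rewrite near_withinE; apply/nbhs_ballP; exists r => //= t.
by rewrite /ball /= => tx; rewrite in_itv /= => tab; rewrite distrC H // distrC.
Qed.

Lemma ccont_int a b g : ccont a b g ->
  mu.-integrable `[a, b] (EFin \o (fun x => complex.Re (g x))) /\
  mu.-integrable `[a, b] (EFin \o (fun x => complex.Im (g x))).
Proof.
move=> H; split; apply: continuous_compact_integrable; rewrite ?segment_compact //;
  try exact: segment_compact; apply: within_cont => x xab e e0;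
  have [r r0 {}H] := H x xab e e0; exists r => // t tab tx.
- apply: le_trans (H t tab tx); rewrite -[X in `|X|](_ : complex.Re (g t - g x) = _) ?cabs_Re //.
  by case: (g t) => ? ?; case: (g x).
- apply: le_trans (H t tab tx); rewrite -[X in `|X|](_ : complex.Im (g t - g x) = _) ?cabs_Im //.
  by case: (g t) => ? ?; case: (g x).
Qed.

Lemma eq_seg_int a b f g : (forall x, a <= x <= b -> f x = g x) ->
  seg_int a b f = seg_int a b g.
Proof.
move=> H; congr (_ +i* _)%C; apply: eq_Rintegral => x; rewrite inE /= in_itv /= => xab;
  by rewrite H.
Qed.

Lemma seg_int_split a c b g : a <= c -> c <= b -> ccont a b g ->
  seg_int a b g = seg_int a c g + seg_int c b g.
Proof.
move=> ac cb /ccont_int[h1 h2].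
have key (h : R -> R) : mu.-integrable `[a, b] (EFin \o h) ->
    \int[mu]_(x in `[a, b]) (h x) =
    \int[mu]_(x in `[a, c]) (h x) + \int[mu]_(x in `[c, b]) (h x).
  move=> hi; have := @Rintegral_itvB R h (BLeft a) (BRight b) c hi.
  rewrite !bnd_simp => /(_ ac cb) E.
  rewrite -[LHS](subrK (\int[mu]_(x in `[a, c]) h x)) E addrC; congr (_ + _).
  apply: Rintegral_itv_obnd_cbnd.
  apply: integrableS hi => //; apply: subset_itvr; by rewrite bnd_simp.
by rewrite /seg_int; simpc; rewrite !key.
Qed.

Lemma seg_intB a b f g : ccont a b f -> ccont a b g ->
  seg_int a b (fun x => f x - g x) = seg_int a b f - seg_int a b g.
Proof.
move=> /ccont_int[f1 f2] /ccont_int[g1 g2]; rewrite /seg_int; simpc.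
congr (_ +i* _)%C; rewrite -RintegralB //; apply: eq_Rintegral => x _;
  by case: (f x) => ? ?; case: (g x).
Qed.

Lemma fine_mu_itv (a b : R) : a <= b -> fine (mu `[a, b]) = b - a.
Proof.
move=> ab; rewrite lebesgue_measure_itv /= lte_fin.
by move: ab; rewrite le_eqVlt => /predU1P[->|->] //; rewrite ltxx subrr.
Qed.

Lemma seg_int_cst a b (k : C) : a <= b -> seg_int a b (fun=> k) = k * (b - a)%:C%C.
Proof.
move=> ab; rewrite /seg_int !Rintegral_cst //= fine_mu_itv //.
by case: k => p q; simpc.
Qed.

Lemma ccont_cst a b (k : C) : ccont a b (fun=> k).
Proof. by move=> x _ e e0; exists 1 => // t _ _; rewrite subrr cabs0 ltW. Qed.

Lemma ccontB a b f g : ccont a b f -> ccont a b g -> ccont a b (fun x => f x - g x).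
Proof.
move=> hf hg x xab e e0; have e2 : 0 < e / 2 by rewrite divr_gt0.
have [r1 r10 H1] := hf x xab _ e2; have [r2 r20 H2] := hg x xab _ e2.
exists (Order.min r1 r2); first by rewrite lt_min r10.
move=> t tab; rewrite lt_min => /andP[/(H1 t tab) {}H1 /(H2 t tab) {}H2].
have -> : f t - g t - (f x - g x) = (f t - f x) - (g t - g x) by ring.
by apply: (le_trans (cabsB _ _)); rewrite [e]splitr lerD.
Qed.

(** The factor 2 comes from estimating the real and the imaginary parts
    separately. *)
Lemma seg_int_le0 a b g M : a <= b -> ccont a b g ->
  (forall x, a <= x <= b -> cabs (g x) <= M) ->
  cabs (seg_int a b g) <= 2 * M * (b - a).
Proof.
move=> ab /ccont_int[h1 h2] H.
have key (h : R -> R) : mu.-integrable `[a, b] (EFin \o h) ->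
    (forall x, a <= x <= b -> `|h x| <= M) ->
    `|\int[mu]_(x in `[a, b]) (h x)| <= M * (b - a).
  move=> hi hM; apply: (le_trans (le_normr_Rintegral _ hi)) => //.
  have hc : mu.-integrable `[a, b] (EFin \o (fun=> M)).
    apply: (@continuous_compact_integrable R (fun=> M)); first exact: segment_compact.
    apply: within_cont => x _ e e0; exists 1 => // t _ _.
    by rewrite subrr normr0 ltW.
  have hn : mu.-integrable `[a, b] (EFin \o (fun x => `|h x|)).
    exact: integrable_norm hi.
  rewrite -(fine_mu_itv ab) -Rintegral_cst //; apply: le_Rintegral => //.
apply: (le_trans (cabs_mk _ _)); rewrite -mulrA mulr_natl mulr2n.
apply: lerD; apply: key => // x /H.
- exact: le_trans (cabs_Re _).
- exact: le_trans (cabs_Im _).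
Qed.

Lemma seg_int_le a b g k M : a <= b -> ccont a b g ->
  (forall x, a <= x <= b -> cabs (g x - k) <= M) ->
  cabs (seg_int a b g - k * (b - a)%:C%C) <= 2 * M * (b - a).
Proof.
move=> ab hg H; rewrite -seg_int_cst // -seg_intB //; last exact: ccont_cst.
by apply: seg_int_le0 => //; apply: ccontB => //; exact: ccont_cst.
Qed.

End SegmentIntegral.

(** * Goursat's theorem *)

Section Goursat.
Variable R : realType.
Local Notation C := R[i].
Implicit Types (f : C -> C) (x y w h : R).

(** The integral of f(z) dz along the boundary of the rectangle,
    counterclockwise. *)
Definition rect_int f x0 x1 y0 y1 : C :=
  seg_int x0 x1 (fun x => f (x +i* y0)%C) - seg_int x0 x1 (fun x => f (x +i* y1)%C)
  + 'i%C * (seg_int y0 y1 (fun y => f (x1 +i* y)%C) - seg_int y0 y1 (fun y => f (x0 +i* y)%C)).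

Definition holo_rect f x0 x1 y0 y1 : Prop :=
  forall x y, x0 <= x <= x1 -> y0 <= y <= y1 -> exists d, cderiv f (x +i* y)%C d.

Lemma cabs_hor x x' y : cabs ((x +i* y)%C - (x' +i* y)%C) = `|x - x'|.
Proof. by rewrite -cabs_real; congr cabs; simpc. Qed.

Lemma cabs_ver x y y' : cabs ((x +i* y)%C - (x +i* y')%C) = `|y - y'|.
Proof.
rewrite -cabs_real -[RHS]mul1r -[1](@cabsi R) -cabsM; congr cabs; by simpc.
Qed.

Lemma holo_ccont_hor f x0 x1 y :
  (forall x, x0 <= x <= x1 -> exists d, cderiv f (x +i* y)%C d) ->
  ccont x0 x1 (fun x => f (x +i* y)%C).
Proof.
move=> H x xab e e0; have [d /cderiv_continuous/(_ e e0)[r r0 {}H]] := H x xab.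
by exists r => // t _ tx; apply: H; rewrite cabs_hor.
Qed.

Lemma holo_ccont_ver f x y0 y1 :
  (forall y, y0 <= y <= y1 -> exists d, cderiv f (x +i* y)%C d) ->
  ccont y0 y1 (fun y => f (x +i* y)%C).
Proof.
move=> H y xab e e0; have [d /cderiv_continuous/(_ e e0)[r r0 {}H]] := H y xab.
by exists r => // t _ tx; apply: H; rewrite cabs_ver.
Qed.

Definition edges f x0 x1 y0 y1 : Prop :=
  [/\ ccont x0 x1 (fun x => f (x +i* y0)%C), ccont x0 x1 (fun x => f (x +i* y1)%C),
      ccont y0 y1 (fun y => f (x0 +i* y)%C) & ccont y0 y1 (fun y => f (x1 +i* y)%C)].

Lemma rect_split_x f x0 x1 y0 y1 c : x0 <= c -> c <= x1 -> edges f x0 x1 y0 y1 ->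
  rect_int f x0 x1 y0 y1 = rect_int f x0 c y0 y1 + rect_int f c x1 y0 y1.
Proof.
move=> xc cx [h1 h2 _ _]; rewrite /rect_int (seg_int_split xc cx h1) (seg_int_split xc cx h2).
by ring.
Qed.

Lemma rect_split_y f x0 x1 y0 y1 c : y0 <= c -> c <= y1 -> edges f x0 x1 y0 y1 ->
  rect_int f x0 x1 y0 y1 = rect_int f x0 x1 y0 c + rect_int f x0 x1 c y1.
Proof.
move=> xc cx [_ _ h1 h2]; rewrite /rect_int (seg_int_split xc cx h1) (seg_int_split xc cx h2).
by ring.
Qed.

Lemma holo_edges f x0 x1 y0 y1 : x0 <= x1 -> y0 <= y1 -> holo_rect f x0 x1 y0 y1 ->
  edges f x0 x1 y0 y1.
Proof.
move=> xx yy H; split; (apply: holo_ccont_hor || apply: holo_ccont_ver) => t tt;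
  by apply: H; rewrite // ?lexx ?xx ?yy.
Qed.

Lemma holo_sub f x0 x1 y0 y1 a b c d : x0 <= a -> b <= x1 -> y0 <= c -> d <= y1 ->
  holo_rect f x0 x1 y0 y1 -> holo_rect f a b c d.
Proof.
move=> ha hb hc hd H x y /andP[xa xb] /andP[yc yd]; apply: H.
  by rewrite (le_trans ha) ?(le_trans xb).
by rewrite (le_trans hc) ?(le_trans yd).
Qed.

(** Affine functions integrate to 0 along the boundary, so that only the
    error e contributes. This is applied to f near a point of
    differentiability. *)
Lemma rect_int_affine f x0 x1 y0 y1 (k : C) e : x0 <= x1 -> y0 <= y1 -> 0 <= e ->
  edges f x0 x1 y0 y1 ->
  (exists z0 v : C, forall x y, x0 <= x <= x1 -> y0 <= y <= y1 ->
     cabs (f (x +i* y)%C - v - k * ((x +i* y)%C - z0)) <= e) ->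
  cabs (rect_int f x0 x1 y0 y1) <= 4 * e * ((x1 - x0) + (y1 - y0)).
Proof.
move=> xx yy e0 [h1 h2 h3 h4] [z0 [v H]].
rewrite /rect_int -!seg_intB //.
have A (p q z z' : C) : cabs (p - v - k * (z - z0)) <= e -> cabs (q - v - k * (z' - z0)) <= e ->
    cabs (p - q - k * (z - z')) <= 2 * e.
  move=> a b; have -> : p - q - k * (z - z') = (p - v - k * (z - z0)) - (q - v - k * (z' - z0)).
    by ring.
  by apply: (le_trans (cabsB _ _)); rewrite mulr_natl mulr2n lerD.
have y0in : y0 <= y0 <= y1 by rewrite lexx.
have y1in : y0 <= y1 <= y1 by rewrite lexx andbT.
have x0in : x0 <= x0 <= x1 by rewrite lexx.
have x1in : x0 <= x1 <= x1 by rewrite lexx andbT.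
have H1 := @seg_int_le _ x0 x1 _ (k * ('i%C * (y0 - y1)%:C%C)) (2 * e) xx (ccontB h1 h2) _.
have H2 := @seg_int_le _ y0 y1 _ (k * (x1 - x0)%:C%C) (2 * e) yy (ccontB h4 h3) _.
have {}H1 := H1 _; have {}H2 := H2 _.
set S1 := seg_int _ _ _ in H1 *; set S2 := seg_int _ _ _ in H2 *.
have -> : S1 + 'i%C * S2 = (S1 - k * ('i%C * (y0 - y1)%:C%C) * (x1 - x0)%:C%C)
   + 'i%C * (S2 - k * (x1 - x0)%:C%C * (y1 - y0)%:C%C).
  by rewrite !rmorphB /=; ring.
apply: (le_trans (cabsD _ _)); rewrite cabsM cabsi mul1r mulrDr.
have -> : 4 * e = 2 * (2 * e) by rewrite mulrA -natrM.
apply: lerD.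
  apply: H1 => x xin; have -> : 'i%C * (y0 - y1)%:C%C = (x +i* y0)%C - (x +i* y1)%C by simpc.
  by apply: A; apply: H.
apply: H2 => y yin; have -> : (x1 - x0)%:C%C = (x1 +i* y)%C - (x0 +i* y)%C by simpc.
by apply: A; apply: H.
Qed.

(** The rectangle is scaled by s, and a scaled copy is bad when its boundary
    integral is at least c s^2, a bound proportional to its area. One of the
    four quarters of a bad rectangle is bad; nested bad rectangles shrink to
    a point, at which differentiability forces c <= 0. *)
Section Bisection.
Variables (f : C -> C) (x0 y0 w h : R).
Hypotheses (w0 : 0 <= w) (h0 : 0 <= h) (Hf : holo_rect f x0 (x0 + w) y0 (y0 + h)).

Let phi (s : R) (p : R * R) := rect_int f p.1 (p.1 + w * s) p.2 (p.2 + h * s).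
Let inside (s : R) (p : R * R) :=
  [/\ x0 <= p.1, p.1 + w * s <= x0 + w, y0 <= p.2 & p.2 + h * s <= y0 + h].

Variable c : R.
Let bad s p := inside s p /\ c * s ^+ 2 <= cabs (phi s p).

Let quarter s p : set (R * R) := fun q => [/\ bad (s / 2) q,
   p.1 <= q.1, q.1 + w * (s / 2) <= p.1 + w * s,
   p.2 <= q.2 & q.2 + h * (s / 2) <= p.2 + h * s].

Lemma bad_quarter s p : 0 <= s -> bad s p -> exists q, quarter s p q.
Proof.
move=> s0 [[i1 i2 i3 i4] hc].
case: p => a b /= in i1 i2 i3 i4 hc *.
pose wa := w * (s / 2); pose ha := h * (s / 2).
have wa0 : 0 <= wa by rewrite mulr_ge0 ?divr_ge0.
have ha0 : 0 <= ha by rewrite mulr_ge0 ?divr_ge0.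
have wE : w * s = wa + wa by rewrite /wa -mulrDr -splitr.
have hE : h * s = ha + ha by rewrite /ha -mulrDr -splitr.
have H' : holo_rect f a (a + w * s) b (b + h * s) by apply: holo_sub Hf.
have aw : a <= a + wa by rewrite lerDl.
have aw2 : a + wa <= a + w * s by rewrite wE addrA lerDl.
have bh : b <= b + ha by rewrite lerDl.
have bh2 : b + ha <= b + h * s by rewrite hE addrA lerDl.
have E : phi s (a, b) = phi (s/2) (a, b) + phi (s/2) (a, b + ha) +
   (phi (s/2) (a + wa, b) + phi (s/2) (a + wa, b + ha)).
  rewrite /phi /= (rect_split_x aw aw2); last first.
    by apply: holo_edges => //; [exact: le_trans aw aw2 | exact: le_trans bh bh2].
  rewrite (rect_split_y bh bh2); last first.
    by apply: holo_edges => //; [exact: le_trans bh bh2 | exact: holo_sub H'].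
  rewrite (rect_split_y bh bh2); last first.
    by apply: holo_edges => //; [exact: le_trans bh bh2 | exact: holo_sub H'].
  by rewrite -/wa -/ha !wE !hE !addrA.
have [H4|H4] := pselect (exists q, q \in [:: (a, b); (a, b + ha); (a + wa, b); (a + wa, b + ha)] /\
    c * (s / 2) ^+ 2 <= cabs (phi (s/2) q)); last first.
  exfalso; suff : cabs (phi s (a, b)) < c * s ^+ 2 by rewrite ltNge hc.
  have K q : q \in [:: (a, b); (a, b + ha); (a + wa, b); (a + wa, b + ha)] ->
     cabs (phi (s/2) q) < c * (s / 2) ^+ 2.
    by move=> qin; rewrite ltNge; apply/negP => ?; apply: H4; exists q.
  rewrite E; apply: (le_lt_trans (cabsD _ _)).
  apply: (le_lt_trans (lerD (cabsD _ _) (cabsD _ _))).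
  have -> : c * s ^+ 2 = c * (s / 2) ^+ 2 + c * (s / 2) ^+ 2 + (c * (s / 2) ^+ 2 + c * (s / 2) ^+ 2).
    by field.
  by do ?apply: ltrD; apply: K; rewrite !inE ?eqxx ?orbT.
case: H4 => q [qin qb]; exists q.
have [] : [/\ a <= q.1, q.1 + wa <= a + w * s, b <= q.2 & q.2 + ha <= b + h * s].
  rewrite !inE in qin; case/or4P: qin => /eqP -> /=; split => //;
    by rewrite ?wE ?hE ?addrA.
move=> q1 q2 q3 q4; split => //; split => //; split.
- exact: le_trans q1.
- exact: le_trans i2.
- exact: le_trans q3.
- exact: le_trans i4.
Qed.

Hypothesis bad0 : bad 1 (x0, y0).

Let sc (n : nat) : R := 2^-1 ^+ n.
Let nextp s p := xget p (quarter s p).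
Let pt := fix pt n := if n is m.+1 then nextp (sc m) (pt m) else (x0, y0).

Let sc_ge0 n : 0 <= sc n. Proof. by rewrite exprn_ge0 // invr_ge0. Qed.
Let scS n : sc n.+1 = sc n / 2. Proof. by rewrite /sc exprS mulrC. Qed.

Lemma pt_spec n : bad (sc n) (pt n) /\
  [/\ (pt n).1 <= (pt n.+1).1, (pt n.+1).1 + w * sc n.+1 <= (pt n).1 + w * sc n,
      (pt n).2 <= (pt n.+1).2 & (pt n.+1).2 + h * sc n.+1 <= (pt n).2 + h * sc n].
Proof.
have step m : bad (sc m) (pt m) -> quarter (sc m) (pt m) (pt m.+1).
  by move=> /(bad_quarter (sc_ge0 m)) [q Hq]; exact: (xgetI (pt m) Hq).
have B m : bad (sc m) (pt m).
  by elim: m => [|m /step[]]; [rewrite /sc expr0 | rewrite scS].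
by split => //; have [_] := step n (B n); rewrite scS.
Qed.

Lemma nested (u l : nat -> R) : (forall n, u n <= u n.+1) -> (forall n, 0 <= l n) ->
  (forall n, u n.+1 + l n.+1 <= u n + l n) ->
  exists x, forall n, u n <= x <= u n + l n.
Proof.
move=> hu l0 hl.
have ud n k : u n <= u (n + k)%N.
  by elim: k => [|k IH]; rewrite ?addn0 // addnS (le_trans IH).
have ld n k : u (n + k)%N + l (n + k)%N <= u n + l n.
  by elim: k => [|k IH]; rewrite ?addn0 // addnS (le_trans (hl _)).
have ub n : ubound (range u) (u n + l n).
  move=> _ [m _ <-]; have [nm|mn] := leqP n m.
    by have := ld n (m - n)%N; rewrite subnKC //; apply: le_trans; rewrite lerDl.
  by have := ud m (n - m)%N; rewrite subnKC ?(ltnW mn) // => /le_trans -> //; rewrite lerDl.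
exists (sup (range u)) => n; apply/andP; split.
  by apply: ub_le_sup; [exists (u 0%N + l 0%N); exact: ub | exists n].
by apply: ge_sup; [exists (u 0%N); exists 0%N | exact: ub].
Qed.

Lemma bad_le0 : c <= 0.
Proof.
rewrite leNgt; apply/negP => c0.
have [x Hx] : exists x, forall n, (pt n).1 <= x <= (pt n).1 + w * sc n.
  apply: (@nested (fun n => (pt n).1) (fun n => w * sc n)) => n.
  - by have [_ []] := pt_spec n.
  - by rewrite mulr_ge0.
  - by have [_ []] := pt_spec n.
have [y Hy] : exists y, forall n, (pt n).2 <= y <= (pt n).2 + h * sc n.
  apply: (@nested (fun n => (pt n).2) (fun n => h * sc n)) => n.
  - by have [_ []] := pt_spec n.
  - by rewrite mulr_ge0.
  - by have [_ []] := pt_spec n.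
have [d Hd] : exists d, cderiv f (x +i* y)%C d.
  apply: Hf; [have := Hx 0%N | have := Hy 0%N]; by rewrite /sc /= expr0 !mulr1.
have wh : 0 <= w + h by rewrite addr_ge0.
pose e := c / 8 / (1 + (w + h) ^+ 2).
have K0 : 0 < 1 + (w + h) ^+ 2 by rewrite ltr_pwDl ?sqr_ge0.
have e0 : 0 < e by rewrite /e !divr_gt0.
have [r r0 Hr] := Hd e e0.
have [n Hn] : exists n, (w + h) * sc n < r.
  have : (2^-1 ^+ n : R) @[n --> \oo] --> (0 : R).
    by apply: cvg_expr; rewrite ger0_norm ?invr_ge0 // invf_lt1 // ltr1n.
  move=> /cvgrPdist_lt /(_ (r / (1 + (w + h)))); rewrite divr_gt0 ?ltr_pwDl //.
  move=> /(_ isT) [N _ HN]; exists N; have /= := HN N (leqnn N).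
  rewrite sub0r normrN ger0_norm ?sc_ge0 // ltr_pdivlMr ?ltr_pwDl // => H.
  by apply: le_lt_trans H; rewrite mulrC ler_wpM2l ?sc_ge0 // lerDr.
have [[[i1 i2 i3 i4] Hb] _] := pt_spec n.
have H' : holo_rect f (pt n).1 ((pt n).1 + w * sc n) (pt n).2 ((pt n).2 + h * sc n).
  by apply: holo_sub Hf.
have ws0 : 0 <= w * sc n by rewrite mulr_ge0.
have hs0 : 0 <= h * sc n by rewrite mulr_ge0.
have xx : (pt n).1 <= (pt n).1 + w * sc n by rewrite lerDl.
have yy : (pt n).2 <= (pt n).2 + h * sc n by rewrite lerDl.
have E0 : 0 <= e * ((w + h) * sc n) by apply: mulr_ge0; [exact: ltW | exact: mulr_ge0].
have := @rect_int_affine f _ _ _ _ d (e * ((w + h) * sc n)) xx yy E0 (holo_edges xx yy H') _.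
have KK : exists z0 v : C, forall t u : R, (pt n).1 <= t <= (pt n).1 + w * sc n ->
   (pt n).2 <= u <= (pt n).2 + h * sc n ->
   cabs (f (t +i* u)%C - v - d * ((t +i* u)%C - z0)) <= e * ((w + h) * sc n).
  exists (x +i* y)%C, (f (x +i* y)%C) => t u /andP[t1 t2] /andP[u_per u2].
  have D : cabs ((t +i* u)%C - (x +i* y)%C) <= (w + h) * sc n.
    have -> : (t +i* u)%C - (x +i* y)%C = ((t - x) +i* (u - y))%C by simpc.
    apply: (le_trans (cabs_mk _ _)); rewrite mulrDl lerD //.
      have /andP[x1 x2] := Hx n.
      by rewrite ler_norml; apply/andP; split; lra.
    have /andP[x1 x2] := Hy n.
    by rewrite ler_norml; apply/andP; split; lra.
  apply: (le_trans (Hr _ _)); first exact: le_lt_trans D Hn.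
  by rewrite ler_wpM2l // ltW.
move=> /(_ KK); rewrite leNgt => /negP; apply; apply: lt_le_trans Hb.
have -> : (pt n).1 + w * sc n - (pt n).1 + ((pt n).2 + h * sc n - (pt n).2) = (w + h) * sc n by ring.
have -> : 4 * (e * ((w + h) * sc n)) * ((w + h) * sc n) =
    c * sc n ^+ 2 * (2^-1 * ((w + h) ^+ 2 / (1 + (w + h) ^+ 2))).
  rewrite /e; field; by rewrite gt_eqF.
rewrite gtr_pMr; last by rewrite mulr_gt0 // exprn_gt0 // exprn_gt0 // invr_gt0.
rewrite mulrC ltr_pdivrMr // mul1r.
apply: (@le_lt_trans _ _ 1); last by rewrite ltr1n.
by rewrite ler_pdivrMr // mul1r lerDr.
Qed.

End Bisection.

(** Nothing is known about the continuity of the derivative, so the integral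
    is controlled by bisection, with c its modulus over the whole rectangle. *)
Lemma goursat f x0 x1 y0 y1 : x0 <= x1 -> y0 <= y1 -> holo_rect f x0 x1 y0 y1 ->
  rect_int f x0 x1 y0 y1 = 0.
Proof.
move=> xx yy H; apply/eqP; rewrite -cabs_eq0 eq_le cabs_ge0 andbT.
apply: (@bad_le0 f x0 y0 (x1 - x0) (y1 - y0)); rewrite ?subr_ge0 //.
  by rewrite !subrKC.
by rewrite /= !mulr1 !subrKC expr1n mulr1; split => //; split.
Qed.

End Goursat.

(** * The covering of the punctured disk *)

Section Covering.
Variable R : realType.
Local Notation C := R[i].

Lemma coveringE (x y : R) : covering (x +i* y)%C =
  ((expR (- (2 * pi * y)) * cos (2 * pi * x)) +i* (expR (- (2 * pi * y)) * sin (2 * pi * x)))%C.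
Proof. by rewrite /covering /=; simpc. Qed.

Lemma coveringD (z w : C) : covering (z + w) = covering z * covering w.
Proof.
case: z w => [x y] [x' y']; rewrite -[(x +i* y)%C + _]/((x + x') +i* (y + y'))%C !coveringE; simpc.
rewrite !mulrDr opprD expRD cosD sinD; congr (_ +i* _)%C; ring.
Qed.

Lemma cabs_covering (z : C) : cabs (covering z) = expR (- (2 * pi * complex.Im z)).
Proof.
rewrite /covering cabsM cabs_real ger0_norm ?expR_ge0 //.
by rewrite /cabs normc_def /= cos2Dsin2 sqrtr1 mulr1.
Qed.

Lemma covering0 : covering 0 = 1 :> C.
Proof. by rewrite -[0 : C]/(0 +i* 0)%C coveringE !mulr0 oppr0 expR0 cos0 sin0 !mul1r. Qed.

Lemma covering1 : covering 1 = 1 :> C.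
Proof.
rewrite -[1 : C]/(1 +i* 0)%C coveringE !mulr0 oppr0 expR0 mulr1 !mul1r.
by rewrite mulr_natl cos2pi sin2pi.
Qed.

Lemma coveringDr1 (z : C) : covering (z + 1) = covering z.
Proof. by rewrite coveringD covering1 mulr1. Qed.

(** Isolates the pole of the periodic kernels below in a strip of width one. *)
Lemma covering_eq1 (x y : R) : `|x| <= 2^-1 -> covering (x +i* y)%C = 1 -> x = 0 /\ y = 0.
Proof.
have p2 : (2 * pi == 0 :> R) = false.
  by apply/negbTE; rewrite gt_eqF // mulr_gt0 // pi_gt0.
move=> hx E; have := congr1 (@cabs R) E; rewrite cabs_covering /= cabs1 => hy.
have {hy}y0 : y = 0.
  have /expR_inj/eqP : expR (- (2 * pi * y)) = expR 0 by rewrite hy expR0.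
  by rewrite oppr_eq0 mulf_eq0 p2 /= => /eqP.
split => //; move: E; rewrite y0 coveringE mulr0 oppr0 expR0 !mul1r => -[hc _].
apply/normr0_eq0; have p0 := @pi_gt0 R.
have : 2 * pi * `|x| = 0.
  apply: cos_inj; rewrite ?in_itv /= ?lexx ?(ltW p0) //.
    rewrite !mulr_ge0 ?(ltW p0) //=.
    by have := ler_wpM2l (ltW p0) hx; lra.
  rewrite cos0; transitivity (cos `|2 * pi * x|); last by rewrite cos_norm.
  by rewrite normrM ger0_norm // mulr_ge0 // ltW.
by move=> /eqP; rewrite mulf_eq0 p2 => /eqP.
Qed.

Lemma real_derive (g : R -> R) (x d : R) : is_derive x 1 g d ->
  forall e, 0 < e -> exists2 r : R, 0 < r &
    forall t, `|t| < r -> `|g (x + t) - g x - d * t| <= e * `|t|.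
Proof.
move=> [/cvg_ex[l Hl] Hd] e e0.
have dl : d = l by rewrite -Hd; apply: cvg_lim Hl; exact: norm_hausdorff.
have /cvgrPdist_le/(_ e e0) := Hl; rewrite near_withinE => /nbhs_ballP[r r0 H].
exists r => // t tr; have [->|t0] := eqVneq t 0; first by rewrite addr0 subrr mulr0 subr0 normr0 mulr0.
have := H t; rewrite /ball /= sub0r normrN => /(_ tr t0).
have E : (t *: (1 : R^o) : R^o) = t by rewrite /GRing.scale /= mulr1.
rewrite E -(ler_pM2r (_ : 0 < `|t|)) ?normr_gt0 // -normrM mulrBl /GRing.scale /=.
by rewrite mulrAC mulVf // mul1r -dl [t + x]addrC distrC.
Qed.

(** Assembled from the derivatives at 0 of the real exponential, cosine and
    sine; the constant 5 + K collects the error terms of the product. *)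
Lemma cderiv_covering0 : cderiv (@covering R) 0 (0 +i* (2 * pi))%C.
Proof.
set K : R := 2 * pi.
have K0 : 0 < K by rewrite mulr_gt0 // pi_gt0.
have scale (g : R -> R) (k d : R) : is_derive (0 : R) 1 g d ->
    is_derive (0 : R) 1 (fun y => g (k * y)) (d * k).
  move=> Hg; have H : is_derive (0 : R) 1 (fun y => k *: (y : R^o) : R^o) (k *: 1) by exact: is_deriveZ.
  have H1 : is_derive (k *: (0 : R^o)) 1 g d by rewrite scaler0.
  by have := is_derive1_comp H1 H; rewrite /GRing.scale /= mulr1.
have gE := scale _ (- K) _ (is_derive_expR (0 : R)).
have gC := scale _ K _ (is_derive_cos (0 : R)).
have gS := scale _ K _ (is_derive_sin (0 : R)).
rewrite expR0 mul1r in gE; rewrite sin0 oppr0 mul0r in gC; rewrite cos0 mul1r in gS.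
move=> e e0; pose e' := Order.min 1 (e / (5 + K)).
have K4 : 0 < 5 + K by rewrite addr_gt0.
have e'0 : 0 < e' by rewrite lt_min ltr01 divr_gt0.
have [r1 r10 H1] := real_derive gE e'0.
have [r2 r20 H2] := real_derive gC e'0.
have [r3 r30 H3] := real_derive gS e'0.
exists (Order.min (Order.min r1 (Order.min r2 r3)) (Order.min 1 e' / (1 + K))).
  rewrite !lt_min r10 r20 r30 /=; apply: divr_gt0; first by rewrite lt_min ltr01.
  by rewrite ltr_pwDl // ltW.
case=> x y; rewrite subr0 covering0 lt_min 2!lt_min => /andP[/and3P[t1 t2 t3] t4].
set n := cabs _ in t1 t2 t3 t4 *.
have nx : `|x| <= n by exact: (@cabs_Re _ (x +i* y)%C).
have ny : `|y| <= n by exact: (@cabs_Im _ (x +i* y)%C).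
have n0 : 0 <= n by exact: cabs_ge0.
have {}H1 := H1 y (le_lt_trans ny t1); have {}H2 := H2 x (le_lt_trans nx t2).
have {}H3 := H3 x (le_lt_trans nx t3).
rewrite add0r mulr0 expR0 [X in expR X]mulNr in H1; rewrite add0r mulr0 cos0 mul0r subr0 in H2.
rewrite add0r mulr0 sin0 subr0 in H3.
rewrite coveringE -/K; clearbody K.
set E := expR _ in H1 *; set c := cos _ in H2 *; set s := sin _ in H3 *.
have -> : ((E * c) +i* (E * s))%C - 1 - (0 +i* K)%C * (x +i* y)%C =
   ((E - 1 - - K * y + E * (c - 1)) +i* (E * (s - K * x) + (E - 1) * (K * x)))%C.
  rewrite /GRing.scale /=; simpc.
  by apply/eqP; rewrite eq_complex /=; apply/andP; split; apply/eqP; ring.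
apply: (le_trans (cabs_mk _ _)).
have e'1 : e' <= 1 by rewrite ge_min lexx.
have e'e : e' * (5 + K) <= e by rewrite -ler_pdivlMr // ge_min lexx orbT.
have n1 : n * (1 + K) < 1 by move: t4; rewrite ltr_pdivlMr ?ltr_pwDl ?ltW // lt_min => /andP[].
have n2 : n * (1 + K) < e' by move: t4; rewrite ltr_pdivlMr ?ltr_pwDl ?ltW // lt_min => /andP[].
have B1 : `|E - 1 - - K * y| <= e' * n by apply: (le_trans H1); rewrite ler_wpM2l // ltW.
have B2 : `|c - 1| <= e' * n by apply: (le_trans H2); rewrite ler_wpM2l // ltW.
have B3 : `|s - K * x| <= e' * n by apply: (le_trans H3); rewrite ler_wpM2l // ltW.
have BE : `|E - 1| <= n * (1 + K).
  have -> : E - 1 = (E - 1 - - K * y) + - K * y by rewrite subrK.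
  apply: (le_trans (ler_normD _ _)); rewrite normrM normrN (gtr0_norm K0) mulrDr mulr1 [n * K]mulrC.
  by apply: lerD; [apply: (le_trans B1); rewrite ler_piMl | rewrite ler_wpM2l // ltW].
have BE2 : `|E| <= 2.
  have -> : E = (E - 1) + 1 by rewrite subrK.
  by apply: (le_trans (ler_normD _ _)); rewrite normr1; apply: lerD => //; rewrite ltW // (le_lt_trans BE).
apply: (@le_trans _ _ ((e' * n + 2 * (e' * n)) + (2 * (e' * n) + e' * (K * n)))).
  apply: lerD; apply: (le_trans (ler_normD _ _)); apply: lerD; rewrite ?normrM //.
  - by rewrite ler_pM.
  - by rewrite ler_pM.
  - rewrite (gtr0_norm K0) ler_pM ?mulr_ge0 ?(ltW K0) ?ler_wpM2l ?(ltW K0) //.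
    exact: ltW (le_lt_trans BE n2).
have -> : e' * n + 2 * (e' * n) + (2 * (e' * n) + e' * (K * n)) = (e' * (5 + K)) * n by ring.
by rewrite ler_wpM2r.
Qed.

(** The functional equation carries the derivative at 0 to every point. *)
Lemma cderiv_covering z : cderiv (@covering R) z ((0 +i* (2 * pi))%C * covering z).
Proof.
have H1 : cderiv (fun t : C => t - z) z 1.
  by rewrite -[1]subr0; apply: cderivB; [exact: cderiv_id | exact: cderiv_cst].
have H2 := cderiv_comp H1 (_ : cderiv (@covering R) (z - z) _).
have {}H2 := H2 (0 +i* (2 * pi))%C; rewrite subrr in H2.
have {}H2 := H2 cderiv_covering0.
have := cderivM (cderiv_cst (covering z) z) H2.
rewrite mul0r add0r mulr1 mulrC.
have -> // : (fun t => covering z * covering (t - z)) = @covering R.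
by apply/funext => t; rewrite -coveringD subrKC.
Qed.

End Covering.

(** * Decay of periodic holomorphic functions *)

Section Decay.
Variable R : realType.
Local Notation C := R[i].

Lemma rect_int_bound (f : C -> C) x0 x1 y0 y1 M : x0 <= x1 -> y0 <= y1 ->
  edges f x0 x1 y0 y1 ->
  (forall x, x0 <= x <= x1 -> cabs (f (x +i* y0)%C) <= M /\ cabs (f (x +i* y1)%C) <= M) ->
  (forall y, y0 <= y <= y1 -> cabs (f (x0 +i* y)%C) <= M /\ cabs (f (x1 +i* y)%C) <= M) ->
  cabs (rect_int f x0 x1 y0 y1) <= 4 * M * ((x1 - x0) + (y1 - y0)).
Proof.
move=> xx yy [h1 h2 h3 h4] Hx Hy; rewrite /rect_int.
have A1 := seg_int_le0 xx h1 (fun x xin => (Hx x xin).1).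
have A2 := seg_int_le0 xx h2 (fun x xin => (Hx x xin).2).
have A3 := seg_int_le0 yy h3 (fun x xin => (Hy x xin).1).
have A4 := seg_int_le0 yy h4 (fun x xin => (Hy x xin).2).
apply: (le_trans (cabsD _ _)); rewrite cabsM cabsi mul1r.
apply: (le_trans (lerD (cabsB _ _) (cabsB _ _))).
by lra.
Qed.

(** Away from the singular point every subrectangle is filled by holomorphy, so
    only the small square around it can contribute. *)
Lemma rect_int_shrink (G : C -> C) (a b y1 y2 p q r : R) : 0 < r ->
  a <= p - r -> p + r <= b -> y1 <= q - r -> q + r <= y2 ->
  (forall x y, a <= x <= b -> y1 <= y <= y2 -> (x, y) <> (p, q) ->
     exists d, cderiv G (x +i* y)%C d) ->
  edges G (p - r) (p + r) (q - r) (q + r) /\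
  rect_int G a b y1 y2 = rect_int G (p - r) (p + r) (q - r) (q + r).
Proof.
move=> r0 ap pb yq qy HG.
have sub (x0 x1 v0 v1 : R) : a <= x0 -> x1 <= b -> y1 <= v0 -> v1 <= y2 ->
    [\/ x1 < p, p < x0, v1 < q | q < v0] -> holo_rect G x0 x1 v0 v1.
  move=> ax xb yv vy out x y /andP[xl xr] /andP[yl yr]; apply: HG.
  - by rewrite (le_trans ax xl) (le_trans xr xb).
  - by rewrite (le_trans yv yl) (le_trans yr vy).
  by case=> xp yp; move: xl xr yl yr; rewrite xp yp !leNgt; case: out => ->.
have EE (x0 x1 v0 v1 : R) : a <= x0 -> x0 <= x1 -> x1 <= b -> y1 <= v0 -> v0 <= v1 -> v1 <= y2 ->
    (x0 < p \/ p < x0) -> (x1 < p \/ p < x1) -> (v0 < q \/ q < v0) -> (v1 < q \/ q < v1) ->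
    edges G x0 x1 v0 v1.
  move=> ax xx xb yv vv vy N1 N2 N3 N4.
  have [ax1 x0b] := (le_trans ax xx, le_trans xx xb); have [yv1 v0y] := (le_trans yv vv, le_trans vv vy).
  split.
  - apply: holo_ccont_hor => x xin; apply: (@sub x0 x1 v0 v0) => //; last by rewrite lexx.
    by case: N3 => h; [apply: Or43 | apply: Or44].
  - apply: holo_ccont_hor => x xin; apply: (@sub x0 x1 v1 v1) => //; last by rewrite lexx.
    by case: N4 => h; [apply: Or43 | apply: Or44].
  - apply: holo_ccont_ver => x xin; apply: (@sub x0 x0 v0 v1) => //; last by rewrite lexx.
    by case: N1 => h; [apply: Or41 | apply: Or42].
  - apply: holo_ccont_ver => x xin; apply: (@sub x1 x1 v0 v1) => //; last by rewrite lexx.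
    by case: N2 => h; [apply: Or41 | apply: Or42].
have pl : p - r < p by rewrite ltrBlDr ltrDl.
have pu : p < p + r by rewrite ltrDl.
have ql : q - r < q by rewrite ltrBlDr ltrDl.
have qu : q < q + r by rewrite ltrDl.
have pp := ltW (lt_trans pl pu); have qq := ltW (lt_trans ql qu).
have ap' := le_trans ap pp; have pb' := le_trans pp pb; have ab := le_trans ap pb'.
have yq' := le_trans yq qq; have qy' := le_trans qq qy; have yy := le_trans yq qy'.
have lo := ltW (le_lt_trans yq ql).
split; first by apply: EE => //; [left | right | left | right].
have y1q := le_lt_trans yq ql; have qy2 := lt_le_trans qu qy.
have bp := lt_le_trans pu pb; have pa := le_lt_trans ap pl.
rewrite (@rect_split_x _ G a b y1 y2 (p - r)) ?ap //; last first.
  by apply: EE => //; [left | right | left | right].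
rewrite (@goursat _ G a (p - r)) ?add0r //; last by apply: sub => //; apply: Or41.
rewrite (@rect_split_x _ G (p - r) b y1 y2 (p + r)) //; last first.
  by apply: EE => //; [left | right | left | right].
rewrite [X in _ + X](@goursat _ G (p + r) b) ?addr0 //; last by apply: sub => //; apply: Or42.
rewrite (@rect_split_y _ G (p - r) (p + r) y1 y2 (q - r)) //; last first.
  by apply: EE => //; [left | right | left | right].
rewrite (@goursat _ G (p - r) (p + r) y1 (q - r)) ?add0r //; last by apply: sub => //; apply: Or43.
rewrite (@rect_split_y _ G (p - r) (p + r) (q - r) y2 (q + r)) //; last first.
  by apply: EE => //; [left | right | left | right].
rewrite [X in _ + X](@goursat _ G (p - r) (p + r) (q + r) y2) ?addr0 //.
by apply: sub => //; apply: Or44.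
Qed.

(** The vertical sides of a period rectangle cancel, so that the mean of a
    periodic function over a horizontal period does not depend on the
    height, even across a point where only (z - w) G(z) -> 0 is known. *)
Lemma mean_eq (G : C -> C) (p q y1 y2 : R) : y1 < q < y2 ->
  (forall x y, `|x - p| <= 2^-1 -> y1 <= y <= y2 -> (x, y) <> (p, q) ->
     exists d, cderiv G (x +i* y)%C d) ->
  (forall y, y1 <= y <= y2 -> G ((p - 2^-1) +i* y)%C = G ((p + 2^-1) +i* y)%C) ->
  (forall e, 0 < e -> exists2 r : R, 0 < r & forall z : C, 0 < cabs (z - (p +i* q)%C) < r ->
      cabs ((z - (p +i* q)%C) * G z) <= e) ->
  seg_int (p - 2^-1) (p + 2^-1) (fun x => G (x +i* y1)%C) =
  seg_int (p - 2^-1) (p + 2^-1) (fun x => G (x +i* y2)%C).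
Proof.
move=> /andP[y1q qy2] HG Hper Hsing.
set a := p - 2^-1; set b := p + 2^-1.
have h20 : 0 < 2^-1 :> R by rewrite invr_gt0.
suff E : rect_int G a b y1 y2 = 0.
  move: E; rewrite /rect_int.
  have -> : seg_int y1 y2 (fun y => G (b +i* y)%C) = seg_int y1 y2 (fun y => G (a +i* y)%C).
    by apply: eq_seg_int => y yin; rewrite Hper.
  by rewrite subrr mulr0 addr0 => /eqP; rewrite subr_eq0 => /eqP.
apply/eqP; rewrite -cabs_eq0 eq_le cabs_ge0 andbT; apply/ler_addgt0Pr => e e0.
rewrite add0r.
(* 16 n is the constant of rect_int_bound on a square of half side n *)
have e16 : 0 < e / 16 by rewrite divr_gt0.
have [r r0 Hr] := Hsing _ e16.
pose n := Order.min (Order.min 2^-1 (r / 3)) (Order.min (q - y1) (y2 - q)).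
have n0 : 0 < n by rewrite !lt_min h20 divr_gt0 // !subr_gt0 y1q.
have n1 : n <= 2^-1 by rewrite /n !ge_min lexx.
have n2 : n <= r / 3 by rewrite /n !ge_min lexx orbT.
have n3 : n <= q - y1 by rewrite /n !ge_min lexx !orbT.
have n4 : n <= y2 - q by rewrite /n !ge_min lexx !orbT.
clearbody n.
have [Ed ->] : edges G (p - n) (p + n) (q - n) (q + n) /\
    rect_int G a b y1 y2 = rect_int G (p - n) (p + n) (q - n) (q + n).
  apply: rect_int_shrink; rewrite /a /b ?lerD2l ?lerN2 //.
  - by rewrite lerBrDr -lerBrDl.
  - by rewrite -lerBrDl.
  - by move=> x y xin; apply: HG; rewrite ler_distl.
have B (x y : R) : `|x - p| <= n -> `|y - q| <= n -> n <= `|x - p| \/ n <= `|y - q| ->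
    cabs (G (x +i* y)%C) <= e / 16 / n.
  move=> hx hy hn; have nn : n <= cabs ((x +i* y)%C - (p +i* q)%C).
    have -> : (x +i* y)%C - (p +i* q)%C = ((x - p) +i* (y - q))%C by simpc.
    case: hn => /le_trans; apply; first exact: (@cabs_Re _ (_ +i* _)%C).
    exact: (@cabs_Im _ (_ +i* _)%C).
  have nr : cabs ((x +i* y)%C - (p +i* q)%C) < r.
    have -> : (x +i* y)%C - (p +i* q)%C = ((x - p) +i* (y - q))%C by simpc.
    by apply: (le_lt_trans (cabs_mk _ _)); lra.
  have := Hr (x +i* y)%C; rewrite nr (lt_le_trans n0 nn) cabsM => /(_ isT) H.
  rewrite ler_pdivlMr // (le_trans _ H) // mulrC ler_wpM2r ?cabs_ge0 //.
have := @rect_int_bound G (p - n) (p + n) (q - n) (q + n) (e / 16 / n) _ _ _ _ _.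
have -> : 4 * (e / 16 / n) * (p + n - (p - n) + (q + n - (q - n))) = e.
  by field; rewrite gt_eqF.
have nn : `|n| = n by rewrite gtr0_norm.
have [pp qq] : p - n <= p + n /\ q - n <= q + n by split; rewrite lerBlDr -addrA lerDl addr_ge0 // ltW.
apply=> //.
- move=> x xin; split; apply: B; rewrite ?ler_distl //; try right.
  + by rewrite lexx.
  + by rewrite addrAC subrr add0r normrN nn.
  + by rewrite qq lexx.
  + by rewrite addrAC subrr add0r nn.
- move=> y yin; split; apply: B; rewrite ?ler_distl //; try left.
  + by rewrite lexx.
  + by rewrite addrAC subrr add0r normrN nn.
  + by rewrite pp lexx.
  + by rewrite addrAC subrr add0r nn.
Qed.

End Decay.

Section Decay2.
Variable R : realType.
Local Notation C := R[i].
Local Notation Im := complex.Im.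
Local Notation Re := complex.Re.
Let K : R := 2 * pi.
Let K0 : 0 < K. Proof. by rewrite mulr_gt0 // pi_gt0. Qed.
Let K4 : 4 <= K. Proof. have := @pi_ge2 R; rewrite /K; lra. Qed.

(** The mean over a period is close to L high up, and at most 2 B on the
    bottom line; by [mean_eq] these are the same mean. *)
Lemma top_le_bottom (G : C -> C) (w L : C) (y1 B : R) : y1 < Im w ->
  (forall z : C, y1 <= Im z -> covering (z - w) <> 1 -> exists d, cderiv G z d) ->
  (forall z : C, G (z + 1) = G z) ->
  (forall e, 0 < e -> exists2 r : R, 0 < r & forall z : C, 0 < cabs (z - w) < r ->
      cabs ((z - w) * G z) <= e) ->
  (forall z : C, Im z = y1 -> cabs (G z) <= B) ->
  (forall e, 0 < e -> exists Y : R, forall z : C, Y < Im z -> cabs (G z - L) <= e) ->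
  cabs L <= 2 * B.
Proof.
case: w => p q /= y1q HG Hper Hsing HB HL.
apply/ler_addgt0Pr => e e0.
have e2 : 0 < e / 2 by rewrite divr_gt0.
have [Y HY] := HL _ e2.
pose y2 := Order.max Y q + 1.
have qy2 : q < y2 by rewrite /y2 ltr_pwDr // le_max lexx orbT.
have Yy2 : Y < y2 by rewrite /y2 ltr_pwDr // le_max lexx.
have H0 x y : `|x - p| <= 2^-1 -> y1 <= y -> (x, y) <> (p, q) -> exists d, cderiv G (x +i* y)%C d.
  move=> hx hy hxy; apply: HG => //= E; apply: hxy.
  have [] := @covering_eq1 R (x - p) (y - q) hx.
    by rewrite -E; congr covering; simpc.
  by move=> /eqP; rewrite subr_eq0 => /eqP -> /eqP; rewrite subr_eq0 => /eqP ->.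
have Hm : seg_int (p - 2^-1) (p + 2^-1) (fun x => G (x +i* y1)%C) =
          seg_int (p - 2^-1) (p + 2^-1) (fun x => G (x +i* y2)%C).
  apply: (@mean_eq _ _ p q) => //; first by rewrite y1q.
    by move=> x y hx /andP[hy _]; exact: H0.
  move=> y _; have -> : ((p + 2^-1) +i* y)%C = ((p - 2^-1) +i* y)%C + 1.
    by rewrite -[1 : C]/(1 +i* 0)%C; simpc; congr (_ +i* _)%C; field.
  by rewrite Hper.
have ab : p - 2^-1 <= p + 2^-1 by lra.
have len : p + 2^-1 - (p - 2^-1) = 1 by field.
have win x : p - 2^-1 <= x <= p + 2^-1 -> `|x - p| <= 2^-1.
  by move=> /andP[? ?]; rewrite ler_norml; apply/andP; split; lra.
have C1 : ccont (p - 2^-1) (p + 2^-1) (fun x => G (x +i* y1)%C).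
  by apply: holo_ccont_hor => x /win xin; apply: H0 => //; case => _ ?; lra.
have C2 : ccont (p - 2^-1) (p + 2^-1) (fun x => G (x +i* y2)%C).
  by apply: holo_ccont_hor => x /win xin; apply: H0 => //; [lra | case => _ ?; lra].
have I1 := seg_int_le0 ab C1 (fun x _ => HB (x +i* y1)%C erefl).
have I2 := seg_int_le ab C2 (fun x _ => HY (x +i* y2)%C Yy2).
rewrite len Hm !mulr1 in I1 I2.
set S := seg_int _ _ _ in I1 I2.
have -> : L = S - (S - L) by ring.
apply: (le_trans (cabsB _ _)); apply: lerD => //.
by apply: (le_trans I2); rewrite mulrC divfK.
Qed.

Section F.
Variables (f : C -> C) (l : C) (Y M : R).
Hypothesis fholo : forall z : C, Y < Im z -> exists d, cderiv f z d.
Hypothesis fper : forall z : C, f (z + 1) = f z.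
Hypothesis fbnd : forall z : C, Y < Im z -> cabs (f z) <= M.
Hypothesis flim : forall e, 0 < e -> exists Y' : R, forall z : C, Y' < Im z -> cabs (f z - l) <= e.

(** The periodic function exp (2 i pi (z - w)), which is 1 at w and tends to
    0 at i infinity. *)
Let u (w z : C) : C := covering (z - w).

Lemma cabs_u w z : cabs (u w z) = expR (K * (Im w - Im z)).
Proof.
rewrite cabs_covering; congr expR; rewrite /K; case: z w => [x y] [x' y'] /=; ring.
Qed.

Lemma u_small w e : 0 < e -> exists Y' : R, forall z : C, Y' < Im z -> cabs (u w z) <= e.
Proof.
move=> e0; have [k ke] := expR_total e0.
exists (Im w - k / K) => z zY; rewrite cabs_u -ke ler_expR.
by rewrite mulrC -ler_pdivlMr // ltW //; lra.
Qed.

Lemma u_half w z : cabs (u w z) <= 2^-1 -> 2^-1 <= cabs (u w z - 1).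
Proof.
move=> h; rewrite cabsBC; have : cabs 1 <= cabs (1 - u w z) + cabs (u w z).
  by have := cabsD (1 - u w z) (u w z); rewrite subrK.
rewrite cabs1; lra.
Qed.

Lemma u_deriv w z : exists d, cderiv (u w) z d.
Proof.
have H1 : cderiv (fun t : C => t - w) z 1.
  by rewrite -[1]subr0; apply: cderivB; [exact: cderiv_id | exact: cderiv_cst].
by eexists; exact: cderiv_comp H1 (cderiv_covering _).
Qed.

Lemma u_per w z : u w (z + 1) = u w z.
Proof. by rewrite /u -addrA [1 - w]addrC addrA coveringDr1. Qed.

Let ci : C := (0 +i* K)%C.
Let cabs_ci : cabs ci = K.
Proof.
have -> : ci = 'i%C * K%:C%C by rewrite /ci; simpc.
by rewrite cabsM cabsi mul1r cabs_real gtr0_norm.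
Qed.

Lemma u_near w e : 0 < e -> exists2 r : R, 0 < r & forall z : C, cabs (z - w) < r ->
  cabs (u w z - 1 - ci * (z - w)) <= e * cabs (z - w).
Proof.
move=> e0; have [r r0 H] := @cderiv_covering0 R e e0; exists r => // z zr.
by have := H (z - w); rewrite subr0 covering0; exact.
Qed.

Lemma u_far w : exists2 r : R, 0 < r & forall z : C, cabs (z - w) < r ->
  cabs (z - w) <= cabs (u w z - 1).
Proof.
have [r r0 H] := u_near w ltr01; exists r => // z /H; rewrite mul1r.
set a := u w z - 1; set b := z - w => h.
have : cabs (ci * b) <= cabs a + cabs b.
  have -> : ci * b = a - (a - ci * b) by ring.
  exact: le_trans (cabsB _ _) (lerD (lexx _) h).
rewrite cabsM cabs_ci => h2; have := cabs_ge0 b; have := K4; nra.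
Qed.

Variable w : C.
Hypothesis wY : Y + 3 < Im w.
Let E := expR (K * (Im w - (Y + 1))).
Let E9 : 9 <= E.
Proof.
apply: (le_trans _ (expR_ge1Dx _)); have := K4; have : 2 <= Im w - (Y + 1) by have := wY; lra.
set d := _ - _ => d2 k4.
have h : 0 <= (K - 4) * (d - 2) by rewrite mulr_ge0 // subr_ge0.
have -> : 1 + K * d = (K - 4) * (d - 2) + 2 * (K - 4) + 4 * (d - 2) + 9 by ring.
rewrite lerDr !addr_ge0 // mulr_ge0 // subr_ge0 //.
Qed.
Let Yw : Y < Im w. Proof. by apply: lt_trans wY; rewrite ltrDl. Qed.
Let Yw1 : Y + 1 < Im w. Proof. by apply: lt_trans wY; rewrite ltrD2l ltr1n. Qed.
Let M0 : 0 <= M. Proof. exact: le_trans (cabs_ge0 _) (fbnd Yw). Qed.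

Let usub (z : C) : cabs (u w z) = E -> E - 1 <= cabs (u w z - 1).
Proof.
by move=> <-; rewrite lerBlDr; have := cabsD (u w z - 1) 1; rewrite subrK cabs1.
Qed.
Let bot (z : C) : Im z = Y + 1 -> cabs (u w z) = E.
Proof. by move=> zY; rewrite cabs_u zY. Qed.

(** The kernel (f z - f w) / (u z - 1) is periodic, holomorphic up to a
    harmless singularity at w, and tends to f w - l at i infinity. On the
    line Im z = Y + 1 its denominator has size E = exp (2 pi (Im w - Y -
    1)). *)
Lemma decay_fun : cabs (f w - l) <= 8 * M / E.
Proof.
pose G z := (f z - f w) / (u w z - 1).
have Eq1 : 0 < E - 1 by have := E9; lra.
have := @top_le_bottom G w (f w - l) (Y + 1) (2 * M / (E - 1)) _ _ _ _ _ _.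
move=> H; apply: le_trans (H _ _ _ _ _ _) _ => {H}.
- exact: Yw1.
- move=> z zY zw; have [df Hf] : exists d, cderiv f z d by apply: fholo; lra.
  have [du Hu] := u_deriv w z.
  have u0 : u w z - 1 != 0 by rewrite subr_eq0; apply/eqP.
  have [di Hi] := @cderivV _ (fun t => u w t - 1) z _ u0 (cderivB Hu (cderiv_cst 1 z)).
  by eexists; exact: cderivM (cderivB Hf (cderiv_cst (f w) z)) Hi.
- by move=> z; rewrite /G fper u_per.
- move=> e e0; have [df Hf] := fholo Yw.
  have [r1 r10 H1] := cderiv_continuous Hf e0; have [r2 r20 H2] := u_far w.
  exists (Order.min r1 r2) => [|z]; first by rewrite lt_min r10.
  rewrite lt_min => /and3P[z0 /H1 {}H1 /H2 {}H2].
  have up : 0 < cabs (u w z - 1) by exact: lt_le_trans H2.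
  rewrite /G !cabsM cabsV mulrA ler_pdivrMr // mulrC.
  by rewrite ler_pM ?cabs_ge0.
- move=> z zY; rewrite /G cabsM cabsV ler_pM ?cabs_ge0 ?invr_ge0 ?cabs_ge0 //.
    by apply: (le_trans (cabsB _ _)); rewrite mulr_natl mulr2n lerD // fbnd // zY; lra.
  by rewrite lef_pV2 ?posrE // ?(lt_le_trans Eq1) // usub // bot.
- move=> e e0.
  have e4 : 0 < e / 4 by rewrite divr_gt0.
  have [Y1 HY1] := flim e4.
  have c0 : 0 < 1 + cabs (f w - l) by rewrite ltr_pwDl ?cabs_ge0.
  have d0 : 0 < Order.min 2^-1 (e / 4 / (1 + cabs (f w - l))).
    by rewrite lt_min invr_gt0 ltr0n divr_gt0.
  have [Y2 HY2] := u_small w d0.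
  exists (Order.max Y1 Y2) => z; rewrite gt_max => /andP[/HY1 h1 /HY2].
  rewrite le_min => /andP[h2]; rewrite ler_pdivlMr // => h3.
  have hu := u_half h2.
  have hp : 0 < cabs (u w z - 1) by apply: lt_le_trans hu; rewrite invr_gt0.
  have -> : G z - (f w - l) = ((f z - l) - (f w - l) * u w z) / (u w z - 1).
    by rewrite /G; field; rewrite -cabs_eq0 gt_eqF.
  rewrite cabsM cabsV ler_pdivrMr //.
  apply: (le_trans (cabsB _ _)); rewrite cabsM.
  have A : cabs (f w - l) * cabs (u w z) <= e / 4.
    by have := cabs_ge0 (u w z); have := cabs_ge0 (f w - l); nra.
  apply: (le_trans (lerD h1 A)); nra.
rewrite mulrA ler_pdivrMr // mulrAC ler_pdivlMr ?(lt_le_trans _ E9) //.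
have := E9; have := M0; nra.
Qed.

(** The same argument for (f z - f w - k (u z - 1)) / (u z - 1)^2, where k =
    f'(w) / (2 i pi) is the value for which the singularity at w is still
    harmless. The limit at i infinity is l - f w + k. *)
Lemma decay_deriv d : cderiv f w d -> cabs d <= 24 * K * M / E.
Proof.
move=> Hd; pose k := d / ci.
have ci0 : ci != 0 by rewrite -cabs_eq0 cabs_ci gt_eqF.
have dk : d = ci * k by rewrite /k mulrC divfK.
clearbody k.
pose G z := (f z - f w - k * (u w z - 1)) / (u w z - 1) ^+ 2.
have Eq1 : 0 < E - 1 by have := E9; lra.
have E0 : 0 < E by have := E9; lra.
have H := @top_le_bottom G w (l - f w + k) (Y + 1) ((2 * M + cabs k * (E + 1)) / (E - 1) ^+ 2) _ _ _ _ _ _.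
have {H} : cabs (l - f w + k) <= 2 * ((2 * M + cabs k * (E + 1)) / (E - 1) ^+ 2).
  apply: H.
  - exact: Yw1.
  - move=> z zY zw; have [df Hf] : exists d, cderiv f z d by apply: fholo; lra.
    have [du Hu] := u_deriv w z.
    have u0 : (u w z - 1) * (u w z - 1) != 0 by rewrite mulf_neq0 // subr_eq0; apply/eqP.
    have Hu1 := cderivB Hu (cderiv_cst 1 z).
    have [di Hi] := @cderivV _ (fun t => (u w t - 1) * (u w t - 1)) z _ u0 (cderivM Hu1 Hu1).
    by eexists; exact: cderivM (cderivB (cderivB Hf (cderiv_cst (f w) z)) (cderivM (cderiv_cst k z) Hu1)) Hi.
  - by move=> z; rewrite /G fper u_per.
  - move=> e e0.
    have c0 : 0 < 1 + cabs k by rewrite ltr_pwDl ?cabs_ge0.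
    have e1 : 0 < e / (1 + cabs k) by rewrite divr_gt0.
    have [r1 r10 H1] := Hd _ e1; have [r2 r20 H2] := u_far w; have [r3 r30 H3] := u_near w e1.
    exists (Order.min r1 (Order.min r2 r3)) => [|z]; first by rewrite !lt_min r10 r20.
    rewrite !lt_min => /and4P[z0 /H1 {}H1 /H2 {}H2 /H3 {}H3].
    have up : 0 < cabs (u w z - 1) by exact: lt_le_trans H2.
    rewrite /G !cabsM cabsV cabsX mulrA ler_pdivrMr ?exprn_gt0 //.
    have N : cabs (f z - f w - k * (u w z - 1)) <= e * cabs (z - w).
      have -> : f z - f w - k * (u w z - 1) = (f z - f w - d * (z - w)) - k * (u w z - 1 - ci * (z - w)).
        by rewrite dk; ring.
      apply: (le_trans (cabsB _ _)); rewrite cabsM.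
      apply: (le_trans (lerD H1 (ler_wpM2l (cabs_ge0 k) H3))).
      rewrite le_eqVlt; apply/orP; left; apply/eqP; field; by rewrite gt_eqF.
    apply: (le_trans (ler_wpM2l (cabs_ge0 _) N)); rewrite mulrCA -expr2.
    by rewrite ler_wpM2l ?(ltW e0) // lerXn2r // nnegrE cabs_ge0.
  - move=> z zY; rewrite /G cabsM cabsV cabsX.
    have uE := usub (bot zY).
    apply: ler_pM; rewrite ?cabs_ge0 ?invr_ge0 ?exprn_ge0 ?cabs_ge0 //.
      apply: (le_trans (cabsB _ _)); rewrite cabsM; apply: lerD.
        by apply: (le_trans (cabsB _ _)); rewrite mulr_natl mulr2n lerD // fbnd // zY; lra.
      rewrite ler_wpM2l ?cabs_ge0 //; apply: (le_trans (cabsB _ _)); by rewrite cabs1 bot.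
    rewrite lef_pV2 ?posrE ?exprn_gt0 // ?(lt_le_trans Eq1) //.
    by rewrite lerXn2r // nnegrE ?cabs_ge0 // ltW.
  - move=> e e0.
    have e4 : 0 < e / 8 by rewrite divr_gt0.
    have [Y1 HY1] := flim e4.
    pose m := 3 * cabs (l - f w) + 2 * cabs k.
    have m0 : 0 <= m by rewrite addr_ge0 // mulr_ge0 // cabs_ge0.
    have c0 : 0 < 1 + m by rewrite ltr_pwDl.
    have d0 : 0 < Order.min 2^-1 (e / 8 / (1 + m)).
      by rewrite lt_min invr_gt0 ltr0n divr_gt0.
    have [Y2 HY2] := u_small w d0.
    exists (Order.max Y1 Y2) => z; rewrite gt_max => /andP[/HY1 h1 /HY2].
    rewrite le_min => /andP[h2]; rewrite ler_pdivlMr // => h3.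
    have hu := u_half h2.
    have hp : 0 < cabs (u w z - 1) by apply: lt_le_trans hu; rewrite invr_gt0.
    have -> : G z - (l - f w + k) = ((f z - l) + u w z *
       ((l - f w) * (2 - u w z) - k * (u w z - 1))) / (u w z - 1) ^+ 2.
      by rewrite /G; field; rewrite -cabs_eq0 gt_eqF.
    rewrite cabsM cabsV cabsX ler_pdivrMr ?exprn_gt0 //.
    apply: (le_trans (cabsD _ _)); rewrite cabsM.
    have A : cabs ((l - f w) * (2 - u w z) - k * (u w z - 1)) <= m.
      apply: (le_trans (cabsB _ _)); rewrite !cabsM /m.
      have B1 : cabs (2 - u w z) <= 3.
        apply: (le_trans (cabsB _ _)).
        have -> : cabs (2 : C) = 2 by rewrite -(rmorph_nat (real_complex R)) cabs_real normr_nat.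
        lra.
      have B2 : cabs (u w z - 1) <= 2.
        by apply: (le_trans (cabsB _ _)); rewrite cabs1; lra.
      by apply: lerD; rewrite [leLHS]mulrC; apply: ler_wpM2r => //; exact: cabs_ge0.
    have A2 : cabs (u w z) * cabs ((l - f w) * (2 - u w z) - k * (u w z - 1)) <= e / 8.
      apply: (le_trans (ler_wpM2l (cabs_ge0 _) A)); apply: le_trans h3.
      by rewrite ler_wpM2l ?cabs_ge0 // lerDr.
    have h4 : 4^-1 <= cabs (u w z - 1) ^+ 2.
      have -> : 4^-1 = 2^-1 ^+ 2 :> R by field.
      by rewrite lerXn2r // nnegrE ?invr_ge0 // ltW.
    apply: (le_trans (lerD h1 A2)).
    by apply: (le_trans _ (ler_wpM2l (ltW e0) h4)); lra.
have D := decay_fun; rewrite cabsBC in D => H.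
have kE : (E + 1) / (E - 1) ^+ 2 <= 4^-1.
  rewrite ler_pdivrMr ?exprn_gt0 //.
  have : 0 <= (E - 9) * (E + 3) by rewrite mulr_ge0 // ?subr_ge0 //; have := E9; lra.
  rewrite expr2 !mulrBl !mulrBr !mulrDr; have := E9; lra.
have ME : M / (E - 1) ^+ 2 <= M / E.
  rewrite ler_wpM2l // lef_pV2 ?posrE ?exprn_gt0 //.
  have : 0 <= (E - 9) * E by rewrite mulr_ge0 // ?subr_ge0 // ltW.
  rewrite expr2 !mulrBl !mulrBr; have := E9; lra.
have k1 : cabs k <= cabs (l - f w) + cabs (l - f w + k).
  have -> : cabs k = cabs ((l - f w + k) - (l - f w)) by congr cabs; ring.
  by rewrite [leRHS]addrC; exact: cabsB.
have k2 : cabs k * ((E + 1) / (E - 1) ^+ 2) <= cabs k * 4^-1.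
  by rewrite ler_wpM2l // cabs_ge0.
have : cabs k <= 24 * M / E.
  have : cabs (l - f w + k) <= 4 * (M / E) + cabs k * 2^-1.
    apply: (le_trans H).
    have -> : 2 * ((2 * M + cabs k * (E + 1)) / (E - 1) ^+ 2) =
      4 * (M / (E - 1) ^+ 2) + 2 * (cabs k * ((E + 1) / (E - 1) ^+ 2)) by ring.
    lra.
  by rewrite -[_ * _ / E]mulrA in D *; lra.
move=> k3; rewrite dk cabsM cabs_ci.
by apply: (le_trans (ler_wpM2l (ltW K0) k3)); rewrite le_eqVlt; apply/orP; left; apply/eqP; ring.
Qed.
End F.

End Decay2.

(** * Rapid decrease at i infinity *)

Section Rapid.
Variable R : realType.
Local Notation C := R[i].
Local Notation Im := complex.Im.

(** Eventually, as Im z tends to infinity, uniformly in Re z. *)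
Definition ev (P : C -> Prop) : Prop := exists Y : R, forall z : C, Y < Im z -> P z.

Lemma ev_all (P : C -> Prop) : (forall z, P z) -> ev P.
Proof. by move=> H; exists 0. Qed.

Lemma ev_mono (P Q : C -> Prop) : (forall z, P z -> Q z) -> ev P -> ev Q.
Proof. by move=> H [Y HY]; exists Y => z /HY/H. Qed.

Lemma ev_and (P Q : C -> Prop) : ev P -> ev Q -> ev (fun z => P z /\ Q z).
Proof.
move=> [Y HY] [Z HZ]; exists (Order.max Y Z) => z.
by rewrite gt_max => /andP[/HY ? /HZ ?].
Qed.

Lemma ev_gt (Y : R) : ev (fun z => Y < Im z).
Proof. by exists Y. Qed.

Lemma ev_fin (T : finType) (P : T -> C -> Prop) : (forall t, ev (P t)) ->
  ev (fun z => forall t, P t z).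
Proof.
move=> H; suff : ev (fun z => forall t, t \in enum T -> P t z).
  by apply: ev_mono => z h t; apply: h; rewrite mem_enum.
elim: (enum T) => [|t s IH]; first exact: ev_all.
have := ev_and (H t) IH; apply: ev_mono => z [h1 h2] t'.
by rewrite inE => /predU1P[->|/h2].
Qed.

Lemma ev_ex (P : C -> Prop) : ev P -> exists2 z, 0 < Im z & P z.
Proof.
move=> [Y HY]; exists (0 +i* (Order.max 0 Y + 1))%C.
  by rewrite /= ltr_pwDr // le_max lexx.
by apply: HY; rewrite /= ltr_pwDr // le_max lexx orbT.
Qed.

Lemma ev_const (P : Prop) : ev (fun=> P) -> P.
Proof. by move=> /ev_ex[]. Qed.

(** Decrease faster than all powers of Im z: weaker than the exponential
    decay at hand, but stable under products with functions of polynomial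
    growth. *)
Definition rapid (f : C -> C) : Prop :=
  forall m, exists c : R, ev (fun z => cabs (f z) * Im z ^+ m <= c).

Definition polyb (f : C -> C) : Prop :=
  exists m, exists c : R, ev (fun z => cabs (f z) <= c * Im z ^+ m).

Lemma eq_rapid f g : ev (fun z => f z = g z) -> rapid f -> rapid g.
Proof.
move=> E H m; have [c Hc] := H m; exists c.
by have := ev_and E Hc; apply: ev_mono => z [<-].
Qed.

Lemma eq_polyb f g : ev (fun z => f z = g z) -> polyb f -> polyb g.
Proof.
move=> E [m [c H]]; exists m, c.
by have := ev_and E H; apply: ev_mono => z [<-].
Qed.

Lemma rapid_polyb f : rapid f -> polyb f.
Proof.
move=> /(_ 0%N)[c H]; exists 0%N, c; move: H; apply: ev_mono => z.
by rewrite expr0 !mulr1.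
Qed.

Lemma polyb_norm f : polyb f -> exists m, exists2 c : R, 0 <= c & ev (fun z => 1 <= Im z /\ cabs (f z) <= c * Im z ^+ m).
Proof.
move=> [m [c H]]; exists m, `|c|; first exact: normr_ge0.
have := ev_and (ev_gt 1) H; apply: ev_mono => z [/ltW z1 h]; split => //.
by apply: (le_trans h); rewrite ler_wpM2r ?ler_norm // exprn_ge0 // (le_trans ler01).
Qed.

Lemma rapidD f g : rapid f -> rapid g -> rapid (fun z => f z + g z).
Proof.
move=> hf hg m; have [c1 h1] := hf m; have [c2 h2] := hg m; exists (c1 + c2).
have := ev_and (ev_gt 0) (ev_and h1 h2); apply: ev_mono => z [z0 [a b]].
by apply: le_trans (lerD a b); rewrite -mulrDl ler_wpM2r ?cabsD // exprn_ge0 // ltW.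
Qed.

Lemma rapidN f : rapid f -> rapid (fun z => - f z).
Proof. by move=> H m; have [c h] := H m; exists c; move: h; apply: ev_mono => z; rewrite cabsN. Qed.

Lemma polybD f g : polyb f -> polyb g -> polyb (fun z => f z + g z).
Proof.
move=> /polyb_norm[m1 [c1 c10 h1]] /polyb_norm[m2 [c2 c20 h2]].
exists (m1 + m2)%N, (c1 + c2); have := ev_and h1 h2; apply: ev_mono => z [[z1 a] [_ b]].
apply: (le_trans (cabsD _ _)); rewrite mulrDl; apply: lerD.
  by apply: (le_trans a); rewrite ler_wpM2l // ler_weXn2l // leq_addr.
by apply: (le_trans b); rewrite ler_wpM2l // ler_weXn2l // leq_addl.
Qed.

Lemma polybM f g : polyb f -> polyb g -> polyb (fun z => f z * g z).
Proof.
move=> /polyb_norm[m1 [c1 c10 h1]] /polyb_norm[m2 [c2 c20 h2]].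
exists (m1 + m2)%N, (c1 * c2); have := ev_and h1 h2; apply: ev_mono => z [[z1 a] [_ b]].
by rewrite cabsM exprD mulrACA ler_pM ?cabs_ge0.
Qed.

Lemma polyb_cst c : polyb (fun=> c).
Proof. by exists 0%N, (cabs c); apply: ev_all => z; rewrite expr0 mulr1. Qed.

Lemma rapidMr f g : rapid f -> polyb g -> rapid (fun z => f z * g z).
Proof.
move=> hf /polyb_norm[k [c c0 h]] m; have [d hd] := hf (k + m)%N; exists (d * c).
have := ev_and h hd; apply: ev_mono => z [[z1 a] b].
have z0 : 0 <= Im z by exact: le_trans z1.
rewrite cabsM; apply: (@le_trans _ _ (cabs (f z) * (c * Im z ^+ k) * Im z ^+ m)).
  by rewrite ler_wpM2r ?exprn_ge0 // ler_wpM2l ?cabs_ge0.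
have -> : cabs (f z) * (c * Im z ^+ k) * Im z ^+ m = (cabs (f z) * Im z ^+ (k + m)) * c.
  by rewrite exprD; ring.
by rewrite ler_wpM2r.
Qed.

Lemma rapidMl f g : polyb f -> rapid g -> rapid (fun z => f z * g z).
Proof.
move=> hf hg; have := rapidMr hg hf; apply: eq_rapid.
by apply: ev_all => z; rewrite mulrC.
Qed.

Lemma rapid0 : rapid (fun=> 0).
Proof. by move=> m; exists 0; apply: ev_all => z; rewrite cabs0 mul0r. Qed.

Lemma rapid_sum I (r : seq I) (F : I -> C -> C) :
  (forall i, rapid (F i)) -> rapid (fun z => \sum_(i <- r) F i z).
Proof.
move=> H; elim: r => [|i r IH].
  by apply: eq_rapid rapid0; apply: ev_all => z; rewrite big_nil.
by apply: eq_rapid (rapidD (H i) IH); apply: ev_all => z; rewrite big_cons.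
Qed.

Lemma polyb_sum I (r : seq I) (F : I -> C -> C) :
  (forall i, polyb (F i)) -> polyb (fun z => \sum_(i <- r) F i z).
Proof.
move=> H; elim: r => [|i r IH].
  by apply: eq_polyb (polyb_cst 0); apply: ev_all => z; rewrite big_nil.
by apply: eq_polyb (polybD (H i) IH); apply: ev_all => z; rewrite big_cons.
Qed.

Lemma polyb_prod I (r : seq I) (F : I -> C -> C) :
  (forall i, polyb (F i)) -> polyb (fun z => \prod_(i <- r) F i z).
Proof.
move=> H; elim: r => [|i r IH].
  by apply: eq_polyb (polyb_cst 1); apply: ev_all => z; rewrite big_nil.
by apply: eq_polyb (polybM (H i) IH); apply: ev_all => z; rewrite big_cons.
Qed.

Lemma rapid_prod I (r : seq I) (F G : I -> C -> C) :
  (forall i, polyb (F i)) -> (forall i, polyb (G i)) ->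
  (forall i, rapid (fun z => F i z - G i z)) ->
  rapid (fun z => \prod_(i <- r) F i z - \prod_(i <- r) G i z).
Proof.
move=> hF hG H; elim: r => [|i r IH].
  by apply: eq_rapid rapid0; apply: ev_all => z; rewrite !big_nil subrr.
have := rapidD (rapidMr (H i) (polyb_prod r hF)) (rapidMl (hG i) IH).
by apply: eq_rapid; apply: ev_all => z; rewrite !big_cons; ring.
Qed.

Lemma rapid_small f e : rapid f -> 0 < e -> ev (fun z => cabs (f z) <= e).
Proof.
move=> /(_ 1%N)[c h] e0; have := ev_and (ev_gt (Order.max 1 (c / e))) h; apply: ev_mono => z [].
rewrite gt_max expr1 => /andP[z1 cz] hz.
have z0 : 0 < Im z by exact: lt_trans z1.
have : c < e * Im z by rewrite mulrC -ltr_pdivrMr.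
by move=> /(le_lt_trans hz); rewrite ltr_pM2r // => /ltW.
Qed.

Lemma rapid_cst c : rapid (fun=> c) -> c = 0.
Proof.
move=> H; apply/eqP; rewrite -cabs_eq0 eq_le cabs_ge0 andbT.
by apply/ler_addgt0Pr => e e0; rewrite add0r; apply: ev_const (rapid_small H e0).
Qed.

Lemma rapid_inv1 f : rapid (fun z => f z - 1) -> ev (fun z => f z != 0) /\ polyb (fun z => (f z)^-1).
Proof.
move=> H; have h2 : 0 < 2^-1 :> R by rewrite invr_gt0.
have {}H := rapid_small H h2.
have K z : cabs (f z - 1) <= 2^-1 -> 2^-1 <= cabs (f z).
  by have := cabsB (f z) (f z - 1); rewrite subKr cabs1; lra.
split; first by move: H; apply: ev_mono => z /K; rewrite -cabs_gt0; exact: lt_le_trans.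
exists 0%N, 2; move: H; apply: ev_mono => z /K hz.
by rewrite expr0 mulr1 cabsV -[2]invrK lef_pV2 ?posrE // (lt_le_trans h2).
Qed.

(** Such an f is a function of s = covering z, holomorphic at s = 0 because
    it is bounded; hence it converges exponentially. *)
Lemma rapid_decay (f f' : C -> C) (l : C) (Y : R) :
  (forall z : C, Y < Im z -> cderiv f z (f' z)) ->
  (forall z, f (z + 1) = f z) ->
  (forall e, 0 < e -> ev (fun z => cabs (f z - l) <= e)) ->
  rapid (fun z => f z - l) /\ rapid f'.
Proof.
move=> Hd Hp Hl; have [Y1 HY1] := Hl 1 ltr01.
pose Y2 := Order.max Y Y1; pose M := 1 + cabs l.
have h1 (z : C) : Y2 < Im z -> exists d, cderiv f z d.
  by rewrite gt_max => /andP[/Hd]; exists (f' z).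
have h2 (z : C) : Y2 < Im z -> cabs (f z) <= M.
  rewrite gt_max => /andP[_ /HY1 h]; have -> : f z = (f z - l) + l by rewrite subrK.
  by apply: (le_trans (cabsD _ _)); rewrite lerD2r.
have D1 := decay_fun h1 Hp h2 Hl; have D2 := decay_deriv h1 Hp h2 Hl.
pose E (z : C) := expR (2 * pi * (Im z - (Y2 + 1))).
have HE m : exists c : R, ev (fun z => Im z ^+ m / E z <= c).
  exists (2 ^+ m.+1 * (m.+1)`!%:R).
  have := ev_gt (Order.max 1 (2 * `|Y2 + 1|)); apply: ev_mono => z; rewrite gt_max => /andP[z1 zY].
  have z0 : 0 < Im z by exact: lt_trans z1.
  rewrite ler_pdivrMr ?expR_gt0 //.
  have A : Im z ^+ m.+1 / 2 ^+ m.+1 / (m.+1)`!%:R <= E z.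
    apply: (@le_trans _ _ (expR (Im z / 2))).
      rewrite -expr_div_n; have := @expR_ge1Dxn R (Im z / 2) m (divr_ge0 (ltW z0) (ler0n _ _)).
      by apply: le_trans; rewrite lerDr.
    rewrite /E ler_expR.
    have : Im z / 2 <= Im z - (Y2 + 1) by have := ler_norm (Y2 + 1); lra.
    move=> /le_trans; apply; rewrite ler_peMl //; last by have := @pi_ge2 R; lra.
    by have := ler_norm (Y2 + 1); lra.
  have f0 : 0 < (m.+1)`!%:R :> R by rewrite ltr0n fact_gt0.
  rewrite ler_pdivrMr // ler_pdivrMr ?exprn_gt0 // in A.
  apply: (@le_trans _ _ (Im z ^+ m.+1)); first by rewrite ler_weXn2l // ltW.
  by apply: (le_trans A); rewrite le_eqVlt; apply/orP; left; apply/eqP; ring.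
have Mge0 : 0 <= M by rewrite addr_ge0 ?cabs_ge0.
split => m; have [c Hc] := HE m.
  exists (8 * M * c); have := ev_and (ev_gt (Order.max 0 (Y2 + 3))) Hc.
  apply: ev_mono => z [zY h]; move: zY; rewrite gt_max => /andP[z0 zY].
  apply: (le_trans (ler_wpM2r (exprn_ge0 m (ltW z0)) (D1 z zY))).
  rewrite -/(E z); have -> : 8 * M / E z * Im z ^+ m = 8 * M * (Im z ^+ m / E z) by ring.
  by rewrite ler_wpM2l // mulr_ge0.
exists (24 * (2 * pi) * M * c); have := ev_and (ev_gt (Order.max 0 (Y2 + 3))) Hc.
apply: ev_mono => z [zY h]; move: zY; rewrite gt_max => /andP[z0 zY].
have Dz : cderiv f z (f' z).
  apply: Hd; apply: le_lt_trans zY; apply: (@le_trans _ _ Y2); first by rewrite le_max lexx.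
  by rewrite lerDl.
apply: (le_trans (ler_wpM2r (exprn_ge0 m (ltW z0)) (D2 z zY _ Dz))).
rewrite -/(E z).
have -> : 24 * (2 * pi) * M / E z * Im z ^+ m = 24 * (2 * pi) * M * (Im z ^+ m / E z) by ring.
by rewrite ler_wpM2l // !mulr_ge0 // pi_ge0.
Qed.

End Rapid.

(** * Limits of moving subspaces *)

Section MRapid.
Variable R : realType.
Local Notation C := R[i].

Definition mrapid m n (A : C -> 'M[C]_(m, n)) : Prop :=
  forall i j, rapid (fun z => A z i j).
Definition mpolyb m n (A : C -> 'M[C]_(m, n)) : Prop :=
  forall i j, polyb (fun z => A z i j).

Lemma eq_mrapid m n (A B : C -> 'M[C]_(m, n)) : ev (fun z => A z = B z) -> mrapid A -> mrapid B.
Proof. by move=> E H i j; apply: eq_rapid (H i j); move: E; apply: ev_mono => z ->. Qed.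

Lemma mrapid_polyb m n (A : C -> 'M[C]_(m, n)) : mrapid A -> mpolyb A.
Proof. by move=> H i j; exact: rapid_polyb. Qed.

Lemma mpolyb_cst m n (A : 'M[C]_(m, n)) : mpolyb (fun=> A).
Proof. by move=> i j; exact: polyb_cst. Qed.

Lemma mrapid0 m n : mrapid (fun=> 0 : 'M[C]_(m, n)).
Proof. by move=> i j; apply: eq_rapid (rapid0 R); apply: ev_all => z; rewrite mxE. Qed.

Lemma mrapidD m n (A B : C -> 'M[C]_(m, n)) : mrapid A -> mrapid B -> mrapid (fun z => A z + B z).
Proof.
by move=> hA hB i j; apply: eq_rapid (rapidD (hA i j) (hB i j)); apply: ev_all => z; rewrite mxE.
Qed.

Lemma mrapidN m n (A : C -> 'M[C]_(m, n)) : mrapid A -> mrapid (fun z => - A z).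
Proof.
by move=> hA i j; apply: eq_rapid (rapidN (hA i j)); apply: ev_all => z; rewrite mxE.
Qed.

Lemma mrapidB m n (A B : C -> 'M[C]_(m, n)) : mrapid A -> mrapid B -> mrapid (fun z => A z - B z).
Proof. by move=> hA hB; apply: mrapidD => //; exact: mrapidN. Qed.

Lemma mpolybD m n (A B : C -> 'M[C]_(m, n)) : mpolyb A -> mpolyb B -> mpolyb (fun z => A z + B z).
Proof.
by move=> hA hB i j; apply: eq_polyb (polybD (hA i j) (hB i j)); apply: ev_all => z; rewrite mxE.
Qed.

Lemma mrapidMl m n p (A : C -> 'M[C]_(m, n)) (B : C -> 'M[C]_(n, p)) :
  mpolyb A -> mrapid B -> mrapid (fun z => A z *m B z).
Proof.
move=> hA hB i j.
have := rapid_sum (index_enum 'I_n) (fun k => rapidMl (hA i k) (hB k j)).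
by apply: eq_rapid; apply: ev_all => z; rewrite mxE.
Qed.

Lemma mrapidMr m n p (A : C -> 'M[C]_(m, n)) (B : C -> 'M[C]_(n, p)) :
  mrapid A -> mpolyb B -> mrapid (fun z => A z *m B z).
Proof.
move=> hA hB i j.
have := rapid_sum (index_enum 'I_n) (fun k => rapidMr (hA i k) (hB k j)).
by apply: eq_rapid; apply: ev_all => z; rewrite mxE.
Qed.

Lemma mpolybM m n p (A : C -> 'M[C]_(m, n)) (B : C -> 'M[C]_(n, p)) :
  mpolyb A -> mpolyb B -> mpolyb (fun z => A z *m B z).
Proof.
move=> hA hB i j.
have := polyb_sum (index_enum 'I_n) (fun k => polybM (hA i k) (hB k j)).
by apply: eq_polyb; apply: ev_all => z; rewrite mxE.
Qed.

Lemma mrapid_cst m n (A : 'M[C]_(m, n)) : mrapid (fun=> A) -> A = 0.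
Proof. by move=> H; apply/matrixP => i j; rewrite mxE; exact: rapid_cst (H i j). Qed.

Lemma polyb_det n (A : C -> 'M[C]_n) : mpolyb A -> polyb (fun z => \det (A z)).
Proof.
move=> hA; apply: polyb_sum => s; apply: polybM; first exact: polyb_cst.
by apply: polyb_prod => i; exact: hA.
Qed.

Lemma rapid_det n (A : C -> 'M[C]_n) : mrapid (fun z => A z - 1%:M) -> rapid (fun z => \det (A z) - 1).
Proof.
move=> hA.
have pA : mpolyb A.
  have := mpolybD (mrapid_polyb hA) (mpolyb_cst 1%:M).
  by move=> H i j; apply: eq_polyb (H i j); apply: ev_all => z; rewrite subrK.
have E z : \det (A z) - 1 = \sum_(s : 'S_n) ((-1) ^+ s * (\prod_i A z i (s i) - \prod_i (1%:M : 'M[C]_n) i (s i))).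
  rewrite -[X in _ - X](det1 C n) /determinant -sumrB; apply: eq_bigr => s _; by rewrite mulrBr.
apply: (@eq_rapid _ (fun z => \sum_(s : 'S_n) ((-1) ^+ s * (\prod_i A z i (s i) - \prod_i (1%:M : 'M[C]_n) i (s i))))).
  by apply: ev_all => z; rewrite E.
apply: rapid_sum => s; apply: rapidMl; first exact: polyb_cst.
apply: (rapid_prod _ (F := fun i z => A z i (s i)) (G := fun i z => (1%:M : 'M[C]_n) i (s i))) => i.
- exact: pA.
- exact: polyb_cst.
- by have := hA i (s i); apply: eq_rapid; apply: ev_all => z; rewrite !mxE.
Qed.

(** Cramer's rule: the determinant tends to 1, and the cofactors grow at
    most polynomially. *)
Lemma near1_inv n (A : C -> 'M[C]_n) : mrapid (fun z => A z - 1%:M) ->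
  ev (fun z => A z \in unitmx) /\ mpolyb (fun z => invmx (A z)).
Proof.
move=> hA; have [h0 hV] := rapid_inv1 (rapid_det hA).
have hu : ev (fun z => A z \in unitmx) by move: h0; apply: ev_mono => z; rewrite unitmxE unitfE.
split => // i j.
have pA : mpolyb A.
  have := mpolybD (mrapid_polyb hA) (mpolyb_cst 1%:M).
  by move=> H k l; apply: eq_polyb (H k l); apply: ev_all => z; rewrite subrK.
have : polyb (fun z => (\det (A z))^-1 * ((-1) ^+ (j + i) * \det (row' j (col' i (A z))))).
  apply: polybM => //; apply: polybM; first exact: polyb_cst.
  by apply: polyb_det => k l; apply: eq_polyb (pA (lift j k) (lift i l)); apply: ev_all => z; rewrite !mxE.
by apply: eq_polyb; move: hu; apply: ev_mono => z hz; rewrite /invmx hz !mxE.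
Qed.

End MRapid.

Section Approx.
Variables (R : realType) (n : nat).
Local Notation C := R[i].
Implicit Types (A : C -> 'M[C]_n) (B : 'M[C]_n).

(** [lower A B]: vectors of B are approached by vectors of A z with rapidly
    decreasing error. [upper A B]: vectors of A z satisfy equations that are
    rapidly close to those of B. For equal ranks both say that A z tends
    rapidly to B; they are kept apart because sums preserve the first notion
    and intersections the second. *)
Definition lower A B := exists2 D, mrapid D & ev (fun z => ((B + D z)%R <= A z)%MS).
Definition upper A B := exists2 E, mrapid E & ev (fun z => A z *m (cokermx B + E z) = 0).

Lemma row_base_data m (B : 'M[C]_(m, n)) : exists (S : 'M[C]_(\rank B, m)) (T : 'M[C]_(n, \rank B)), S *m B *m T = 1%:M /\ (S *m B :=: B)%MS.
Proof.
have /row_freeP[T HT] := row_base_free B.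
exists (row_base B *m pinvmx B), T; rewrite mulmxKpV ?eq_row_base //.
by split => //; exact: eq_row_base.
Qed.

Lemma factor_coker m p (X : 'M[C]_(n, m)) (Y : 'M[C]_(n, p)) : kermx X *m Y = 0 -> exists M, Y = X *m M.
Proof.
move=> H; exists (pinvmx X *m Y); rewrite mulmxA; apply/eqP; rewrite -subr_eq0.
rewrite -{1}(mul1mx Y) -mulmxBl.
have : (1%:M - X *m pinvmx X <= kermx X)%MS.
  by apply/sub_kermxP; rewrite mulmxBl mul1mx mulmxKpV ?subrr.
by move=> /submxP[Z ->]; rewrite -mulmxA H mulmx0.
Qed.

Lemma full_rank_prod m p (X : 'M[C]_(m, n)) (T : 'M[C]_(n, m)) (Z : 'M[C]_(p, n)) :
  X *m T \in unitmx -> (Z <= X)%MS -> Z = Z *m T *m invmx (X *m T) *m X.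
Proof. by move=> u /submxP[Y ->]; rewrite -[Y *m X *m T]mulmxA mulmxK. Qed.

Lemma unit_rank m (X : 'M[C]_(m, n)) (T : 'M[C]_(n, m)) : X *m T \in unitmx -> \rank X = m.
Proof.
move=> u; apply/eqP; rewrite eqn_leq rank_leq_row /=.
by rewrite -{1}(mxrank_unit u) mxrankM_maxl.
Qed.

Lemma near1_prod r m (S : 'M[C]_(r, m)) (T : 'M[C]_(n, r)) (B : 'M[C]_(m, n)) (D : C -> 'M[C]_(m, n)) :
  S *m B *m T = 1%:M -> mrapid D ->
  ev (fun z => S *m (B + D z) *m T \in unitmx) /\ mpolyb (fun z => invmx (S *m (B + D z) *m T)).
Proof.
move=> ST HD; apply: near1_inv.
apply: eq_mrapid (mrapidMr (mrapidMl (mpolyb_cst S) HD) (mpolyb_cst T)).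
by apply: ev_all => z; rewrite mulmxDr mulmxDl ST addrAC subrr add0r.
Qed.

(** If A z is not larger than B, the approximations of the vectors of B
    exhaust it. *)
Lemma lower_upper A B : lower A B -> ev (fun z => (\rank (A z) <= \rank B)%N) -> upper A B.
Proof.
move=> [D HD HA] Hr; have [S [T [ST SB]]] := row_base_data B.
have [hu hp] := near1_prod ST HD.
exists (fun z => - (T *m invmx (S *m (B + D z) *m T) *m S *m D z *m cokermx B)).
  apply: mrapidN; apply: mrapidMr (mpolyb_cst _); apply: mrapidMl => //.
  by apply: mpolybM (mpolyb_cst _); apply: mpolybM (mpolyb_cst _) hp.
have := ev_and HA (ev_and Hr hu); apply: ev_mono => z [h1 [h2 h3]].
have le1 : (S *m (B + D z)%R <= A z)%MS by rewrite (submx_trans _ h1) // submxMl.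
have le2 : (A z <= S *m (B + D z)%R)%MS.
  by rewrite -(geq_leqif (mxrank_leqif_sup le1)) (unit_rank h3).
have := full_rank_prod h3 le2 => E.
set V := invmx _ in E *.
have E2 : A z *m cokermx B = A z *m (T *m V *m S *m D z *m cokermx B).
  rewrite {1}E mulmxDr mulmxDr mulmxDl.
  have -> : A z *m T *m V *m (S *m B) *m cokermx B = 0.
    by rewrite -[_ *m (S *m B) *m _]mulmxA -[S *m B *m _]mulmxA mulmx_coker !mulmx0.
  by rewrite add0r !mulmxA.
by rewrite mulmxDr mulmxN E2 subrr.
Qed.

(** Dually, if A z is not smaller than B, it is the whole space of solutions
    of the approximate equations. *)
Lemma upper_lower A B : upper A B -> ev (fun z => (\rank B <= \rank (A z))%N) -> lower A B.
Proof.
move=> [E HE HA] Hr; set c := cokermx B in HA.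
have [S [T [ST SB]]] := row_base_data c.
have [hu hp] := near1_prod ST HE.
have rc : \rank c = (n - \rank B)%N by rewrite mxrank_coker.
exists (fun z => - (B *m E z *m T *m invmx (S *m (c + E z) *m T) *m S)).
  apply: mrapidN; apply: mrapidMr (mpolyb_cst _); apply: mrapidMr hp.
  by apply: mrapidMr (mpolyb_cst _); apply: mrapidMl => //; exact: mpolyb_cst.
have := ev_and HA (ev_and Hr hu); apply: ev_mono => z [h1 [h2 h3]].
have r1 := unit_rank h3.
have rB : (\rank B <= n)%N by exact: rank_leq_col.
have le1 : (A z <= kermx (c + E z)%R)%MS by apply/sub_kermxP.
have r2 : (\rank c <= \rank (c + E z)%R)%N by rewrite -[X in (X <= _)%N]r1 mxrankM_maxr.
have r3 := mxrankS le1; rewrite mxrank_ker in r3.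
have rC : (\rank (c + E z)%R <= \rank c)%N by have := rank_leq_col (c + E z)%R; lia.
have le2 : (kermx (c + E z)%R <= A z)%MS.
  by rewrite -(geq_leqif (mxrank_leqif_sup le1)) mxrank_ker; lia.
apply: submx_trans le2; apply/sub_kermxP.
have le3 : ((c + E z)%R <= S *m (c + E z)%R)%MS.
  by rewrite -(geq_leqif (mxrank_leqif_sup (submxMl _ _))) r1.
have le4 : (B *m E z <= S *m (c + E z)%R)%MS.
  apply: submx_trans le3.
  by have -> : B *m E z = B *m (c + E z); [rewrite mulmxDr mulmx_coker add0r | exact: submxMl].
rewrite mulmxDl mulmxDr mulmx_coker add0r mulNmx -[X in _ - X]mulmxA -(full_rank_prod h3 le4).
by rewrite subrr.
Qed.

Lemma upperS A A' B : ev (fun z => (A' z <= A z)%MS) -> upper A B -> upper A' B.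
Proof.
move=> h [E HE HA]; exists E => //; have := ev_and h HA; apply: ev_mono => z [/submxP[X ->] e].
by rewrite -mulmxA e mulmx0.
Qed.

Lemma upper_cst B : upper (fun=> B) B.
Proof. by exists (fun=> 0); [exact: mrapid0 | apply: ev_all => z; rewrite addr0 mulmx_coker]. Qed.

(** Equations of an intersection are combinations of equations of the two
    subspaces. *)
Lemma upper_cap A1 A2 B1 B2 : upper A1 B1 -> upper A2 B2 ->
  upper (fun z => A1 z :&: A2 z)%MS (B1 :&: B2)%MS.
Proof.
move=> [E1 H1 K1] [E2 H2 K2].
have [M HM] : exists M, cokermx (B1 :&: B2)%MS = row_mx (cokermx B1) (cokermx B2) *m M.
  apply: factor_coker; apply/eqP; rewrite -submxE sub_capmx.
  set K := kermx _; have H : K *m row_mx (cokermx B1) (cokermx B2) = row_mx 0 0.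
    by rewrite row_mx0 mulmx_ker.
  clearbody K; rewrite mul_mx_row in H; have [h1 h2] := eq_row_mx H.
  by apply/andP; split; rewrite submxE; [rewrite h1 | rewrite h2].
exists (fun z => E1 z *m usubmx M + E2 z *m dsubmx M).
  by apply: mrapidD; apply: mrapidMr => //; exact: mpolyb_cst.
have := ev_and K1 K2; apply: ev_mono => z [k1 k2].
have ann A B E : A z *m (cokermx B + E z) = 0 -> (A1 z :&: A2 z <= A z)%MS ->
    (A1 z :&: A2 z)%MS *m (cokermx B + E z) = 0.
  by move=> h /submxP[X ->]; rewrite -mulmxA h mulmx0.
have {}k1 := ann _ _ _ k1 (capmxSl _ _); have {}k2 := ann _ _ _ k2 (capmxSr _ _).
set G := (A1 z :&: A2 z)%MS in k1 k2 *.
have -> : cokermx (B1 :&: B2)%MS = cokermx B1 *m usubmx M + cokermx B2 *m dsubmx M.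
  by rewrite HM -mul_row_col vsubmxK.
rewrite addrACA -!mulmxDl mulmxDr.
by rewrite !mulmxA k1 k2 !mul0mx addr0.
Qed.

Lemma lowerS A A' B : ev (fun z => (A z <= A' z)%MS) -> lower A B -> lower A' B.
Proof.
move=> h [D HD HA]; exists D => //; have := ev_and h HA; apply: ev_mono => z [k e].
exact: submx_trans e k.
Qed.

Lemma lower_sub A B B' : (B' <= B)%MS -> lower A B -> lower A B'.
Proof.
move=> /submxP[X ->] [D HD HA]; exists (fun z => X *m D z); first exact: mrapidMl (mpolyb_cst X) HD.
by move: HA; apply: ev_mono => z h; rewrite -mulmxDr (submx_trans _ h) // submxMl.
Qed.

Lemma lower_add A1 A2 B1 B2 : lower A1 B1 -> lower A2 B2 ->
  lower (fun z => A1 z + A2 z)%MS (B1 + B2)%MS.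
Proof.
move=> [D1 H1 K1] [D2 H2 K2].
have /sub_addsmxP[[X1 X2] /= E] : (B1 + B2 <= B1 + B2)%MS by [].
exists (fun z => X1 *m D1 z + X2 *m D2 z).
  by apply: mrapidD; apply: mrapidMl => //; exact: mpolyb_cst.
have := ev_and K1 K2; apply: ev_mono => z [k1 k2].
by rewrite {1}E addrACA -!mulmxDr addmx_sub_adds // (submx_trans (submxMl _ _)).
Qed.

Lemma lower_limit A B m (G : 'M[C]_(m, n)) : lower A B -> ev (fun z => (A z <= G)%MS) -> (B <= G)%MS.
Proof.
move=> [D HD HA] HG; rewrite submxE; apply/eqP; apply: mrapid_cst.
apply: eq_mrapid (mrapidN (mrapidMr HD (mpolyb_cst (cokermx G)))).
have := ev_and HA HG; apply: ev_mono => z [h1 h2].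
have := submx_trans h1 h2; rewrite submxE mulmxDl addr_eq0 => /eqP ->.
by rewrite ?opprK.
Qed.

End Approx.

(** * The entrywise norm of matrices *)

Section MNorm.
Variable R : realType.
Local Notation C := R[i].

Definition mnorm m n (A : 'M[C]_(m, n)) : R := \sum_i \sum_j cabs (A i j).

Lemma mnorm_ge0 m n (A : 'M[C]_(m, n)) : 0 <= mnorm A.
Proof. by apply: sumr_ge0 => i _; apply: sumr_ge0 => j _; exact: cabs_ge0. Qed.

Lemma mnorm_ge m n (A : 'M[C]_(m, n)) i j : cabs (A i j) <= mnorm A.
Proof.
rewrite /mnorm (bigD1 i) //= (bigD1 j) //= -addrA lerDl.
by apply: addr_ge0; apply: sumr_ge0 => k _; rewrite ?cabs_ge0 //; apply: sumr_ge0 => l _; exact: cabs_ge0.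
Qed.

Lemma mnormD m n (A B : 'M[C]_(m, n)) : mnorm (A + B) <= mnorm A + mnorm B.
Proof.
rewrite /mnorm -big_split; apply: ler_sum => i _; rewrite -big_split; apply: ler_sum => j _.
by rewrite mxE cabsD.
Qed.

Lemma mnormN m n (A : 'M[C]_(m, n)) : mnorm (- A) = mnorm A.
Proof. by apply: eq_bigr => i _; apply: eq_bigr => j _; rewrite mxE cabsN. Qed.

Lemma mnorm_tr m n (A : 'M[C]_(m, n)) : mnorm A^T = mnorm A.
Proof. by rewrite /mnorm exchange_big; do 2!apply: eq_bigr => ? _; rewrite mxE. Qed.

Lemma mnorm_eq0 m n (A : 'M[C]_(m, n)) : mnorm A <= 0 -> A = 0.
Proof.
move=> h; apply/matrixP => i j; rewrite mxE; apply/eqP; rewrite -cabs_eq0 eq_le cabs_ge0 andbT.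
exact: le_trans (mnorm_ge A i j) h.
Qed.

Lemma mnormM m n p (A : 'M[C]_(m, n)) (B : 'M[C]_(n, p)) : mnorm (A *m B) <= mnorm A * mnorm B.
Proof.
rewrite /mnorm mulr_suml; apply: ler_sum => i _.
apply: (@le_trans _ _ (\sum_j \sum_k cabs (A i k) * cabs (B k j))).
  apply: ler_sum => j _; rewrite mxE; apply: (le_trans (cabs_sum _ _ _)).
  by apply: ler_sum => k _; rewrite cabsM.
rewrite exchange_big /= mulr_suml; apply: ler_sum => k _.
rewrite -mulr_sumr ler_wpM2l ?cabs_ge0 // [leRHS](bigD1 k) //= lerDl.
by apply: sumr_ge0 => l _; apply: sumr_ge0 => j _; exact: cabs_ge0.
Qed.

Lemma mnorm_le m n (A : 'M[C]_(m, n)) e : 0 <= e -> (forall i j, cabs (A i j) <= e) -> mnorm A <= (m * n)%:R * e.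
Proof.
move=> e0 h; apply: (@le_trans _ _ (\sum_(i < m) \sum_(j < n) e)).
  by apply: ler_sum => i _; apply: ler_sum => j _; exact: h.
by rewrite !sumr_const !card_ord -mulrnA mulr_natl mulnC.
Qed.

(** From X = X A - X (A - 1) follows |X| <= 2 |X A|, applied to the kernel
    of A and to its inverse. *)
Lemma near1_mnorm r (A : 'M[C]_r) : mnorm (A - 1%:M) <= 2^-1 ->
  A \in unitmx /\ mnorm (invmx A) <= 2 * mnorm (1%:M : 'M[C]_r).
Proof.
move=> h; have uA : A \in unitmx.
  rewrite -row_free_unit -kermx_eq0; apply/eqP/mnorm_eq0.
  have : mnorm (kermx A) <= mnorm (kermx A) * 2^-1.
    have {1}-> : kermx A = kermx A *m - (A - 1%:M).
      by rewrite mulmxN mulmxBr mulmx_ker mulmx1 sub0r opprK.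
    by apply: (le_trans (mnormM _ _)); rewrite mnormN ler_wpM2l ?mnorm_ge0.
  by have := mnorm_ge0 (kermx A); lra.
split => //.
have E : invmx A = 1%:M - invmx A *m (A - 1%:M).
  by rewrite mulmxBr mulVmx // mulmx1 opprB addrC subrK.
have : mnorm (invmx A) <= mnorm (1%:M : 'M[C]_r) + mnorm (invmx A) * 2^-1.
  rewrite {1}E; apply: (le_trans (mnormD _ _)); rewrite mnormN lerD2l.
  by apply: (le_trans (mnormM _ _)); rewrite ler_wpM2l ?mnorm_ge0.
lra.
Qed.

Lemma mnorm_sum m n I (r : seq I) (P : pred I) (f : I -> 'M[C]_(m, n)) :
  mnorm (\sum_(i <- r | P i) f i) <= \sum_(i <- r | P i) mnorm (f i).
Proof.
elim/big_ind2: _ => [|x1 x2 y1 y2 h1 h2|//].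
  by rewrite /mnorm big1 // => i _; rewrite big1 // => j _; rewrite mxE cabs0.
exact: le_trans (mnormD _ _) (lerD h1 h2).
Qed.

End MNorm.

(** * Filtrations opposed to their conjugates *)

Section Filtered.
Variables (R : realType) (n : nat).
Local Notation C := R[i].
Implicit Types (W : int -> 'M[R]_n) (F G : int -> 'M[C]_n).

Lemma conjMK m (A : 'M[C]_(m, n)) : conjM (conjM A) = A.
Proof. by apply/matrixP => i j; rewrite !mxE conjCK. Qed.

Lemma conj_cplx m (A : 'M[R]_(m, n)) : conjM (cplx A) = cplx A.
Proof. by apply/matrixP => i j; rewrite !mxE conj_Creal // complex_real. Qed.

Lemma conjM_sub m1 m2 (A : 'M[C]_(m1, n)) (B : 'M[C]_(m2, n)) : (conjM A <= conjM B)%MS = (A <= B)%MS.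
Proof. exact: map_submx. Qed.

Lemma conjM_sub2 m1 m2 (A : 'M[C]_(m1, n)) (B : 'M[C]_(m2, n)) : (conjM A <= B)%MS = (A <= conjM B)%MS.
Proof. by rewrite -{1}(conjMK B) conjM_sub. Qed.

Lemma cplx_sub m1 m2 (A : 'M[R]_(m1, n)) (B : 'M[R]_(m2, n)) : (cplx A <= cplx B)%MS = (A <= B)%MS.
Proof. exact: map_submx. Qed.

Lemma conj_grF W F k p : (conjM (grF W F k p) :=: (conjM (F p) :&: cplx (W k)) + cplx (W (k - 1)))%MS.
Proof.
rewrite /conjM /grF; apply: eqmx_trans (map_addsmx _ _ _) _; apply: adds_eqmx.
  apply: eqmx_trans (map_capmx _ _ _) _; apply: cap_eqmx => //.
  by rewrite -[map_mx _ (cplx _)]/(conjM _) conj_cplx.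
by rewrite -[map_mx _ (cplx _)]/(conjM _) conj_cplx.
Qed.

Section Fsum.
Variables (W : int -> 'M[R]_n) (k0 : int).
Hypothesis Winc : forall k l, k <= l -> (W k <= W l)%MS.
Hypothesis W0 : (W k0 :=: (0 : 'M[R]_n))%MS.

Local Notation lev j := (k0 + (j : nat)%:Z)%R.

Fixpoint fsum (G : int -> 'M[C]_n) (j : nat) : 'M[C]_n :=
  if j is j'.+1 then (fsum G j' + (G (lev j) :&: cplx (W (lev j))))%MS else 0.

Lemma cW_inc k l : k <= l -> (cplx (W k) <= cplx (W l))%MS.
Proof. by move=> kl; rewrite cplx_sub Winc. Qed.

Lemma cW_0 k : k <= k0 -> cplx (W k) = 0.
Proof.
move=> kk; apply/eqP; rewrite -submx0 -(map_mx0 (real_complex R)) -[X in (_ <= X)%MS]/(cplx _) cplx_sub.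
by rewrite (submx_trans (Winc kk)) // W0.
Qed.

Lemma levS j : lev j.+1 - 1 = lev j.
Proof. by lia. Qed.

Lemma lev0 : lev 0 = k0.
Proof. by lia. Qed.

Lemma fsum_subW G j : (fsum G j <= cplx (W (lev j)))%MS.
Proof.
elim: j => [|j IH] /=; first exact: sub0mx.
by rewrite addsmx_sub capmxSr andbT (submx_trans IH) // cW_inc //; lia.
Qed.

Lemma fsum_sup G j i : (i <= j)%N -> (G (lev i) :&: cplx (W (lev i)) <= fsum G j)%MS.
Proof.
elim: j => [|j IH]; first by rewrite leqn0 => /eqP ->; rewrite cW_0 ?lev0 // capmx0 sub0mx.
rewrite leq_eqVlt => /predU1P[->|/IH h] /=; first exact: addsmxSr.
exact: submx_trans h (addsmxSl _ _).
Qed.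

Lemma fsum_cap G j : (forall l : int, (G (l + 1)%R <= G l)%MS) ->
  (fsum G j.+1 :&: cplx (W (lev j)) <= fsum G j)%MS.
Proof.
move=> Gd /=; rewrite -(matrix_modl _ (fsum_subW G j)) addsmx_sub submx_refl /=.
apply: submx_trans (fsum_sup G (leqnn j)).
rewrite sub_capmx capmxSr andbT (submx_trans (capmxSl _ _)) // (submx_trans (capmxSl _ _)) //.
have -> : lev j.+1 = lev j + 1 by lia.
exact: Gd.
Qed.

Lemma fsum_rank G j : (forall l : int, (G (l + 1)%R <= G l)%MS) ->
  (\rank (fsum G j.+1) + \rank (G (lev j.+1) :&: cplx (W (lev j))))%N =
  (\rank (fsum G j) + \rank (G (lev j.+1) :&: cplx (W (lev j.+1))))%N.
Proof.
move=> Gd; rewrite [fsum G j.+1]/=; set A := fsum G j; set B := (G _ :&: cplx (W (lev j.+1)))%MS.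
rewrite -(mxrank_sum_cap A B); congr (_ + _)%N; apply: eqmx_rank; apply/andP; split; rewrite sub_capmx; apply/andP; split.
- apply: submx_trans (fsum_sup G (leqnn j)); rewrite sub_capmx capmxSr andbT.
  rewrite (submx_trans (capmxSl _ _)) //.
  have -> : lev j.+1 = lev j + 1 by lia.
  exact: Gd.
- rewrite /B sub_capmx capmxSl (submx_trans (capmxSr _ _)) // cW_inc //; lia.
- by rewrite (submx_trans (capmxSr _ _)) // capmxSl.
- by rewrite (submx_trans (capmxSl _ _)) // fsum_subW.
Qed.

Section Opposite.
Variables (F : int -> 'M[C]_n) (e : int -> int).
Hypothesis Fdec : forall p q, p <= q -> (F q <= F p)%MS.
Hypothesis Hpure : pure_on_Gr W F.
Hypothesis e1 : forall l : int, e l <= e (l + 1) <= e l + 1.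

Let X := fsum (fun l => F (e l)).
Let U := fsum (fun l => conjM (F (l - e l + 1))).

Let Xd (l : int) : (F (e (l + 1)%R) <= F (e l))%MS.
Proof. by apply: Fdec; case/andP: (e1 l). Qed.
Let Ud (l : int) : (conjM (F (l + 1 - e (l + 1) + 1)%R) <= conjM (F (l - e l + 1)%R))%MS.
Proof. by rewrite conjM_sub; apply: Fdec; case/andP: (e1 l) => _ h; lia. Qed.

(** On each Gr^W_l the filtration F is opposed to its conjugate at the level
    e l, which pushes an element common to X and U down to lower weights. That
    e grows by at most 1 makes the pieces of both sums decreasing, as
    [fsum_cap] requires. *)
Lemma opp_cap j : (X j :&: U j)%MS = 0.
Proof.
apply/eqP; rewrite -submx0; elim: j => [|j IH]; first exact: capmxSl.
apply: (submx_trans _ IH).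
have Z : (X j.+1 :&: U j.+1 <= cplx (W (lev j)))%MS.
  have [_ h] := Hpure (lev j.+1) (e (lev j.+1)); rewrite levS in h.
  rewrite -h; apply: capmxS.
    by rewrite /= addsmx_sub /grF addsmxSl andbT (submx_trans (fsum_subW _ _)) // levS addsmxSr.
  by rewrite conj_grF /= addsmx_sub addsmxSl andbT (submx_trans (fsum_subW _ _)) // levS addsmxSr.
rewrite sub_capmx; apply/andP; split.
  by apply: submx_trans (@fsum_cap (fun l => F (e l)) j Xd); rewrite sub_capmx Z capmxSl.
by apply: submx_trans (@fsum_cap (fun l => conjM (F (l - e l + 1))) j Ud); rewrite sub_capmx Z capmxSr.
Qed.

End Opposite.
End Fsum.
End Filtered.

(** * Deligne bigradings *)

Section Hodge.
Variables (R : realType) (n : nat).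
Local Notation C := R[i].
Implicit Types (W : int -> 'M[R]_n) (F G : int -> 'M[C]_n).

Lemma seq_sum_sup (T : eqType) (s : seq T) (P : pred T) (B : T -> 'M[C]_n) x :
  x \in s -> P x -> (B x <= \sum_(y <- s | P y) B y)%MS.
Proof.
elim: s => // y s IH; rewrite inE big_cons => /predU1P[<- -> |/IH h /h {}h].
  exact: addsmxSl.
by case: (P y) => //; exact: submx_trans h (addsmxSr _ _).
Qed.

Lemma seq_sum_sub (T : eqType) (s : seq T) (P : pred T) (B : T -> 'M[C]_n) m (D : 'M[C]_(m, n)) :
  (forall x, x \in s -> P x -> (B x <= D)%MS) -> (\sum_(y <- s | P y) B y <= D)%MS.
Proof.
move=> H; rewrite big_seq_cond; elim/big_ind: _ => [|A1 A2 h1 h2|x /andP[/H h /h //]].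
  exact: sub0mx.
by rewrite addsmx_sub h1.
Qed.

(** The levels that isolate I^(p,q), for k = p + q: F is opposed to its
    conjugate at level p in weights less than k, and at level p + 1 from k
    on. *)
Definition hodge_step (p k l : int) : int := p + (k <= l)%R%:Z.

Lemma hodge_step_mono (p k l : int) : hodge_step p k l <= hodge_step p k (l + 1) <= hodge_step p k l + 1.
Proof. by rewrite /hodge_step; case: (lerP k l) => h1; case: (lerP k (l + 1)) => h2 /=; lia. Qed.

Lemma hodge_step_le (p k l l' : int) : hodge_step p k l' <= hodge_step p k l + 1.
Proof. by rewrite /hodge_step; case: (lerP k l) => h1; case: (lerP k l') => h2 /=; lia. Qed.

(** With k = k0 + j and q = k - p, the sum of conj F^q :&: W_k and of the
    conj F^(q-i+1) :&: W_(k-i) for i > 0. *)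
Definition Uspace W k0 F (p : int) (j : nat) : 'M[C]_n :=
  fsum W k0 (fun l => conjM (F (l - hodge_step p (k0 + j%:Z) l + 1))) j.

Section Bigrading.
Variables (W : int -> 'M[R]_n) (F : int -> 'M[C]_n) (k0 : int) (I : int -> int -> 'M[C]_n).
Hypothesis Winc : forall k l, k <= l -> (W k <= W l)%MS.
Hypothesis W0 : (W k0 :=: (0 : 'M[R]_n))%MS.
Hypothesis Fdec : forall p q, p <= q -> (F q <= F p)%MS.
Hypothesis HI : deligne_bigrading W F I.

Lemma bigrading_F (p q : int) : (I p q <= F p)%MS.
Proof.
case: HI => s [[us Is] _ HF _ _]; rewrite HF.
have [h|/Is ->] := boolP ((p, q) \in s); last exact: sub0mx.
exact: (@seq_sum_sup _ s (fun ab => p <= ab.1) (fun ab => I ab.1 ab.2) (p, q)).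
Qed.

Lemma bigrading_W (p q : int) : (I p q <= cplx (W (p + q)%R))%MS.
Proof.
case: HI => s [[us Is] _ _ HW _]; rewrite HW.
have [h|/Is ->] := boolP ((p, q) \in s); last exact: sub0mx.
exact: (@seq_sum_sup _ s (fun ab => ab.1 + ab.2 <= p + q) (fun ab => I ab.1 ab.2) (p, q)).
Qed.

Lemma bigrading_low (p q : int) : (p + q <= k0)%R -> I p q = 0.
Proof.
move=> h; apply/eqP; rewrite -submx0 (submx_trans (bigrading_W p q)) // (cW_0 Winc W0 h).
exact: submx_refl.
Qed.

(** Induction on the weight: up to terms of lower weight, I^(a,b) is the
    conjugate of I^(b,a), contained in conj F^b. *)
Lemma bigrading_fsum (e : int -> int) (j i : nat) (a b : int) : (forall l l' : int, l <= l' -> e l' <= e l + 1) ->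
  (i <= j)%N -> a + b = k0 + i%:Z -> a + 1 <= e (a + b) ->
  (I a b <= fsum W k0 (fun l => conjM (F (l - e l + 1))) j)%MS.
Proof.
move=> He; elim/ltn_ind: i a b => i IH a b ij ab hab.
case: HI => s [[us Is] _ _ _ /(_ b a) /= HC].
set low := (\sum_(ab <- s | _) _)%MS in HC.
have HX : (I a b <= conjM (I b a) + low)%MS by rewrite HC addsmxSl.
apply: (submx_trans HX).
rewrite addsmx_sub; apply/andP; split.
  apply: submx_trans (fsum_sup Winc W0 _ ij); rewrite -ab sub_capmx conjM_sub; apply/andP; split.
    by apply: (submx_trans (bigrading_F b a)); apply: Fdec; lia.
  by rewrite conjM_sub2 conj_cplx addrC bigrading_W.
apply: seq_sum_sub => -[a' b'] _ /=; move: (a' : int) (b' : int) => {a' b'} a' b' /andP[ha hb].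
have [h|h] := lerP (a' + b') k0; first by rewrite bigrading_low // sub0mx.
have : e (a + b) <= e (a' + b') + 1 by apply: He; lia.
move=> h1; have [i' Hi'] : exists i' : nat, a' + b' = k0 + i'%:Z.
  by exists (absz (a' + b' - k0)%R); lia.
have ii : (i' < i)%N by lia.
by apply: (IH i' ii a' b' _ Hi' _); lia.
Qed.

Lemma bigrading_U (p q : int) (j : nat) : p + q = k0 + j%:Z -> (I p q <= Uspace W k0 F p j)%MS.
Proof.
move=> h; apply: (@bigrading_fsum _ j j) => //; first by move=> l l' _; exact: hodge_step_le.
by rewrite /hodge_step h lexx.
Qed.

End Bigrading.

Lemma fsum_rank_eq W W' k0 G G' j :
  (forall k l, k <= l -> (W k <= W l)%MS) -> (W k0 :=: (0 : 'M[R]_n))%MS ->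
  (forall k l, k <= l -> (W' k <= W' l)%MS) -> (W' k0 :=: (0 : 'M[R]_n))%MS ->
  (forall l : int, (G (l + 1)%R <= G l)%MS) -> (forall l : int, (G' (l + 1)%R <= G' l)%MS) ->
  (forall p k, \rank (G p :&: cplx (W k)) = \rank (G' p :&: cplx (W' k))) ->
  \rank (fsum W k0 G j) = \rank (fsum W' k0 G' j).
Proof.
move=> Wi W0 Wi' W0' Gd Gd' H; elim: j => // j IH.
have h1 := fsum_rank Wi W0 j Gd; have h2 := fsum_rank Wi' W0' j Gd'.
by rewrite !H in h1; lia.
Qed.

Section HodgeNumbers.
Variables (W : int -> 'M[R]_n) (F : int -> 'M[C]_n).
Hypothesis Winc : increasing_filtration W.
Hypothesis Fdec : decreasing_filtration F.
Hypothesis Hpure : pure_on_Gr W F.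

Lemma grF_W (k p : int) : (cplx (W (k - 1)) <= grF W F k p)%MS.
Proof. exact: addsmxSr. Qed.

Lemma grF_sub (k p : int) : (grF W F k p <= cplx (W k))%MS.
Proof. by rewrite addsmx_sub capmxSr cplx_sub; case: Winc => -> //; lia. Qed.

(** On Gr^W_k the component H^(p,k-p) is a complement of F^(p+1) in F^p. *)
Lemma hodge_rank (k p : int) : \rank (grF W F k p) = (hodge_number W F p (k - p) + \rank (grF W F k (p + 1)%R))%N.
Proof.
have [h1 h2] := Hpure k (p + 1).
have E : k - (p + 1) + 1 = k - p by lia.
rewrite E in h1 h2; rewrite /hodge_number /hodge_component.
have -> : p + (k - p) = k by lia.
set A := grF W F k p; set A' := grF W F k (p + 1)%R in h1 h2 *.
set B := conjM (grF W F k (k - p)) in h1 h2 *.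
have AA : (A' <= A)%MS.
  by apply: addsmxS => //; apply: capmxS => //; case: Fdec => -> //; lia.
have AB : (A + B :=: cplx (W k))%MS.
  apply/eqmxP/andP; split; last by rewrite -h1 addsmxS.
  by rewrite addsmx_sub grF_sub conjM_sub2 conj_cplx grF_sub.
have WB : (cplx (W (k - 1)) <= A :&: B)%MS.
  by rewrite sub_capmx grF_W -conj_cplx conjM_sub grF_W.
have r1 := mxrank_sum_cap A B; have r2 := mxrank_sum_cap A' B.
rewrite AB h1 h2 in r1 r2.
have r3 := mxrankS WB.
have r4 : \rank (cplx (W (k - 1))) = \rank (W (k - 1)) by exact: mxrank_map.
lia.
Qed.

Lemma grF_rank (k p : int) : (\rank (grF W F k p) + \rank (F p :&: cplx (W (k - 1))) =
   \rank (F p :&: cplx (W k)) + \rank (W (k - 1)))%N.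
Proof.
rewrite -(mxrank_map (real_complex R) (W (k - 1))) -[map_mx _ _]/(cplx _).
rewrite -(mxrank_sum_cap (F p :&: cplx (W k))%MS) /grF; congr (_ + _)%N.
apply: eqmx_rank; apply/andP; split; rewrite !sub_capmx ?capmxSl ?capmxSr ?andbT /=.
  by rewrite (submx_trans (capmxSr _ _)) // cplx_sub; case: Winc => -> //; lia.
by rewrite (submx_trans (capmxSl _ _)) // capmxSl.
Qed.

End HodgeNumbers.

Lemma grF_cap_rank W F F' : increasing_filtration W ->
  (forall p k, \rank (grF W F k p) = \rank (grF W F' k p)) ->
  forall p k, \rank (F p :&: cplx (W k)) = \rank (F' p :&: cplx (W k)).
Proof.
move=> Wi Hgr p k; case: (Wi) => inc [k0 W0] _.
have base l : l <= k0 -> \rank (F p :&: cplx (W l)) = \rank (F' p :&: cplx (W l)).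
  by move=> h; rewrite (cW_0 inc W0 h) !capmx0.
have [h|h] := lerP k k0; first exact: base.
have [N ->] : exists N : nat, k = k0 + N%:Z by exists (absz (k - k0)%R); lia.
elim: N => [|N IH]; first by apply: base; lia.
have h1 := @grF_rank W F Wi (k0 + N.+1%:Z) p; have h2 := @grF_rank W F' Wi (k0 + N.+1%:Z) p.
have E : k0 + N.+1%:Z - 1 = k0 + N%:Z by lia.
by rewrite E in h1 h2; have := Hgr p (k0 + N.+1%:Z); lia.
Qed.

(** Hodge numbers determine the ranks of F^p on each Gr^W_k by descending
    induction on p, and these the ranks on W_k by induction on k. *)
Lemma hodge_number_cap_rank W F F' : increasing_filtration W ->
  decreasing_filtration F -> decreasing_filtration F' ->
  pure_on_Gr W F -> pure_on_Gr W F' ->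
  (forall p q, hodge_number W F p q = hodge_number W F' p q) ->
  forall p k, \rank (F p :&: cplx (W k)) = \rank (F' p :&: cplx (W k)).
Proof.
move=> Wi Fd Fd' HF HF' Hh.
have [m Hm] : exists m, forall p k, m <= p -> \rank (grF W F k p) = \rank (grF W F' k p).
  case: Fd => d [m hm] _; case: Fd' => d' [m' hm'] _.
  exists (Order.max m m') => p k; rewrite ge_max => /andP[h h'].
  have E : (F p <= (0 : 'M[C]_n))%MS by rewrite -hm d.
  have E' : (F' p <= (0 : 'M[C]_n))%MS by rewrite -hm' d'.
  by move: E E'; rewrite !submx0 /grF => /eqP -> /eqP ->.
apply: grF_cap_rank => // p k.
have [N hN] : exists N : nat, m <= p + N%:Z by exists (absz (m - p)%R); lia.
elim: N p hN => [|N IH] p hN; first by apply: Hm; lia.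
rewrite (hodge_rank Wi Fd HF) (hodge_rank Wi Fd' HF') Hh (IH (p + 1)) //; lia.
Qed.

Section Range.
Variables (W : int -> 'M[R]_n) (F : int -> 'M[C]_n) (I : int -> int -> 'M[C]_n).
Hypothesis HI : deligne_bigrading W F I.

(** The ranks in a direct sum add up, and leave nothing for the terms
    outside a part that already spans. *)
Lemma direct_full (s : seq (int * int)) (P : pred (int * int)) (A : int * int -> 'M[C]_n) :
  mxdirect (\sum_(ab <- s) A ab)%MS -> (\sum_(ab <- s | P ab) A ab :=: 1%:M)%MS ->
  forall ab, ab \in s -> ~~ P ab -> A ab = 0.
Proof.
move=> /mxdirectP /= Hd H1 ab abs Pab.
have h1 : (\rank (\sum_(ab <- s | P ab) A ab)%MS <= \sum_(ab <- s | P ab) \rank (A ab))%N.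
  elim/big_ind2: _ => [|X x Y y hx hy|//]; first by rewrite mxrank0.
  by apply: leq_trans (leq_add hx hy); apply: leq_trans (mxrank_adds_leqif _ _) _.
have h2 : (\rank (\sum_(ab <- s) A ab)%MS <= n)%N by exact: rank_leq_row.
rewrite Hd (bigID P) /= in h2; rewrite H1 mxrank1 in h1.
have : (\sum_(ab <- s | ~~ P ab) \rank (A ab) == 0)%N by lia.
rewrite sum_nat_seq_eq0 => /allP /(_ _ abs) /implyP /(_ Pab).
by rewrite mxrank_eq0 => /eqP.
Qed.

Lemma bigrading_full_F p0 : (F p0 :=: 1%:M)%MS -> forall p q, p < p0 -> I p q = 0.
Proof.
case: HI => s [[_ Is] [Hd _] HF _ _] F1 p q pp.
have [h|/Is //] := boolP ((p, q) \in s).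
apply: (@direct_full s (fun ab => p0 <= ab.1) (fun ab => I ab.1 ab.2) Hd _ (p, q)) => //=.
  by apply: eqmx_trans F1; apply: eqmx_sym; exact: HF.
by rewrite -ltNge.
Qed.

Lemma bigrading_full_W k1 : (W k1 :=: 1%:M)%MS -> forall p q, k1 < p + q -> I p q = 0.
Proof.
case: HI => s [[_ Is] [Hd _] _ HW _] W1 p q pp.
have [h|/Is //] := boolP ((p, q) \in s).
apply: (@direct_full s (fun ab => ab.1 + ab.2 <= k1) (fun ab => I ab.1 ab.2) Hd _ (p, q)) => //=.
  apply: eqmx_trans (eqmx_sym (HW _)) _; apply/eqmxP; rewrite submx1 /= -(map_mx1 (real_complex R)).
  by rewrite -[X in (X <= _)%MS]/(cplx _) cplx_sub W1 submx_refl.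
by rewrite -ltNge.
Qed.

(** Components vanish outside the box of Hodge levels in [p0, p0 + a) and
    weights in (k0, k0 + b], which gives all fibres a common index set. *)
Lemma bigrading_box (p0 k0 : int) (a b : nat) :
  (forall k l, k <= l -> (W k <= W l)%MS) -> (W k0 :=: (0 : 'M[R]_n))%MS -> (W (k0 + b%:Z)%R :=: 1%:M)%MS ->
  (forall p q, p <= q -> (F q <= F p)%MS) -> (F (p0 + a%:Z)%R :=: (0 : 'M[C]_n))%MS -> (F p0 :=: 1%:M)%MS ->
  (1%:M <= \sum_(t : 'I_a * 'I_b) I (p0 + (t.1 : nat)%:Z) (k0 + (t.2 : nat).+1%:Z - (p0 + (t.1 : nat)%:Z)))%MS.
Proof.
move=> Wi W0 W1 Fd F0 F1; have [s [_ [_ Hs] _ _ _]] := HI.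
rewrite -Hs; apply: seq_sum_sub => -[p q] _ _ /=.
have [->|I0] := eqVneq (I p q) 0; first exact: sub0mx.
have hp : p0 <= p by rewrite leNgt; apply: contraNN I0 => h; rewrite (bigrading_full_F F1 _ h).
have hk : p + q <= k0 + b%:Z by rewrite leNgt; apply: contraNN I0 => h; rewrite (bigrading_full_W W1 h).
have hp1 : p < p0 + a%:Z.
  rewrite ltNge; apply: contraNN I0 => h; rewrite -submx0 (submx_trans (bigrading_F HI p q)) //.
  by rewrite (submx_trans (Fd _ _ h)) // F0.
have hk0 : k0 < p + q.
  by rewrite ltNge; apply: contraNN I0 => h; rewrite (bigrading_low Wi W0 HI h).
have h1 : (absz (p - p0)%R < a)%N by lia.
have h2 : ((absz (p + q - k0)%R).-1 < b)%N by lia.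
apply: (sumsmx_sup (Ordinal h1, Ordinal h2)) => //=.
have -> : p0 + (absz (p - p0)%R)%:Z = p by lia.
have -> : k0 + (absz (p + q - k0)%R).-1.+1%:Z - p = q by lia.
exact: submx_refl.
Qed.

End Range.

End Hodge.

(** * Vectors near independent subspaces *)

Section Independence.
Variables (R : realType) (n : nat).
Local Notation C := R[i].
Variables (W : int -> 'M[R]_n) (F : int -> 'M[C]_n) (k0 : int).
Hypothesis Winc : forall k l, k <= l -> (W k <= W l)%MS.
Hypothesis W0 : (W k0 :=: (0 : 'M[R]_n))%MS.
Hypothesis Fdec : forall p q, p <= q -> (F q <= F p)%MS.
Hypothesis Hpure : pure_on_Gr W F.

(** Deligne's formula for I^(p,q), with p + q = k0 + j, which makes sense
    for any filtration. *)
Definition Jspace (p : int) (j : nat) : 'M[C]_n :=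
  ((F p :&: cplx (W (k0 + j%:Z)%R)) :&: Uspace W k0 F p j)%MS.

Lemma Uspace_conj (p : int) (j : nat) :
  (Uspace W k0 F p j.+1 <= conjM (grF W F (k0 + j.+1%:Z) (k0 + j.+1%:Z - p)))%MS.
Proof.
rewrite conj_grF /Uspace /= /hodge_step lexx /= addsmx_sub; apply/andP; split.
  by rewrite (submx_trans (fsum_subW k0 Winc _ _)) // levS addsmxSr.
have -> : k0 + j.+1%:Z - (p + 1%:Z) + 1 = k0 + j.+1%:Z - p by lia.
exact: addsmxSl.
Qed.

(** Modulo W_(k-1) such a vector is in F^(p+1) and in the conjugate of
    F^(k-p), which are opposed. It is thus in F^p :&: W_(k-1), a piece of
    the space X that [opp_cap] shows to be disjoint from U. *)
Lemma J_step (p : int) (j : nat) (x : 'rV[C]_n) :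
  (x <= Jspace p j.+1)%MS -> (x <= grF W F (k0 + j.+1%:Z) (p + 1))%MS -> x = 0.
Proof.
rewrite /Jspace !sub_capmx => /andP[/andP[xF xW] xU] xG.
have xW' : (x <= cplx (W (k0 + j%:Z)%R))%MS.
  have [_ h] := Hpure (k0 + j.+1%:Z) (p + 1); rewrite levS in h.
  rewrite -h sub_capmx xG (submx_trans xU) //.
  have -> : k0 + j.+1%:Z - (p + 1) + 1 = k0 + j.+1%:Z - p by lia.
  exact: Uspace_conj.
have e1 := hodge_step_mono p (k0 + j.+1%:Z).
apply/eqP; rewrite -submx0 -(opp_cap Winc W0 Fdec Hpure e1 j.+1) sub_capmx xU andbT.
apply: submx_trans (addsmxSl _ _); apply: submx_trans (fsum_sup Winc W0 _ (leqnn j)).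
rewrite sub_capmx xW' andbT.
have -> : hodge_step p (k0 + j.+1%:Z) (k0 + j%:Z) = p by rewrite /hodge_step; case: lerP => //; lia.
by [].
Qed.

(** In a linear relation, a nonzero term of largest weight, and of smallest
    p among these, would be in F^(p+1) modulo lower weights. *)
Lemma J_indep (a b : nat) (p0 : int) (x : 'I_a * 'I_b -> 'rV[C]_n) :
  (forall t, (x t <= Jspace (p0 + (t.1 : nat)%:Z)%R (t.2 : nat).+1)%MS) ->
  \sum_t x t = 0 -> forall t, x t = 0.
Proof.
move=> Hx Hsum t0; apply/eqP/contraT => x0.
(* largest weight first, then smallest p *)
pose mu (t : 'I_a * 'I_b) := (t.2 * a.+1 + (a - t.1))%N.
case: (@arg_maxnP _ t0 (fun t => x t != 0) mu x0) => -[i j] xij Hmax.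
case/negP: xij; apply/eqP; apply: (J_step (Hx (i, j))) => /=.
have -> : x (i, j) = - \sum_(t | t != (i, j)) x t.
  by apply/eqP; rewrite -addr_eq0; apply/eqP; rewrite -[RHS]Hsum [RHS](bigD1 (i, j)).
rewrite -scaleN1r; apply/scalemx_sub/summx_sub => -[i' j'] tt.
have [->|xt] := eqVneq (x (i', j')) 0; first exact: sub0mx.
have := Hmax _ xt; rewrite /mu /= => Hm.
have := Hx (i', j'); rewrite /Jspace /= !sub_capmx => /andP[/andP[xF xW] _].
have ia := ltn_ord i; have ia' := ltn_ord i'.
have [jj|jj] := ltnP j' j.
  apply: submx_trans (addsmxSr _ _); apply: (submx_trans xW).
  by rewrite cplx_sub; apply: Winc; lia.
have jE : j' = j :> nat.
  apply/eqP; rewrite eqn_leq jj andbT leqNgt; apply/negP => jl.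
  have := leq_mul jl (leqnn a.+1); rewrite mulSn; lia.
have ii : (i < i')%N.
  rewrite jE in Hm; rewrite ltnNge; apply/negP => ii.
  have E : i' = i :> nat by lia.
  by case/negP: tt; apply/eqP; congr (_, _); apply: val_inj.
apply: submx_trans (addsmxSl _ _); rewrite sub_capmx -jE xW andbT.
by apply: (submx_trans xF); apply: Fdec; lia.
Qed.

End Independence.

Section BoundedComponents.
Variables (R : realType) (n : nat) (T : finType).
Local Notation C := R[i].
Variables (A : T -> C -> 'M[C]_n) (B : T -> 'M[C]_n).
Hypothesis HA : forall t, upper (A t) (B t).
Hypothesis indep : forall x : T -> 'rV[C]_n, (forall t, (x t <= B t)%MS) -> \sum_t x t = 0 -> forall t, x t = 0.

Lemma components_proj : exists P : T -> 'M[C]_n, forall x : T -> 'rV[C]_n, (forall t, (x t <= B t)%MS) ->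
  forall t, x t = (\sum_t' x t') *m P t.
Proof.
pose S t := (\sum_(t' | t' != t) B t')%MS.
have cap0 t : (B t :&: S t)%MS = 0.
  apply/eqP/rowV0P => v; rewrite sub_capmx => /andP[vB /sub_sumsmxP[u Hu]].
  pose x t' := if t' == t then v else - (u t' *m B t').
  have Hx t' : (x t' <= B t')%MS.
    rewrite /x; case: eqP => [->//|_]; by rewrite -mulNmx submxMl.
  have xs : \sum_t' x t' = 0.
    rewrite (bigD1 t) //= {1}/x eqxx {1}Hu; apply/eqP; rewrite addr_eq0 -sumrN; apply/eqP.
    by apply: eq_bigr => t' /negbTE h; rewrite /x h opprK.
  by have := indep Hx xs t; rewrite /x eqxx.
exists (fun t => proj_mx (B t) (S t)) => x Hx t.
rewrite (bigD1 t) //= mulmxDl (proj_mx_id (cap0 t) (Hx t)).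
rewrite (proj_mx_0 (cap0 t)) ?addr0 //.
by apply: summx_sub => t' tt; rewrite (submx_trans (Hx t')) // (sumsmx_sup t').
Qed.

(** Up to a small multiple of their size the y t lie in the independent
    subspaces B t, on whose sum components are continuous; the small
    multiple is then absorbed. *)
Lemma bounded_components : exists c : R, ev (fun z => forall y : T -> 'rV[C]_n,
  (forall t, (y t <= A t z)%MS) -> forall t, mnorm (y t) <= c * mnorm (\sum_t y t)).
Proof.
have [P HP] := components_proj.
have [E HE] : exists E : T -> C -> 'M[C]_n, forall t, mrapid (E t) /\
    ev (fun z => A t z *m (cokermx (B t) + E t z) = 0).
  have H t : exists E : C -> 'M[C]_n, mrapid E /\ ev (fun z => A t z *m (cokermx (B t) + E z) = 0).
    by have [E h1 h2] := HA t; exists E.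
  by exists (fun t => projT1 (cid (H t))) => t; exact: (projT2 (cid (H t))).
(* Q turns the small value of y t on the equations of B t into a small
   correction that brings y t into B t *)
pose Q t := pinvmx (cokermx (B t)).
have HQ t (y : 'rV[C]_n) : (y - y *m cokermx (B t) *m Q t <= B t)%MS.
  rewrite submxE mulmxBl -[y *m _ *m _ *m _]mulmxA -[y *m cokermx _ *m _]mulmxA.
  by rewrite [cokermx _ *m (_ *m _)]mulmxA mulmxKpV // subrr.
have bnd (Z : T -> 'M[C]_n) : exists c : R, 0 <= c /\ forall t (x : 'rV_n), mnorm (x *m Z t) <= c * mnorm x.
  exists (\sum_t mnorm (Z t)); split; first by apply: sumr_ge0 => t _; exact: mnorm_ge0.
  move=> t x; apply: (le_trans (mnormM _ _)); rewrite mulrC ler_wpM2r ?mnorm_ge0 //.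
  by rewrite (bigD1 t) //= lerDl sumr_ge0 // => *; exact: mnorm_ge0.
have [cP [cP0 HcP]] := bnd P; have [cQ [cQ0 HcQ]] := bnd Q.
pose N : R := #|T|%:R.
pose K := (cP * N + 1) * cQ * N.
have K0 : 0 <= K by rewrite !mulr_ge0 // addr_ge0 // mulr_ge0.
pose e := (2 * (1 + (n * n)%:R) * (1 + K))^-1.
have n1 : 0 < 1 + (n * n)%:R :> R by rewrite ltr_pwDl.
have K1 : 0 < 1 + K by rewrite ltr_pwDl.
have e0 : 0 < e by rewrite invr_gt0 !mulr_gt0.
have small : ev (fun z => forall t, (forall ij : 'I_n * 'I_n, cabs (E t z ij.1 ij.2) <= e) /\
    A t z *m (cokermx (B t) + E t z) = 0).
  apply: ev_fin => t; apply: ev_and; last by case: (HE t).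
  by apply: ev_fin => -[i j]; apply: rapid_small => //; case: (HE t).
exists (2 * cP * N); move: small; apply: ev_mono => z Hz y Hy.
set s := \sum_t y t; pose Y := \sum_t mnorm (y t).
have Y0 : 0 <= Y by apply: sumr_ge0 => t _; exact: mnorm_ge0.
have yY t : mnorm (y t) <= Y by rewrite /Y (bigD1 t) //= lerDl sumr_ge0 // => *; exact: mnorm_ge0.
pose d t := y t *m cokermx (B t) *m Q t.
have Hd t : mnorm (d t) <= cQ * ((n * n)%:R * e * Y).
  apply: (le_trans (HcQ t _)); rewrite ler_wpM2l //.
  have [h1 h2] := Hz t.
  have -> : y t *m cokermx (B t) = - (y t *m E t z).
    have /submxP[u Hu] := Hy t; apply/eqP; rewrite -addr_eq0 -mulmxDr Hu -mulmxA h2 mulmx0 //.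
  rewrite mnormN; apply: (le_trans (mnormM _ _)); rewrite mulrC; apply: ler_pM; rewrite ?mnorm_ge0 //.
  by apply: mnorm_le => [|i j]; [exact: ltW | exact: (h1 (i, j))].
have HY t : mnorm (y t) <= cP * mnorm s + (cP * N + 1) * (cQ * ((n * n)%:R * e * Y)).
  have -> : y t = (s - \sum_t' d t') *m P t + d t.
    rewrite -sumrB -(HP (fun t => y t - d t)) ?subrK // => t'; exact: HQ.
  apply: (le_trans (mnormD _ _)); rewrite mulrDl mul1r addrA; apply: lerD => //.
  apply: (le_trans (HcP t _)); rewrite -mulrA -mulrDr ler_wpM2l //.
  apply: (le_trans (mnormD _ _)); rewrite mnormN lerD2l; apply: (le_trans (mnorm_sum _ _ _)).
  apply: (@le_trans _ _ (\sum_(t' : T) cQ * ((n * n)%:R * e * Y))); first by apply: ler_sum => t' _; exact: Hd.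
  by rewrite sumr_const -[leLHS]mulr_natl.
have HS : Y <= N * (cP * mnorm s) + K * (n * n)%:R * e * Y.
  apply: (@le_trans _ _ (\sum_(t : T) (cP * mnorm s + (cP * N + 1) * (cQ * ((n * n)%:R * e * Y))))).
    by apply: ler_sum => t _; exact: HY.
  rewrite sumr_const -[leLHS]mulr_natl -/N mulrDr lerD2l le_eqVlt; apply/orP; left; apply/eqP.
  by rewrite /K; ring.
have He : K * (n * n)%:R * e <= 2^-1.
  rewrite /e ler_pdivrMr ?mulr_gt0 //.
  have -> : 2^-1 * (2 * (1 + (n * n)%:R) * (1 + K)) = (1 + (n * n)%:R) * (1 + K) by field.
  have : 0 <= (n * n)%:R :> R by [].
  have : 0 <= (n * n)%:R * K by rewrite mulr_ge0.
  by rewrite mulrDl !mulrDr => *; have := K0; lra.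
have : Y <= N * (cP * mnorm s) + 2^-1 * Y.
  by apply: (le_trans HS); rewrite lerD2l ler_wpM2r.
move=> h t; apply: (le_trans (yY t)).
have -> : 2 * cP * N * mnorm s = 2 * (N * (cP * mnorm s)) by ring.
lra.
Qed.

End BoundedComponents.

(** * Exponentials of nilpotent matrices *)

Section NilExp.
Variables (K : numFieldType) (n : nat).
Implicit Types (N : 'M[K]_n).

(** The ranks of the powers of N decrease strictly until they are
    stationary, and they reach 0. *)
Lemma nilp N k : N ^+ k = 0 -> N ^+ n = 0.
Proof.
move=> Nk.
have key j : N ^+ j = 0 \/ (\rank (N ^+ j) <= n - j)%N.
  elim: j => [|j [IH|IH]]; first by right; rewrite subn0 rank_leq_row.
    by left; rewrite exprS IH mulr0.
  have le : (N ^+ j.+1 <= N ^+ j)%MS by rewrite exprS -mulmxE submxMl.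
  have [h|h] := leqP (\rank (N ^+ j)) (\rank (N ^+ j.+1)); last by right; lia.
  have {}le : (N ^+ j <= N ^+ j.+1)%MS by rewrite -(geq_leqif (mxrank_leqif_sup le)).
  have stab m : (N ^+ j <= N ^+ (j + m))%MS.
    elim: m => [|m IHm]; first by rewrite addn0.
    apply: (submx_trans le); rewrite addnS !exprSr -!mulmxE; exact: submxMr.
  left; have := stab k; rewrite exprD Nk mulr0 submx0 => /eqP E.
  by rewrite exprS E mulr0.
have [//|] := key n; rewrite subnn leqn0 mxrank_eq0 => /eqP //.
Qed.

Lemma nilp_ge N j : N ^+ n = 0 -> (n <= j)%N -> N ^+ j = 0.
Proof. by move=> Nn nj; rewrite -(subnKC nj) exprD Nn mul0r. Qed.

Lemma nilexpZ (a : K) N : nilexp (a *: N) = \sum_(k < n) (a ^+ k / k`!%:R) *: N ^+ k.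
Proof.
apply: eq_bigr => k _; have -> : (a *: N) ^+ k = a ^+ k *: N ^+ k.
  elim: (k : nat) => [|j IH]; first by rewrite !expr0 scale1r.
  by rewrite !exprS IH -!mulmxE -scalemxAl -scalemxAr scalerA.
by rewrite scalerA mulrC.
Qed.

Lemma nilexpD N (a b : K) : N ^+ n = 0 ->
  nilexp (a *: N) *m nilexp (b *: N) = nilexp ((a + b) *: N).
Proof.
move=> Nn; rewrite !nilexpZ mulmx_suml.
pose u k : K := a ^+ k / k`!%:R; pose v k : K := b ^+ k / k`!%:R.
have E1 i : (i < n)%N -> (u i *: N ^+ i) *m (\sum_(k < n) (v k) *: N ^+ k) =
    \sum_(i <= k < n) (u i * v (k - i)%N) *: N ^+ k.
  move=> iN; rewrite mulmx_sumr -(big_mkord xpredT (fun k => (u i *: N ^+ i) *m (v k *: N ^+ k))).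
  rewrite (big_cat_nat _ (n := n - i)) ?leq_subr //= [X in _ + X]big_nat_cond [X in _ + X]big1 ?addr0; last first.
    move=> k /andP[/andP[h _] _]; rewrite -scalemxAl -scalemxAr mulmxE -exprD nilp_ge ?scaler0 //; lia.
  rewrite -[X in _ = \sum_(X <= _ < _) _](add0n i) big_addn; apply: eq_bigr => k _.
  by rewrite -scalemxAl -scalemxAr mulmxE -exprD scalerA addnK addnC.
transitivity (\sum_(0 <= i < n) \sum_(0 <= k < n | (i <= k)%N) (u i * v (k - i)%N) *: N ^+ k).
  rewrite big_mkord; apply: eq_bigr => i _; rewrite (E1 i (ltn_ord i)).
  by rewrite (big_nat_widenl _ 0%N).
rewrite (exchange_big_dep xpredT) //= big_mkord; apply: eq_bigr => k _.
rewrite -scaler_suml; congr (_ *: _).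
rewrite addrC exprDn mulr_suml -(big_mkord xpredT (fun i => b ^+ (k - i) * a ^+ i *+ 'C(k, i) / k`!%:R)).
rewrite [RHS](big_nat_widen _ _ n) ?ltn_ord //=; apply: eq_big => [i|i]; first by rewrite ltnS.
move=> h.
have h' : (i <= k)%N by [].
rewrite /u /v -(bin_fact h') -mulr_natr !natrM.
have f0 m : m`!%:R != 0 :> K by rewrite pnatr_eq0 -lt0n fact_gt0.
have C0 : 'C(k, i)%:R != 0 :> K by rewrite pnatr_eq0 -lt0n bin_gt0.
by field; rewrite !f0 C0.
Qed.

Lemma nilexp0 N : nilexp (0 *: N) = 1%:M.
Proof.
rewrite nilexpZ; case: n N => [|m] N; first by rewrite [LHS]flatmx0 [RHS]flatmx0.
rewrite big_ord_recl /= expr0 fact0 divr1 scale1r expr0 big1 ?addr0 // => i _.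
by rewrite expr0n /= mul0r scale0r.
Qed.

Lemma nilexpK N (a : K) : N ^+ n = 0 -> nilexp (a *: N) *m nilexp (- a *: N) = 1%:M.
Proof. by move=> Nn; rewrite nilexpD // subrr nilexp0. Qed.

Lemma nilexp_unit N (a : K) : N ^+ n = 0 -> nilexp (a *: N) \in unitmx.
Proof. by move=> Nn; case/mulmx1_unit: (nilexpK a Nn). Qed.

Lemma nilexp_comm N (a : K) : nilexp (a *: N) *m N = N *m nilexp (a *: N).
Proof.
rewrite nilexpZ mulmx_suml mulmx_sumr; apply: eq_bigr => k _.
by rewrite -scalemxAl -scalemxAr mulmxE -exprSr -exprS.
Qed.

Lemma nilexp_stable N (a : K) m (A : 'M[K]_(m, n)) : (A *m N <= A)%MS -> (A *m nilexp (a *: N) <= A)%MS.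
Proof.
move=> h; have hk k : (A *m N ^+ k <= A)%MS.
  elim: k => [|k IH]; first by rewrite expr0 mulmx1.
  by rewrite exprSr -mulmxE mulmxA (submx_trans (submxMr _ IH)).
by rewrite nilexpZ mulmx_sumr; apply: summx_sub => k _; rewrite -scalemxAr scalemx_sub.
Qed.

Lemma nilexp_sub1 N (a : K) m p (A : 'M[K]_(m, n)) (B : 'M[K]_(p, n)) :
  (A *m N <= B)%MS -> (B <= A)%MS -> (A *m (nilexp (a *: N) - 1%:M) <= B)%MS.
Proof.
move=> h BA; have [n0|n0] := posnP n.
  by clear h BA; move: (A *m _) B; rewrite n0 => X B; rewrite [X]thinmx0 sub0mx.
have hk k : (A *m N ^+ k.+1 <= B)%MS.
  elim: k => [|k IH]; first by rewrite expr1.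
  by rewrite exprSr -mulmxE mulmxA (submx_trans (submxMr _ (submx_trans IH BA))).
rewrite nilexpZ -(big_mkord xpredT (fun k => (a ^+ k / k`!%:R) *: N ^+ k)) big_ltn //.
rewrite expr0 fact0 divr1 scale1r expr0 addrAC subrr add0r mulmx_sumr big_nat_cond.
by apply: summx_sub => -[|k] // _; rewrite -scalemxAr scalemx_sub.
Qed.

(** N is e^N - 1 minus terms of higher order in N, treated by descending
    induction on the power of N. *)
Lemma unip_log N m p (A : 'M[K]_(m, n)) (B : 'M[K]_(p, n)) : N ^+ n = 0 ->
  (forall j, (A *m N ^+ j *m (nilexp N - 1%:M) <= B)%MS) -> (A *m N <= B)%MS.
Proof.
move=> Nn H; have [n0|n0] := posnP n.
  by clear H; move: (A *m N) B; rewrite n0 => X B; rewrite [X]thinmx0 sub0mx.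
suff key d j : (n <= d + j.+1)%N -> (A *m N ^+ j.+1 <= B)%MS.
  by have := key n 0%N; rewrite expr1; apply; lia.
elim: d j => [|d IH] j hj; first by rewrite nilp_ge ?mulmx0 ?sub0mx.
have := H j; have -> : nilexp N = nilexp (1 *: N) by rewrite scale1r.
rewrite nilexpZ -(big_mkord xpredT (fun k => (1 ^+ k / k`!%:R) *: N ^+ k)).
have [n1|n1] := leqP n 1.
  have -> : N ^+ j.+1 = 0 by apply: nilp_ge => //; lia.
  by rewrite mulmx0 sub0mx.
rewrite big_ltn // big_ltn // expr0 fact0 divr1 scale1r expr0 addrAC subrr add0r.
rewrite scale1r expr1 mulmxDr => h.
have -> : A *m N ^+ j.+1 = (A *m N ^+ j *m N + A *m N ^+ j *m (\sum_(2 <= k < n) (1 ^+ k / k`!%:R) *: N ^+ k)) - A *m N ^+ j *m (\sum_(2 <= k < n) (1 ^+ k / k`!%:R) *: N ^+ k).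
  by rewrite addrK exprSr -mulmxE mulmxA.
apply: addmx_sub => //; rewrite eqmx_opp mulmx_sumr big_nat_cond; apply: summx_sub => k /andP[/andP[k2 _] _].
rewrite -scalemxAr scalemx_sub // -mulmxA mulmxE -exprD.
have -> : (j + k = (j + k).-1.+1)%N by lia.
apply: IH; lia.
Qed.

End NilExp.

Section NilExpC.
Variables (R : realType) (n : nat).
Local Notation C := R[i].

Lemma map_mx_exp (K L : fieldType) (f : {rmorphism K -> L}) (A : 'M[K]_n) k : map_mx f (A ^+ k) = map_mx f A ^+ k.
Proof.
elim: k => [|k IH]; first by rewrite !expr0 map_mx1.
by rewrite !exprS -!mulmxE map_mxM IH.
Qed.

Lemma map_nilexp (K L : fieldType) (f : {rmorphism K -> L}) (A : 'M[K]_n) : map_mx f (nilexp A) = nilexp (map_mx f A).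
Proof.
rewrite /nilexp map_mx_sum; apply: eq_bigr => k _.
by rewrite map_mxZ fmorphV rmorph_nat map_mx_exp.
Qed.

Lemma cplx_nilexp (N : 'M[R]_n) : cplx (nilexp N) = nilexp (cplx N).
Proof. exact: map_nilexp. Qed.

Lemma conj_nilexp (N : 'M[R]_n) (a : C) : conjM (nilexp (a *: cplx N)) = nilexp (a^* *: cplx N).
Proof. by rewrite [LHS]map_nilexp map_mxZ -[map_mx _ (cplx N)]/(conjM _) conj_cplx. Qed.

Lemma cplx_exp (N : 'M[R]_n) k : cplx (N ^+ k) = cplx N ^+ k.
Proof. exact: map_mx_exp. Qed.

Lemma polybX (f : C -> C) k : polyb f -> polyb (fun z => f z ^+ k).
Proof.
move=> hf; elim: k => [|k IH].
  by apply: eq_polyb (polyb_cst 1); apply: ev_all => z; rewrite expr0.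
by apply: eq_polyb (polybM hf IH); apply: ev_all => z; rewrite exprS.
Qed.

Lemma mpolyb_nilexp (f : C -> C) (N : 'M[C]_n) : polyb f -> mpolyb (fun z => nilexp (f z *: N)).
Proof.
move=> hf i j.
have := polyb_sum (index_enum 'I_n) (fun k : 'I_n =>
  polybM (polybM (polybX k hf) (polyb_cst (k`!%:R)^-1)) (polyb_cst ((N ^+ k) i j))).
apply: eq_polyb; apply: ev_all => z; rewrite nilexpZ summxE; apply: eq_bigr => k _.
by rewrite mxE.
Qed.

End NilExpC.

(** * Derivatives of matrix-valued functions *)

Section MatrixDeriv.
Variable (R : realType).
Local Notation C := R[i].

Definition mdiff m n (A : C -> 'M[C]_(m, n)) (z : C) (D : 'M[C]_(m, n)) : Prop :=
  forall i j, cderiv (fun t => A t i j) z (D i j).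

Lemma cderiv_near (f g : C -> C) z d : (\forall t \near (z : C^o), f t = g t) -> cderiv f z d -> cderiv g z d.
Proof.
move=> /nearC[r r0 E] H e e0; have [r' r'0 {}H] := H e e0.
exists (Order.min r r'); first by rewrite lt_min r0.
move=> t; rewrite lt_min => /andP[/E <- /H]; rewrite -(E z) //.
by rewrite subrr cabs0.
Qed.

Lemma eq_cderiv (f g : C -> C) z d d' : f =1 g -> d = d' -> cderiv f z d -> cderiv g z d'.
Proof. by move=> fg <-; have -> : f = g by apply/funext. Qed.

Lemma mdiff_near m n (A B : C -> 'M[C]_(m, n)) z D : (\forall t \near (z : C^o), A t = B t) -> mdiff A z D -> mdiff B z D.
Proof.
move=> E H i j; apply: cderiv_near (H i j); move/nearC: E => [r r0 E]; apply/nearC.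
by exists r => // t /E ->.
Qed.

Lemma mdiff_cst m n (A : 'M[C]_(m, n)) z : mdiff (fun=> A) z 0.
Proof. by move=> i j; rewrite mxE; exact: cderiv_cst. Qed.

Lemma cderiv_sum I (r : seq I) (F : I -> C -> C) (d : I -> C) z :
  (forall i, cderiv (F i) z (d i)) -> cderiv (fun t => \sum_(i <- r) F i t) z (\sum_(i <- r) d i).
Proof.
move=> H; elim: r => [|i r IH].
  by apply: eq_cderiv (cderiv_cst 0 z) => [t|]; rewrite big_nil.
by apply: eq_cderiv (cderivD (H i) IH) => [t|]; rewrite big_cons.
Qed.

Lemma cderiv_prod I (r : seq I) (F : I -> C -> C) z :
  (forall i, exists d, cderiv (F i) z d) -> exists d, cderiv (fun t => \prod_(i <- r) F i t) z d.
Proof.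
move=> H; elim: r => [|i r [d IH]].
  by exists 0; apply: eq_cderiv (cderiv_cst 1 z) => [t|//]; rewrite big_nil.
have [d' H'] := H i.
by eexists; apply: eq_cderiv (cderivM H' IH) => [t|//]; rewrite big_cons.
Qed.

Lemma mdiffM m n p (A : C -> 'M[C]_(m, n)) (B : C -> 'M[C]_(n, p)) z DA DB :
  mdiff A z DA -> mdiff B z DB -> mdiff (fun t => A t *m B t) z (DA *m B z + A z *m DB).
Proof.
move=> hA hB i j.
have := @cderiv_sum _ (index_enum 'I_n) _ _ z (fun k => cderivM (hA i k) (hB k j)).
by apply: eq_cderiv => [t|]; rewrite !mxE ?big_split.
Qed.

Lemma mdiff_Mr m n p (A : C -> 'M[C]_(m, n)) (B : 'M[C]_(n, p)) z DA :
  mdiff A z DA -> mdiff (fun t => A t *m B) z (DA *m B).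
Proof. by move=> h; have := mdiffM h (mdiff_cst B z); rewrite mulmx0 addr0. Qed.

Lemma mdiff_comp m n (A : C -> 'M[C]_(m, n)) (g : C -> C) z D d :
  cderiv g z d -> mdiff A (g z) D -> mdiff (fun t => A (g t)) z (d *: D).
Proof.
move=> hg hA i j; apply: eq_cderiv (cderiv_comp hg (hA i j)) => [//|].
by rewrite mxE mulrC.
Qed.

Lemma cderiv_det n (A : C -> 'M[C]_n) z : (forall i j, exists d, cderiv (fun t => A t i j) z d) ->
  exists d, cderiv (fun t => \det (A t)) z d.
Proof.
move=> hA.
have H (s : 'S_n) : exists d, cderiv (fun t => (-1) ^+ s * \prod_i A t i (s i)) z d.
  have [d hd] := @cderiv_prod _ (index_enum 'I_n) (fun i t => A t i (s i)) z (fun i => hA i (s i)).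
  by eexists; exact: cderivM (cderiv_cst _ z) hd.
exists (\sum_(s : 'S_n) projT1 (cid (H s))).
by apply: cderiv_sum => s; case: (cid (H s)).
Qed.

Lemma cderiv_neq0 (f : C -> C) z d : cderiv f z d -> f z != 0 -> \forall t \near (z : C^o), f t != 0.
Proof.
move=> Hd dz; have n2 : 0 < cabs (f z) / 2 by rewrite divr_gt0 // cabs_gt0.
have [r r0 Hr] := cderiv_continuous Hd n2.
apply/nearC; exists r => [//|t /Hr h]; rewrite -cabs_gt0.
have := cabsB (f t) (f t - f z); rewrite subKr.
have : 0 < cabs (f z) by rewrite cabs_gt0.
lra.
Qed.

Lemma mdiff_inv n (A : C -> 'M[C]_n) z D : A z \in unitmx -> mdiff A z D ->
  exists D', mdiff (fun t => invmx (A t)) z D'.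
Proof.
move=> Au hA.
have hA' i j : exists d, cderiv (fun t => A t i j) z d by exists (D i j).
have [dd Hd] := cderiv_det hA'.
have dz : \det (A z) != 0 by rewrite -unitfE -unitmxE.
have [di Hi] := cderivV dz Hd.
have near_u : \forall t \near (z : C^o), A t \in unitmx.
  have /nearC[r r0 Hr] := cderiv_neq0 Hd dz.
  by apply/nearC; exists r => [//|t /Hr h]; rewrite unitmxE unitfE.
have key i j : exists d, cderiv (fun t => invmx (A t) i j) z d.
  have [dc Hc] : exists d, cderiv (fun t => \det (row' j (col' i (A t)))) z d.
    apply: cderiv_det => k l; exists (D (lift j k) (lift i l)).
    by apply: eq_cderiv (hA (lift j k) (lift i l)) => // t; rewrite !mxE.
  eexists; apply: cderiv_near (cderivM Hi (cderivM (cderiv_cst ((-1) ^+ (j + i)) z) Hc)).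
  move/nearC: near_u => [r r0 Hr]; apply/nearC; exists r => // t /Hr h.
  by rewrite /invmx h !mxE.
exists (\matrix_(i, j) projT1 (cid (key i j))) => i j.
by rewrite mxE; case: (cid (key i j)).
Qed.

Lemma cderivX (k : nat) (z : C) : cderiv (fun t => t ^+ k.+1) z (k.+1%:R * z ^+ k).
Proof.
elim: k => [|k IH]; first by apply: eq_cderiv (cderiv_id z) => [t|]; rewrite ?expr1 ?expr0 ?mulr1.
apply: eq_cderiv (cderivM (cderiv_id z) IH) => [t|]; first by rewrite /= -exprS.
have -> : k.+2%:R = k.+1%:R + 1 :> C by rewrite natr1.
by move: (k.+1%:R : C) => c /=; rewrite !exprS; ring.
Qed.

(** Shifts the exponential series of [mdiff_nilexp], whose term of order n
    vanishes. *)
Lemma shift_sum (F : nat -> C) n : F 0%N = 0 -> F n = 0 ->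
  \sum_(0 <= k < n) F k = \sum_(0 <= k < n) F k.+1.
Proof.
move=> F0 Fn; transitivity (\sum_(0 <= k < n.+1) F k).
  by rewrite big_nat_recr //= Fn addr0.
by rewrite big_nat_recl //= F0 add0r.
Qed.

Lemma mdiff_nilexp n (N : 'M[C]_n) z : N ^+ n = 0 ->
  mdiff (fun t => nilexp (- t *: N)) z (- (nilexp (- z *: N) *m N)).
Proof.
move=> Nn i j.
have hk (k : nat) : cderiv (fun t : C => (- t) ^+ k / k`!%:R) z
    (if k is k'.+1 then - ((- z) ^+ k' / k'`!%:R) else 0).
  case: k => [|k].
    by apply: eq_cderiv (cderiv_cst 1 z) => [t|//]; rewrite expr0 fact0 divr1.
  have h1 := cderiv_comp (cderivN (cderiv_id z)) (cderivX k (- z)).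
  apply: eq_cderiv (cderivM h1 (cderiv_cst (k.+1)`!%:R^-1 z)) => [t //|].
  rewrite mulr0 addr0 factS natrM.
  have f0 m : m`!%:R != 0 :> C by rewrite pnatr_eq0 -lt0n fact_gt0.
  have k0 : k.+1%:R != 0 :> C by rewrite pnatr_eq0.
  move: (f0 k) k0; move: (k`!%:R : C) (k.+1%:R : C) => a b a0 b0.
  by field; rewrite a0 b0.
have := @cderiv_sum _ (index_enum 'I_n) _ _ z (fun k : 'I_n => cderivM (hk k) (cderiv_cst ((N ^+ k) i j) z)).
apply: eq_cderiv => [t|].
  by rewrite nilexpZ summxE; apply: eq_bigr => k _; rewrite mxE.
rewrite nilexpZ mulmx_suml -sumrN summxE.
under [LHS]eq_bigr do rewrite mulr0 addr0.
have -> : \sum_(k < n) (- (((- z) ^+ k / k`!%:R) *: N ^+ k *m N)) i j =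
   \sum_(0 <= k < n) (- ((- z) ^+ k / k`!%:R)) * (N ^+ k.+1) i j.
  by rewrite big_mkord; apply: eq_bigr => k _; rewrite exprSr -mulmxE -scalemxAl !mxE mulNr.
rewrite -(big_mkord xpredT (fun k => (if k is k'.+1 then - ((- z) ^+ k' / k'`!%:R) else 0) * (N ^+ k) i j)).
apply: (shift_sum (F := fun k => (if k is k'.+1 then - ((- z) ^+ k' / k'`!%:R) else 0) * (N ^+ k) i j)); first by rewrite mul0r.
by rewrite Nn mxE mulr0.
Qed.

End MatrixDeriv.

(** * The upper half plane *)

Section UpperHalfPlane.
Variable R : realType.
Local Notation C := R[i].
Local Notation Im := complex.Im.

(** The set of times up to which P holds along the segment from z0 to z,
    which stays in the half plane, is open and closed. *)
Lemma half_plane_connected (P : C -> Prop) (z0 : C) : upper_half_plane z0 -> P z0 ->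
  (forall z, upper_half_plane z -> \forall w \near (z : C^o), P z <-> P w) ->
  forall z, upper_half_plane z -> P z.
Proof.
move=> h0 P0 Hloc z1 h1.
pose g (t : R) : C := (1 - t)%:C%C * z0 + t%:C%C * z1.
have gh t : 0 <= t <= 1 -> upper_half_plane (g t).
  have E (u v : C) (p q : R) : complex.Im (p%:C%C * u + q%:C%C * v) = p * complex.Im u + q * complex.Im v.
    by case: u v => ? ? [? ?] /=; ring.
  move=> /andP[t0 t1]; rewrite /upper_half_plane /g /= E.
  have [->|tn] := eqVneq t 0; first by rewrite subr0 mul1r mul0r addr0.
  rewrite ltr_wpDl ?mulr_ge0 ?subr_ge0 ?(ltW h0) // mulr_gt0 // lt_neqAle eq_sym tn //.
have gd s t : cabs (g s - g t) = `|s - t| * cabs (z1 - z0).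
  rewrite -cabs_real -cabsM; congr cabs; rewrite /g !rmorphB /=; ring.
pose A := [set t : R | 0 <= t <= 1 /\ forall s, 0 <= s <= t -> P (g s)].
have A0 : A 0.
  split; first by rewrite lexx ler01.
  move=> s /le_anti E; have -> : s = 0 by rewrite E.
  by rewrite /g subr0 mul1r mul0r addr0.
have Aub : has_ubound A by exists 1 => t [/andP[]].
pose m := sup A.
have m0 : 0 <= m by apply: ub_le_sup.
have m1 : m <= 1 by apply: ge_sup; [exists 0 | move=> t [/andP[]]].
have [r r0 Hr] : exists2 r : R, 0 < r & forall t, 0 <= t <= 1 -> `|t - m| < r -> (P (g m) <-> P (g t)).
  have /nearC[d d0 Hd] := Hloc _ (gh m (introT andP (conj m0 m1))).
  exists (d / (1 + cabs (z1 - z0))) => [|t _]; first by rewrite divr_gt0 // ltr_pwDl ?cabs_ge0.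
  rewrite ltr_pdivlMr ?ltr_pwDl ?cabs_ge0 // => h; apply: Hd; rewrite gd.
  by apply: le_lt_trans h; rewrite ler_wpM2l // lerDr.
have [t At tm] : exists2 t, A t & m - r < t.
  by apply: sup_adherent => //; split; [exists 0|].
have tle : t <= m by apply: ub_le_sup.
case: At => /andP[t0 t1] At.
have Pm : P (g m).
  apply/(Hr t); rewrite ?t0 //; last by apply: At; rewrite t0 lexx.
  by rewrite ltr_norml; apply/andP; split; lra.
pose m' := Order.min 1 (m + r / 2).
have Am' : A m'.
  split; first by rewrite ge_min lexx le_min ler01 /=; lra.
  move=> s /andP[s0]; rewrite le_min => /andP[s1 sm].
  have [st|st] := lerP s t; first by apply: At; rewrite s0.
  apply/(Hr s); rewrite ?s0 //.
  by rewrite ltr_norml; apply/andP; split; lra.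
have mm : m' <= m by apply: ub_le_sup.
have E : m' = 1.
  by move: mm; rewrite /m'; case: (lerP 1 (m + r / 2)) => // h; lra.
case: Am' => _ /(_ 1); rewrite E ler01 lexx => /(_ isT).
by rewrite /g subrr mul0r add0r mul1r.
Qed.

Definition zbase : C := 'i%C.
Lemma zbaseP : upper_half_plane zbase.
Proof. by rewrite /upper_half_plane /= ltr01. Qed.

Lemma covering_disk (z : C) : upper_half_plane z -> punctured_disk (covering z).
Proof.
rewrite /upper_half_plane /punctured_disk /= => z0.
have E : (1 : C) = (1 : R)%:C%C by [].
rewrite cabsE cabs_covering ltcR expR_gt0 /= E ltcR expR_lt1 oppr_lt0.
by rewrite !mulr_gt0 // pi_gt0.
Qed.

Lemma near_covering (z : C) (P : C -> Prop) :
  (\forall s \near (covering z : C^o), P s) -> \forall w \near (z : C^o), P (covering w).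
Proof.
move=> /nearC[r r0 h].
have r2 : 0 < r / 2 by rewrite divr_gt0.
have [d d0 hd] := cderiv_continuous (cderiv_covering z) r2.
apply/nearC; exists d => // t /hd ht; apply: h; apply: le_lt_trans ht _.
by rewrite ltr_pdivrMr // ltr_pMr // ltr1n.
Qed.

Lemma upper_half_plane1 (z : C) : upper_half_plane z -> upper_half_plane (z + 1).
Proof. by rewrite /upper_half_plane /=; case: z => x y /=; rewrite addr0. Qed.

Lemma ev_uhp : ev (fun z : C => upper_half_plane z).
Proof. by exists 0. Qed.

Lemma ev_near0 (P : C -> Prop) : (\forall s \near (0 : C^o)^', P s) -> ev (fun z => P (covering z)).
Proof.
move=> /near0C[d d0 h]; have [k hk] := expR_total d0.
exists (- k / (2 * pi)) => z hz; apply: h; rewrite cabs_covering expR_gt0 /= -hk ltr_expR.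
have p0 : 0 < 2 * pi :> R by rewrite mulr_gt0 // pi_gt0.
by move: hz; rewrite ltr_pdivrMr // mulrC ltrNl.
Qed.

(** Polar coordinates, with the logarithm of the modulus for the imaginary
    part. *)
Lemma covering_surj (s : C) : s != 0 -> exists z : C, covering z = s.
Proof.
rewrite -cabs_gt0 => r0; have [l Hl] := expR_total r0.
case: s r0 Hl => a b; set r := cabs _ => r0 Hl.
have E : r ^+ 2 = a ^+ 2 + b ^+ 2.
  by rewrite /r /cabs normc_def /= sqr_sqrtr // addr_ge0 // sqr_ge0.
have E1 : (a / r) ^+ 2 + (b / r) ^+ 2 = 1.
  by rewrite !expr_div_n -mulrDl -E divff // expf_neq0 // gt_eqF.
have ar : -1 <= a / r <= 1.
  by rewrite -ler_norml -(@ler_pXn2r _ 2) ?nnegrE // expr1n real_normK ?num_real // -E1 lerDl sqr_ge0.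
have [t [ct st]] : exists t, cos t = a / r /\ sin t = b / r.
  have cK : cos (acos (a / r)) = a / r by apply: acosK; rewrite in_itv.
  have sK : sin (acos (a / r)) = `|b / r|.
    by rewrite sin_acos // -E1 addrAC subrr add0r sqrtr_sqr.
  have [b0|b0] := lerP 0 (b / r).
    by exists (acos (a / r)); rewrite cK sK ger0_norm.
  by exists (- acos (a / r)); rewrite cosN sinN cK sK ltr0_norm // opprK.
have p0 : 2 * pi != 0 :> R by rewrite mulf_neq0 ?gt_eqF ?pi_gt0.
exists ((t / (2 * pi)) +i* (- l / (2 * pi)))%C; rewrite coveringE.
rewrite !(mulrC (2 * pi)) !divfK // opprK Hl ct st.
by rewrite !(mulrC r) !divfK // gt_eqF.
Qed.

Lemma near0_of_ev (P : C -> Prop) : ev (fun z => P (covering z)) -> \forall s \near (0 : C^o)^', P s.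
Proof.
move=> [Y HY]; apply/near0C; exists (expR (- (2 * pi * Y))); first exact: expR_gt0.
move=> s /andP[s0 sY]; have [z zs] : exists z : C, covering z = s by apply: covering_surj; rewrite -cabs_gt0.
rewrite -zs; apply: HY; move: sY; rewrite -zs cabs_covering ltr_expR ltrN2 ltr_pM2l //.
by rewrite mulr_gt0 // pi_gt0.
Qed.

End UpperHalfPlane.

(** * Relative weight filtration of an action trivial on Gr^W *)

(** If N acts trivially on Gr^W, its monodromy weight filtration on Gr^W_k
    is concentrated in weight k. The relative weight filtration is then W
    itself, and N W_k <= W_(k-2). *)
Section RelativeWeight.
Variables (R : realType) (n : nat) (N : 'M[R]_n) (W M : int -> 'M[R]_n).
Hypothesis Wf : increasing_filtration W.
Hypothesis HM : relative_weight_filtration N W M.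
Hypothesis WN1 : forall k, (W k *m N <= W (k - 1))%MS.

Let Winc k l : k <= l -> (W k <= W l)%MS. Proof. by case: Wf => h _ _; exact: h. Qed.
Let Minc k l : k <= l -> (M k <= M l)%MS. Proof. by case: HM => -[h _ _] _ _ _ _; exact: h. Qed.

Let WNj (k : int) (j : nat) : (W k *m N ^+ j.+1 <= W (k - 1))%MS.
Proof.
elim: j => [|j IH]; first by rewrite expr1.
rewrite exprSr -mulmxE mulmxA (submx_trans (submxMr _ IH)) // (submx_trans (WN1 _)) //.
by apply: Winc; lia.
Qed.

Let gW (k j : int) : (grM W M k j <= W k)%MS.
Proof. by rewrite addsmx_sub capmxSr Winc //; lia. Qed.

(** N^j is zero on Gr^W_k, so its surjectivity onto Gr^M_(k-j) Gr^W_k makes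
    the latter vanish for all j > 0. *)
Lemma M_cap_W (k : int) : (M (k - 1) :&: W k <= W (k - 1))%MS.
Proof.
have [[_ [l0 M0] _] _ _ H4 _] := HM.
have step (d j : nat) : (grM W M k (k - j.+1%:Z)%R <= grM W M k (k - (j.+1 + d)%N%:Z)%R)%MS.
  elim: d j => [|d IH] j; first by rewrite addn0.
  apply: (@submx_trans _ _ _ _ _ _ (grM W M k (k - j.+2%:Z)%R)); last by rewrite -addSnnS IH.
  rewrite -(H4 k j.+1) addsmx_sub; apply/andP; split.
    rewrite (submx_trans (submxMr _ (gW _ _))) // (submx_trans (WNj _ _)) //; exact: addsmxSr.
  by have -> : k - j.+1%:Z - 1 = k - j.+2%:Z by lia.
have := step (absz (k - l0)%R) 0%N; set l := (k - (_ + _)%N%:Z)%R => h.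
have Ml : (M l <= (0 : 'M[R]_n))%MS by rewrite -M0; apply: Minc; rewrite /l; lia.
apply: (@submx_trans _ _ _ _ _ _ (grM W M k (k - 1))); first exact: addsmxSl.
apply: (submx_trans h); rewrite /grM addsmx_sub submx_refl andbT (submx_trans (capmxSl _ _)) //.
by rewrite (submx_trans Ml) // sub0mx.
Qed.

(** Dually, injectivity of N^j makes Gr^M_(k+j) Gr^W_k vanish for all j > 0. *)
Lemma W_sub_MW (k : int) : (W k <= M k + W (k - 1))%MS.
Proof.
have [[_ _ [l1 M1]] _ _ _ H5] := HM.
have step (d : nat) : (W k <= grM W M k (k + d%:Z)%R)%MS -> (W k <= grM W M k k)%MS.
  elim: d => [|d IH]; first by rewrite addr0.
  move=> h; apply: IH; apply/rV_subP => x xW.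
  have -> : k + d%:Z = k + d.+1%:Z - 1 by lia.
  apply: H5; first exact: submx_trans xW h.
  rewrite (submx_trans (submxMr _ xW)) // (submx_trans (WNj _ _)) //; exact: addsmxSr.
have := step (absz (l1 - k)%R); set l := (k + _)%R => h.
have Ml : (1%:M <= M l)%MS by rewrite -M1; apply: Minc; rewrite /l; lia.
have {}h := h _; apply: submx_trans (h _) _.
  rewrite /grM (submx_trans _ (addsmxSl _ _)) // sub_capmx submx_refl andbT.
  by rewrite (submx_trans (submx1 _)).
by rewrite /grM addsmxS // capmxSl.
Qed.

Lemma M_sub_W (k : int) : (M k <= W k)%MS.
Proof.
have [_ _ [l1 W1]] := Wf.
have step (d : nat) : (M k :&: W (k + d%:Z)%R <= W k)%MS.
  elim: d => [|d IH]; first by rewrite addr0 capmxSr.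
  apply: submx_trans IH; rewrite sub_capmx capmxSl /=.
  have -> : k + d%:Z = k + d.+1%:Z - 1 by lia.
  apply: submx_trans (M_cap_W _); rewrite sub_capmx capmxSr andbT (submx_trans (capmxSl _ _)) //.
  by apply: Minc; lia.
apply: submx_trans (step (absz (l1 - k)%R)); rewrite sub_capmx submx_refl /=.
apply: (submx_trans (submx1 _)); rewrite -W1; apply: Winc; lia.
Qed.

Lemma W_sub_M (k : int) : (W k <= M k)%MS.
Proof.
have [_ [k0 W0] _] := Wf.
have base l : l <= k0 -> (W l <= M l)%MS.
  by move=> h; rewrite (submx_trans (Winc h)) // W0 sub0mx.
have [h|h] := lerP k k0; first exact: base.
have [d ->] : exists d : nat, k = k0 + d%:Z by exists (absz (k - k0)%R); lia.
elim: d => [|d IH]; first by apply: base; lia.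
apply: (submx_trans (W_sub_MW _)); rewrite addsmx_sub submx_refl /=.
have -> : k0 + d.+1%:Z - 1 = k0 + d%:Z by lia.
by apply: (submx_trans IH); apply: Minc; lia.
Qed.

Lemma W_N2 (k : int) : (W k *m N <= W (k - 2))%MS.
Proof.
apply: submx_trans (M_sub_W _); apply: (submx_trans (submxMr _ (W_sub_M k))).
by case: HM.
Qed.

End RelativeWeight.

(** * Changes of coordinates and twists *)

Lemma invmx_mul (K : fieldType) n (A B : 'M[K]_n) : A \in unitmx -> B \in unitmx ->
  invmx (A *m B) = invmx B *m invmx A.
Proof.
move=> uA uB; have uAB : A *m B \in unitmx by rewrite unitmx_mul uA.
by rewrite -[RHS]mulmx1 -(mulmxV uAB) !mulmxA mulmxKV // mulVmx // mul1mx.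
Qed.

Section Transport.
Variables (R : realType) (n : nat).
Local Notation C := R[i].

Lemma cap_unitM (A B : 'M[C]_n) (U : 'M[C]_n) : U \in unitmx ->
  ((A :&: B) *m U :=: A *m U :&: B *m U)%MS.
Proof.
move=> uU; apply/eqmxP/andP; split; first exact: capmxMr.
rewrite -(@submxMfree _ _ _ _ _ _ _ (invmx U)); last by rewrite row_free_unit unitmx_inv.
by rewrite mulmxK // (submx_trans (capmxMr _ _ _)) // !mulmxK.
Qed.

Lemma rank_unitM m (A : 'M[C]_(m, n)) (U : 'M[C]_n) : U \in unitmx -> \rank (A *m U) = \rank A.
Proof. by move=> uU; rewrite mxrankMfree // row_free_unit. Qed.

Lemma conjM_mul m p (A : 'M[C]_(m, n)) (B : 'M[C]_(n, p)) : conjM (A *m B) = conjM A *m conjM B.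
Proof. exact: map_mxM. Qed.

Lemma conjM_eqmx m1 m2 (A : 'M[C]_(m1, n)) (B : 'M[C]_(m2, n)) : (A :=: B)%MS -> (conjM A :=: conjM B)%MS.
Proof. by move=> h; apply/eqmxP; rewrite !conjM_sub !h submx_refl. Qed.

Lemma unit_eqmx_full (U : 'M[C]_n) : U \in unitmx -> (U :=: (1%:M : 'M[C]_n))%MS.
Proof. by move=> u; apply/eqmxP; rewrite submx1 sub1mx row_full_unit. Qed.

Lemma cplxVK (A : 'M[R]_n) : A \in unitmx -> cplx (invmx A) *m cplx A = 1%:M.
Proof. by move=> uA; rewrite -map_mxM mulVmx // map_mx1. Qed.

Lemma F_cap_unit (F : 'M[C]_n) (V : 'M[R]_n) (A : 'M[R]_n) : A \in unitmx ->
  ((F :&: cplx V) *m cplx A :=: F *m cplx A :&: cplx (V *m A))%MS.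
Proof.
by move=> uA; rewrite [cplx (V *m A)]map_mxM; apply: cap_unitM; rewrite map_unitmx.
Qed.

Variables (W : int -> 'M[R]_n) (F : int -> 'M[C]_n) (A : 'M[R]_n).
Hypothesis uA : A \in unitmx.
Let W' k := W k *m A.
Let F' p := F p *m cplx A.
Let uC : cplx A \in unitmx. Proof. by rewrite map_unitmx. Qed.
Let cW' k : cplx (W' k) = cplx (W k) *m cplx A. Proof. exact: map_mxM. Qed.

Lemma grF_transport k p : (grF W' F' k p :=: grF W F k p *m cplx A)%MS.
Proof.
rewrite /grF !cW'; apply: eqmx_trans (eqmx_sym (addsmxMr _ _ _)).
by apply: adds_eqmx => //; apply: eqmx_sym; exact: cap_unitM.
Qed.

Lemma conj_grF_transport k p : (conjM (grF W' F' k p) :=: conjM (grF W F k p) *m cplx A)%MS.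
Proof.
by apply: eqmx_trans (conjM_eqmx (grF_transport k p)) _; rewrite conjM_mul conj_cplx.
Qed.

Lemma pure_transport : pure_on_Gr W F -> pure_on_Gr W' F'.
Proof.
move=> h k p; have [h1 h2] := h k p; split; rewrite cW'.
  apply: eqmx_trans (adds_eqmx (grF_transport _ _) (conj_grF_transport _ _)) _.
  by apply: eqmx_trans (eqmx_sym (addsmxMr _ _ _)) _; exact: eqmxMr.
apply: eqmx_trans (cap_eqmx (grF_transport _ _) (conj_grF_transport _ _)) _.
by apply: eqmx_trans (eqmx_sym (cap_unitM _ _ uC)) _; exact: eqmxMr.
Qed.

Lemma dec_transport (U : 'M[C]_n) (G : int -> 'M[C]_n) : U \in unitmx -> (forall p, (G p :=: F p *m U)%MS) ->
  decreasing_filtration F -> decreasing_filtration G.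
Proof.
move=> uU HG [h1 [p0 h2] [p1 h3]]; split.
- by move=> p q pq; rewrite !HG submxMr // h1.
- exists p0; apply: eqmx_trans (HG p0) _; apply: eqmx_trans (eqmxMr _ h2) _; by rewrite mul0mx.
- exists p1; apply: eqmx_trans (HG p1) _; apply: eqmx_trans (eqmxMr _ h3) _; rewrite mul1mx.
  exact: unit_eqmx_full.
Qed.

End Transport.

Section Twist.
Variables (R : realType) (n : nat).
Local Notation C := R[i].

(** A twist of polynomial growth that preserves the limit U does not spoil a
    rapidly decreasing error. *)
Lemma lower_twist (A : C -> 'M[C]_n) (U N : 'M[C]_n) (f : C -> C) : N ^+ n = 0 -> polyb f ->
  (U *m N <= U)%MS -> lower A U -> lower (fun z => A z *m nilexp (f z *: N)) U.
Proof.
move=> Nn pf UN [D HD HA].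
pose Y z := U *m nilexp (- f z *: N) *m pinvmx U.
have YU z : Y z *m U = U *m nilexp (- f z *: N) by rewrite mulmxKpV // nilexp_stable.
have pY : mpolyb Y.
  apply: mpolybM (mpolyb_cst _); apply: mpolybM (mpolyb_cst _) _.
  apply: mpolyb_nilexp; apply: eq_polyb (polybM (polyb_cst (-1)) pf).
  by apply: ev_all => z; rewrite mulN1r.
exists (fun z => Y z *m D z *m nilexp (f z *: N)).
  by apply: mrapidMr; [exact: mrapidMl | exact: mpolyb_nilexp].
move: HA; apply: ev_mono => z h.
have -> : (U + Y z *m D z *m nilexp (f z *: N) = Y z *m (U + D z) *m nilexp (f z *: N))%R.
  by rewrite mulmxDr mulmxDl YU -[U *m _ *m _]mulmxA nilexpD // addNr nilexp0 mulmx1.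
by apply: submxMr; exact: submx_trans (submxMl _ _) h.
Qed.

Lemma lower_conj (A : C -> 'M[C]_n) (B : 'M[C]_n) : lower A B -> lower (fun z => conjM (A z)) (conjM B).
Proof.
move=> [D HD HA]; exists (fun z => conjM (D z)).
  move=> i j m; have [c h] := HD i j m; exists c; move: h; apply: ev_mono => z.
  by rewrite mxE cabs_conj.
move: HA; apply: ev_mono => z h.
by have -> : (conjM B + conjM (D z) = conjM (B + D z))%R; [rewrite [RHS]map_mxD | rewrite conjM_sub].
Qed.

Lemma conj_cap (A : 'M[C]_n) (V : 'M[R]_n) : (conjM (A :&: cplx V) :=: conjM A :&: cplx V)%MS.
Proof.
apply: eqmx_trans (map_capmx _ _ _) _; apply: cap_eqmx => //.
by rewrite -[map_mx _ (cplx _)]/(conjM _) conj_cplx.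
Qed.

Lemma rank_conj_cap (A : 'M[C]_n) (V : 'M[R]_n) : \rank (conjM A :&: cplx V) = \rank (A :&: cplx V).
Proof. by rewrite -(conj_cap A V) mxrank_map. Qed.

Lemma polyb_conjB : polyb (fun z : C => z^* - z).
Proof.
exists 1%N, 2; have := ev_gt (0 : R); apply: ev_mono => z z0; rewrite expr1.
have -> : z^* - z = (2%:C * (complex.Im z)%:C * - 'i)%C.
  by case: z z0 => x y _; rewrite /=; apply/eqP; rewrite eq_complex /= ; apply/andP; split; apply/eqP; ring.
by rewrite !cabsM !cabs_real cabsN cabsi mulr1 !ger0_norm // ltW.
Qed.

End Twist.

(** * Bilinear and sesquilinear forms *)

Section Forms.
Variables (R : realType) (n : nat).
Local Notation C := R[i].
Implicit Types (B : 'M[C]_n) (Q : 'M[R]_n).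

Lemma bilDl (K : fieldType) (B : 'M[K]_n) x x' y : bil B (x + x') y = bil B x y + bil B x' y.
Proof. by rewrite /bil !mulmxDl mxE. Qed.

Lemma bilDr (K : fieldType) (B : 'M[K]_n) x y y' : bil B x (y + y') = bil B x y + bil B x y'.
Proof. by rewrite /bil linearD mulmxDr mxE. Qed.

Lemma bil_trans (K : fieldType) (B A : 'M[K]_n) x y : bil (A *m B *m A^T) x y = bil B (x *m A) (y *m A).
Proof. by rewrite /bil trmx_mul !mulmxA. Qed.

Lemma conjM_sum (T : finType) (x : T -> 'rV[C]_n) : conjM (\sum_t x t) = \sum_t conjM (x t).
Proof. exact: map_mx_sum. Qed.

Lemma sesq_sum_orth (T : finType) B (x : T -> 'rV[C]_n) :
  (forall t t', t != t' -> sesq B (x t) (x t') = 0) ->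
  sesq B (\sum_t x t) (\sum_t x t) = \sum_t sesq B (x t) (x t).
Proof.
move=> H; rewrite {1}/sesq {1}/bil conjM_sum linear_sum mulmx_suml mulmx_suml summxE.
apply: eq_bigr => t _; rewrite mulmx_sumr summxE (bigD1 t) //= big1 ?addr0 // => t' tt.
by apply: H; rewrite eq_sym.
Qed.

(** Both sides are determined by their values on the rows of A and B, which
    are real. *)
Lemma bil_cplx Q Q' (A B : 'M[R]_n) :
  (forall x y : 'rV[R]_n, (x <= A)%MS -> (y <= B)%MS -> bil Q x y = bil Q' x y) ->
  forall x y : 'rV[C]_n, (x <= cplx A)%MS -> (y <= cplx B)%MS -> bil (cplx Q) x y = bil (cplx Q') x y.
Proof.
move=> H x y /submxP[u ->] /submxP[w ->].
have E : A *m Q *m B^T = A *m Q' *m B^T.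
  have ent Q1 i j : bil Q1 (row i A) (row j B) = (A *m Q1 *m B^T) i j.
    by rewrite /bil -row_mul [LHS]mxE [RHS]mxE; apply: eq_bigr => k _; rewrite [row _ _ _ _]mxE !mxE.
  by apply/matrixP => i j; rewrite -!ent; apply: H; exact: row_sub.
have F (Q1 : 'M[R]_n) : bil (cplx Q1) (u *m cplx A) (w *m cplx B) = (u *m cplx (A *m Q1 *m B^T) *m w^T) 0 0.
  by rewrite /bil /cplx !map_mxM -map_trmx trmx_mul !mulmxA.
by rewrite !F E.
Qed.

Lemma mnorm_conj (y : 'rV[C]_n) : mnorm (conjM y) = mnorm y.
Proof. by apply: eq_bigr => i _; apply: eq_bigr => j _; rewrite mxE cabs_conj. Qed.

Lemma sesq_bound B y : cabs (sesq B y y) <= mnorm B * mnorm y ^+ 2.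
Proof.
rewrite /sesq /bil; apply: (le_trans (mnorm_ge _ 0 0)).
apply: (le_trans (mnormM _ _)); rewrite mnorm_tr mnorm_conj expr2 mulrA [mnorm B * _]mulrC.
by rewrite ler_wpM2r ?mnorm_ge0 ?mnormM.
Qed.

Lemma cabs_iexp (m : int) : cabs ('i%C ^ m : C) = 1.
Proof.
case: m => m; rewrite /exprz ?cabsV cabsX cabsi expr1n //.
by rewrite invr1.
Qed.

(** The vector d is in the radical of Q_k. *)
Lemma graded_forms_cplx (V Q : int -> 'M[R]_n) k (x d : 'rV[C]_n) : graded_forms V Q -> (V (k - 1) <= V k)%MS ->
  (x <= cplx (V k))%MS -> (d <= cplx (V (k - 1)))%MS ->
  sesq (cplx (Q k)) (x + d) (x + d) = sesq (cplx (Q k)) x x.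
Proof.
move=> /(_ k) [sym rad] inc hx hd.
have hd' : (d <= cplx (V k))%MS by rewrite (submx_trans hd) // cplx_sub.
have cj (A : 'M[R]_n) (y : 'rV[C]_n) : (y <= cplx A)%MS -> (conjM y <= cplx A)%MS.
  by rewrite conjM_sub2 conj_cplx.
have b0 x' y' : bil (cplx (0 : 'M[R]_n)) x' y' = 0 :> C.
  by rewrite /bil /cplx map_mx0 mulmx0 mul0mx mxE.
have r1 : forall x y : 'rV[C]_n, (x <= cplx (V (k - 1)))%MS -> (y <= cplx (V k))%MS -> bil (cplx (Q k)) x y = 0.
  move=> x1 y1 h1 h2; rewrite (@bil_cplx (Q k) 0 (V (k - 1)) (V k)) //.
  by move=> x' y' h1' h2'; rewrite rad // /bil mulmx0 mul0mx mxE.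
have r2 : forall x y : 'rV[C]_n, (x <= cplx (V k))%MS -> (y <= cplx (V (k - 1)))%MS -> bil (cplx (Q k)) x y = 0.
  move=> x1 y1 h1 h2; rewrite (@bil_cplx (Q k) 0 (V k) (V (k - 1))) //.
  move=> x' y' h1' h2'; rewrite (sym y' x') ?(submx_trans h2' inc) //.
  by rewrite rad // mulr0 /bil mulmx0 mul0mx mxE.
rewrite /sesq [conjM _]map_mxD -!/(conjM _) bilDl !bilDr.
by rewrite (r2 x (conjM d)) ?cj // (r1 d (conjM x)) ?cj // (r1 d (conjM d)) ?cj // !addr0.
Qed.

End Forms.

(** The content of [mixed_hodge_metric], with the bigrading exposed so that
    it can be chosen as a function of the point. *)
Definition metric_bigrading (R : realType) n (W Q : int -> 'M[R]_n) F (h : 'M[R[i]]_n) I : Prop :=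
  [/\ deligne_bigrading W F I,
    forall p q p' q' x y, (p, q) != (p', q') ->
       (x <= I p q)%MS -> (y <= I p' q')%MS -> sesq h x y = 0
  & forall p q x y, (x <= I p q)%MS -> (y <= I p q)%MS ->
       sesq h x y = ('i%C : R[i]) ^ (p - q) * sesq (cplx (Q (p + q))) x y].

(** * Flat data on the half plane *)

Section Variation.
Variables (R : realType) (n : nat) (H : gpvmhs R n).
Local Notation C := R[i].
Local Notation Im := complex.Im.
Local Notation z0 := (zbase R).
Variables (Phi : C -> 'M[R]_n) (N : 'M[R]_n).
Hypothesis HPhi : flat_frame H Phi.
Hypothesis HN : monodromy_logarithm Phi N.
Local Notation W := (liftW H Phi z0).

Lemma Phi_unit z : upper_half_plane z -> Phi z \in unitmx.
Proof. by move=> /HPhi[]. Qed.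

Lemma Phi_near z : upper_half_plane z -> \forall w \near (z : C^o),
  Phi w = Phi z *m vL H (covering z) (covering w) /\ vL H (covering z) (covering w) \in unitmx.
Proof.
move=> hz; have [_ h1] := HPhi hz.
exact: filterI h1 (near_covering (transport_unit (vL H) (covering_disk hz))).
Qed.

Lemma liftW_const z k : upper_half_plane z -> (liftW H Phi z k :=: liftW H Phi z0 k)%MS.
Proof.
move: z; apply: (@half_plane_connected _ (fun z => (liftW H Phi z k :=: liftW H Phi z0 k)%MS) _ (zbaseP R)) => // z hz.
have h2 := near_covering (vW_flat H (covering_disk hz) k).
apply: filterS (filterI (Phi_near hz) h2) => w [[E u] EW].
have -> // : (liftW H Phi z k :=: liftW H Phi z0 k)%MS <-> (liftW H Phi w k :=: liftW H Phi z0 k)%MS.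
have EE : (liftW H Phi w k :=: liftW H Phi z k)%MS.
  rewrite /liftW E invmx_mul ?Phi_unit // mulmxA.
  apply: eqmx_trans (eqmxMr _ (eqmxMr _ EW)) _.
  by rewrite mulmxK.
split => h; [exact: eqmx_trans EE h | exact: eqmx_trans (eqmx_sym EE) h].
Qed.

Lemma W_Phi z k : upper_half_plane z -> (W k *m Phi z :=: vW H (covering z) k)%MS.
Proof.
move=> hz; apply: eqmx_trans (eqmxMr _ (eqmx_sym (liftW_const k hz))) _.
by rewrite /liftW mulmxKV // Phi_unit.
Qed.

Lemma section_const (v : C -> 'rV[C]_n) : flat_section H v -> forall z, upper_half_plane z ->
  v (covering z) *m cplx (invmx (Phi z)) = v (covering z0) *m cplx (invmx (Phi z0)).
Proof.
move=> Hv; apply: (@half_plane_connected _ (fun z => v (covering z) *m cplx (invmx (Phi z)) = v (covering z0) *m cplx (invmx (Phi z0))) _ (zbaseP R)) => // z hz.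
have h2 := near_covering (Hv _ (covering_disk hz)).
apply: filterS (filterI (Phi_near hz) h2) => w [[E u] Ev].
rewrite Ev E invmx_mul ?Phi_unit //.
have -> : v (covering z) *m cplx (vL H (covering z) (covering w)) *m
  cplx (invmx (vL H (covering z) (covering w)) *m invmx (Phi z)) = v (covering z) *m cplx (invmx (Phi z)).
  by rewrite -mulmxA -map_mxM mulmxA mulmxV // mul1mx.
by [].
Qed.

Lemma liftQ_const k (x y : 'rV[R]_n) : (x <= W k)%MS -> (y <= W k)%MS -> forall z, upper_half_plane z ->
  bil (liftQ H Phi z k) x y = bil (liftQ H Phi z0 k) x y.
Proof.
move=> hx hy; apply: (@half_plane_connected _ (fun z => bil (liftQ H Phi z k) x y = bil (liftQ H Phi z0 k) x y) _ (zbaseP R)) => // z hz.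
have h2 := near_covering (vQ_flat H (covering_disk hz) k).
apply: filterS (filterI (Phi_near hz) h2) => w [[E u] EQ].
have -> // : bil (liftQ H Phi w k) x y = bil (liftQ H Phi z k) x y.
rewrite /liftQ !bil_trans E !mulmxA; apply: EQ; rewrite -(W_Phi k hz); exact: submxMr.
Qed.

Lemma W_filtration : increasing_filtration W.
Proof.
have [[h1 [k0 h2] [k1 h3]] _ _ _ _] := v_mhs H (covering_disk (zbaseP R)).
split.
- by move=> k l kl; apply: submxMr; exact: h1.
- exists k0; apply: eqmx_trans (eqmxMr _ h2) _; by rewrite mul0mx.
- exists k1; apply: eqmx_trans (eqmxMr _ h3) _; rewrite mul1mx; apply/eqmxP.
  by rewrite submx1 sub1mx row_full_unit unitmx_inv /=; exact: (Phi_unit (zbaseP R)).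
Qed.

Lemma N_nilp : N ^+ n = 0.
Proof. by have [[k hk] _] := HN; exact: nilp hk. Qed.
Lemma cN_nilp : (cplx N) ^+ n = 0.
Proof. by rewrite -cplx_exp N_nilp /cplx map_mx0. Qed.

(** The section is single-valued, hence fixed by the monodromy e^N. *)
Lemma flat_section_N (v : C -> 'rV[C]_n) : flat_section H v ->
  v (covering z0) *m cplx (invmx (Phi z0)) *m cplx N = 0.
Proof.
move=> Hv; set c := v (covering z0) *m cplx (invmx (Phi z0)).
have hz1 := upper_half_plane1 (zbaseP R).
have E : c = c *m nilexp (cplx N).
  have E0 : c = v (covering z0) *m cplx (invmx (Phi (z0 + 1))).
    by rewrite /c -(section_const Hv hz1) coveringDr1.
  rewrite {1}E0.
  have [_ /(_ _ (zbaseP R)) hN] := HN.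
  rewrite /c hN -cplx_nilexp -mulmxA -map_mxM invmx_mul ?Phi_unit //; last first.
    by rewrite -[N]scale1r nilexp_unit // N_nilp.
  by rewrite -mulmxA mulVmx ?mulmx1 // -[N]scale1r nilexp_unit // N_nilp.
apply/eqP; rewrite -submx0; apply: (unip_log cN_nilp) => j.
have comm : cplx N ^+ j *m (nilexp (cplx N) - 1%:M) = (nilexp (cplx N) - 1%:M) *m cplx N ^+ j.
  rewrite mulmxBr mulmxBl mulmx1 mul1mx; congr (_ - _).
  elim: j => [|j IH]; first by rewrite expr0 mulmx1 mul1mx.
  have E1 : nilexp (cplx N) *m cplx N = cplx N *m nilexp (cplx N).
    by have := nilexp_comm (cplx N) 1; rewrite scale1r.
  by rewrite exprS -mulmxE -mulmxA IH mulmxA -E1 mulmxA.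
by rewrite -mulmxA comm mulmxA mulmxBr mulmx1 -E subrr mul0mx sub0mx.
Qed.

Lemma trivialization_const k (t : C -> 'M[R]_n) (L : int -> 'M[C]_n) :
  (forall a, punctured_disk a ->
    [/\ (vW H a k :&: kermx (t a) :=: vW H a (k - 1))%MS,
        \forall s \near (a : C^o),
          vW H a k *m vL H a s *m t s = vW H a k *m t a
      & forall p, ((vF H a p :&: cplx (vW H a k)) *m cplx (t a) :=: L p)%MS]) ->
  forall z, upper_half_plane z ->
  W k *m Phi z *m t (covering z) = W k *m Phi z0 *m t (covering z0).
Proof.
move=> Ht; apply: (@half_plane_connected _ (fun z =>
  W k *m Phi z *m t (covering z) = W k *m Phi z0 *m t (covering z0)) _ (zbaseP R)) => // z hz.
have [_ h2 _] := Ht _ (covering_disk hz).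
apply: filterS (filterI (Phi_near hz) (near_covering h2)) => w [[E u] Et].
suff -> : W k *m Phi w *m t (covering w) = W k *m Phi z *m t (covering z) by [].
rewrite E mulmxA; have /submxP[X ->] : (W k *m Phi z <= vW H (covering z) k)%MS by rewrite W_Phi.
by rewrite -!mulmxA; congr (_ *m _); rewrite !mulmxA.
Qed.

Hypothesis Hunip : unipotent_variation H.
Variable M : int -> 'M[R]_n.
Hypothesis HM : relative_weight_filtration N W M.

(** The map t that trivializes Gr^W_k is single-valued, so that e^N - 1 maps
    W_k to the kernel W_(k-1) of t. *)
Lemma W_N1 k : (W k *m N <= W (k - 1))%MS.
Proof.
have [t [L Ht]] := Hunip k.
have WN : (W k *m N <= W k)%MS by case: HM.
have hz1 := upper_half_plane1 (zbaseP R).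
apply: (unip_log N_nilp) => j.
have E1 := trivialization_const Ht hz1; rewrite coveringDr1 in E1.
have [_ /(_ _ (zbaseP R)) hN] := HN; rewrite hN in E1.
have [hk _ _] := Ht _ (covering_disk (zbaseP R)).
have WNj : (W k *m N ^+ j <= W k)%MS.
  elim: j => [|j IH]; first by rewrite expr0 mulmx1.
  by rewrite exprSr -mulmxE mulmxA (submx_trans (submxMr _ IH)).
suff : (W k *m N ^+ j *m (nilexp N - 1%:M) *m Phi (z0 + 1)%R <= W (k - 1)%R *m Phi (z0 + 1)%R)%MS.
  by rewrite submxMfree // row_free_unit Phi_unit.
rewrite (W_Phi _ hz1) coveringDr1 -hk sub_capmx; apply/andP; split.
  rewrite -[X in vW H X](coveringDr1 z0) -(W_Phi _ hz1); apply: submxMr.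
  rewrite mulmxBr mulmx1 addmx_sub //; last by rewrite eqmx_opp.
  have E2 : nilexp N = nilexp (1 *: N) by rewrite scale1r.
  have /submxP[X ->] := WNj; rewrite E2.
  by rewrite -mulmxA (submx_trans (submxMl _ _)) // nilexp_stable.
apply/sub_kermxP.
have /submxP[X EX] := WNj.
rewrite EX; move: (W k) E1 => A E1.
have -> : X *m A *m (nilexp N - 1%:M) *m Phi (z0 + 1) *m t (covering z0) =
  X *m (A *m (nilexp N *m Phi (z0 + 1)) *m t (covering z0) - A *m Phi (z0 + 1) *m t (covering z0)).
  by rewrite -!mulmxA -mulmxBr mulmxBl mul1mx.
by rewrite E1 subrr mulmx0.
Qed.

(** On Gr^W_k, identified by t with a fixed space, the Hodge filtration is
    the constant filtration L. *)
Lemma gr_const z z' k p : upper_half_plane z -> upper_half_plane z' ->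
  (grF W (liftF H Phi z) k p <= grF W (liftF H Phi z') k p)%MS.
Proof.
move=> hz hz'; have [t [L Ht]] := Hunip k.
have tc (x : 'M[C]_n) u u' : upper_half_plane u -> upper_half_plane u' -> (x <= cplx (W k))%MS ->
    x *m cplx (Phi u) *m cplx (t (covering u)) = x *m cplx (Phi u') *m cplx (t (covering u')).
  move=> hu hu' /submxP[X ->]; rewrite -!mulmxA -!map_mxM !mulmxA.
  by have := trivialization_const Ht hu; rewrite -(trivialization_const Ht hu') -!mulmxA => ->.
have Wu u : upper_half_plane u -> (cplx (W k *m Phi u) :=: cplx (vW H (covering u) k))%MS.
  by move=> hu; apply/eqmxP; rewrite !cplx_sub !(W_Phi) // submx_refl.
have LF u : upper_half_plane u ->
    ((liftF H Phi u p :&: cplx (W k)) *m cplx (Phi u) *m cplx (t (covering u)) :=: L p)%MS.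
  move=> hu; have [_ _ h3] := Ht _ (covering_disk hu).
  apply: eqmx_trans (h3 p); apply: eqmxMr; apply: eqmx_trans (F_cap_unit _ _ (Phi_unit hu)) _.
  apply: cap_eqmx; last exact: Wu.
  by rewrite /liftF -mulmxA cplxVK ?(Phi_unit hu) // mulmx1.
rewrite {1}/grF addsmx_sub addsmxSr andbT.
set A := (_ :&: _)%MS.
have AW : (A <= cplx (W k))%MS by exact: capmxSr.
have : (A *m cplx (Phi z') *m cplx (t (covering z')) <= L p)%MS.
  by rewrite (tc A z' z) // -(LF z hz).
rewrite -(LF z' hz') -[X in (_ <= X)%MS]mulmxA -[X in (X <= _)%MS]mulmxA => /submxP[X].
set B := (_ :&: _)%MS; have BW : (B <= cplx (W k))%MS by exact: capmxSr.
move=> E; have -> : A = X *m B + (A - X *m B) by rewrite addrC subrK.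
apply: addmx_sub_adds; first exact: submxMl.
have DW : (A - X *m B <= cplx (W k))%MS.
  by rewrite addmx_sub // eqmx_opp (submx_trans (submxMl _ _)).
have [hk _ _] := Ht _ (covering_disk hz').
rewrite -(@submxMfree _ _ _ _ _ _ _ (cplx (Phi z'))); last by rewrite row_free_unit map_unitmx (Phi_unit hz').
rewrite -map_mxM.
apply: (@submx_trans _ _ _ _ _ _ (cplx (vW H (covering z') (k - 1)))); last by rewrite cplx_sub (W_Phi).
have hk' : (cplx (vW H (covering z') k) :&: kermx (cplx (t (covering z'))) <= cplx (vW H (covering z') (k - 1)))%MS.
  rewrite -map_kermx -[map_mx _ _]/(cplx _).
  have /eqmxP := map_capmx (real_complex R) (vW H (covering z') k) (kermx (t (covering z'))).
  by move=> /andP[_ h]; apply: (submx_trans h); rewrite map_submx hk.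
apply: submx_trans hk'; rewrite sub_capmx; apply/andP; split.
  by rewrite -(Wu z' hz') /cplx map_mxM; apply: submxMr; exact: DW.
apply/sub_kermxP; rewrite !mulmxBl; apply/eqP; rewrite subr_eq0; apply/eqP.
by rewrite -[A *m _ *m _]mulmxA E !mulmxA.
Qed.

(** * A holomorphic frame of the untwisted period map *)

Variables (psi : C -> int -> 'M[C]_n) (Finf : int -> 'M[C]_n).
Hypothesis Hpsi : forall z, upper_half_plane z -> forall p,
  (psi (covering z) p :=: liftF H Phi z p *m nilexp (- z *: cplx N))%MS.
Hypothesis Hcvg : forall p, subspace_cvg0 (psi^~ p) (Finf p).

(** A local holomorphic frame of F, untwisted. Differentiating the factor
    e^(-zN) subtracts b N from the covariant derivative, so Griffiths
    transversality takes the form of the last clause. *)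
Lemma psi_local (z : C) p : upper_half_plane z -> exists r (b : C -> 'M[C]_(r, n)) (db : 'M[C]_(r, n)),
  [/\ mdiff b z db,
      (\forall t \near (z : C^o), row_free (b t) /\ (b t :=: psi (covering t) p)%MS)
    & ((db + b z *m cplx N)%R <= psi (covering z) (p - 1))%MS].
Proof.
move=> hz; set a := covering z; have ha := covering_disk hz.
have [b hb1 hb2] := vF_holomorphic H ha p.
exists (\rank (vF H a p)).
pose C1 := cplx (invmx (Phi z)).
pose db := \matrix_(i, j) ((fun t : C^o => b t i j : C^o)^`() a) : 'M[C]_(\rank (vF H a p), n).
have Hb : mdiff b a db.
  move=> i j; rewrite mxE; have h := nbhs_singleton (hb1 i j).
  by apply/is_derive_cderiv; rewrite derive1E; apply: derivableP.
have dbF : (db <= vF H a (p - 1))%MS.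
  apply/row_subP => i.
  have h1 : holomorphic_near (fun t => row i (b t)) a.
    move=> k j; have := hb1 i j; apply: filterS => s.
    by have -> : (fun t : C^o => row i (b t) k j : C^o) = (fun t : C^o => b t i j : C^o) by apply/funext => t; rewrite mxE.
  have h2 : \forall s \near (a : C^o), (row i (b s) <= transported (vL H) (vF H) a s p)%MS.
    by move: hb2; apply: filterS => s [_ <-]; exact: row_sub.
  have := @vF_transversal R n H a ha p _ h1 h2.
  have -> // : row i db = \row_j (fun t : C^o => row i (b t) 0 j : C^o)^`() a.
  apply/rowP => j; rewrite !mxE.
  have -> // : (fun t : C^o => row i (b t) 0 j : C^o) = (fun t : C^o => b t i j : C^o).
  by apply/funext => t; rewrite mxE.
pose E (t : C) := nilexp (- t *: cplx N).
have En := cN_nilp.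
exists (fun t => b (covering t) *m C1 *m E t).
exists ((((0 +i* (2 * pi))%C * covering z) *: db *m C1) *m E z + (b a *m C1) *m - (E z *m cplx N)).
split.
- apply: mdiffM; last exact: mdiff_nilexp.
  by apply: mdiff_Mr; apply: mdiff_comp => //; exact: cderiv_covering.
- have [r hr hu] : exists2 r : R, 0 < r & forall t, cabs (t - z) < r -> upper_half_plane t.
    exists (Im z) => // t; have := @cabs_Im R (t - z); rewrite /upper_half_plane /=.
    case: t => x y; case: (z) hz => x' y' /=; rewrite /upper_half_plane /= => y0.
    by move=> h1 h2; have := le_lt_trans h1 h2; rewrite ltr_norml => /andP[]; lra.
  have near_u : \forall t \near (z : C^o), upper_half_plane t by apply/nearC; exists r.
  apply: filterS (filterI (filterI (Phi_near hz) near_u) (near_covering hb2)) => t [[[Et ut] ht] [fr Eb]].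
  have uC1 : C1 \in unitmx by rewrite map_unitmx unitmx_inv (Phi_unit hz).
  have uE : E t \in unitmx by exact: nilexp_unit.
  split.
    rewrite /row_free -!mulmxA mxrankMfree //.
    by rewrite row_free_unit unitmx_mul uC1.
  apply: eqmx_trans (eqmx_sym (Hpsi ht p)); apply: eqmxMr.
  apply: eqmx_trans (eqmxMr _ Eb) _.
  rewrite /transported /liftF -mulmxA -map_mxM Et invmx_mul ?(Phi_unit hz) //.
- rewrite mulmxN -[b a *m C1 *m E z *m _]mulmxA subrK -!scalemxAl scalemx_sub //.
  rewrite (Hpsi hz) /liftF submxMr // submxMr //.
Qed.

(** The frame is normalized by bet T = 1, where T is a right inverse of a
    basis of the limit. Being unique, the normalized frame is periodic, and
    it is holomorphic because the normalization of any local holomorphic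
    frame is. *)
Lemma frame p : exists (bet dbet : C -> 'M[C]_(\rank (Finf p), n)) (Y : R),
  [/\ forall z, Y < Im z -> mdiff bet z (dbet z),
      forall z, bet (z + 1) = bet z,
      forall e, 0 < e -> ev (fun z => forall i j, cabs (bet z i j - row_base (Finf p) i j) <= e),
      forall z, Y < Im z -> (bet z :=: psi (covering z) p)%MS
    & forall z, Y < Im z -> ((dbet z + bet z *m cplx N)%R <= psi (covering z) (p - 1))%MS].
Proof.
have [b [hb1 hb2]] := Hcvg p; set r := \rank (Finf p) in b hb1 hb2 *.
set B := row_base (Finf p) in hb1 *.
have /row_freeP[T HT] : row_free B by exact: row_base_free.
have evb e : 0 < e -> ev (fun z => forall i j, cabs (b (covering z) i j - B i j) <= e).
  move=> e0; suff : ev (fun z => forall ij : 'I_r * 'I_n, cabs (b (covering z) ij.1 ij.2 - B ij.1 ij.2) <= e).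
    by apply: ev_mono => z h i j; exact: (h (i, j)).
  apply: ev_fin => -[i j] /=; have /cvg0C/(_ e e0)/near0C := hb1 i j.
  exact: ev_near0.
have mD e : 0 < e -> ev (fun z => mnorm (b (covering z) - B) <= e).
  move=> e0; have k0 : 0 < 1 + (r * n)%:R :> R by rewrite ltr_pwDl.
  have e1 : 0 < e / (1 + (r * n)%:R) by rewrite divr_gt0.
  have := evb _ e1; apply: ev_mono => z h.
  apply: (@le_trans _ _ ((r * n)%:R * (e / (1 + (r * n)%:R)))).
    by apply: mnorm_le => [|i j]; [exact: ltW | rewrite mxE [X in _ + X]mxE; exact: h].
  by rewrite mulrA ler_pdivrMr // mulrC ler_wpM2l ?(ltW e0) // lerDr.
pose A z := b (covering z) *m T.
have mA : ev (fun z => mnorm (A z - 1%:M) <= 2^-1).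
  have e0 : 0 < 2^-1 / (1 + mnorm T) by rewrite divr_gt0 // ltr_pwDl // mnorm_ge0.
  have := mD _ e0; apply: ev_mono => z h; rewrite /A -HT -mulmxBl.
  apply: (le_trans (mnormM _ _)); have t0 := mnorm_ge0 T.
  rewrite ler_pdivlMr ?ltr_pwDl // in h; apply: le_trans h.
  by rewrite ler_wpM2l ?mnorm_ge0 // lerDr.
have [Y HY] := ev_and (ev_uhp R) (ev_and mA (ev_near0 hb2)).
pose bet z := invmx (A z) *m b (covering z).
have betT z : Y < Im z -> bet z *m T = 1%:M.
  by move=> /HY[_ [/near1_mnorm[u _] _]]; rewrite /bet -mulmxA mulVmx.
have betpsi z : Y < Im z -> (bet z :=: psi (covering z) p)%MS.
  move=> /HY[_ [/near1_mnorm[u _] h]]; apply: eqmx_trans h.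
  by apply: eqmxMfull; rewrite row_full_unit unitmx_inv.
have key z : Y < Im z -> exists D, mdiff bet z D /\ ((D + bet z *m cplx N)%R <= psi (covering z) (p - 1))%MS.
  move=> hY; have [hz _] := HY z hY.
  have [r' [b' [db' [h1 h2 h3]]]] := psi_local p hz.
  have rr : r' = r.
    have [f e] := nbhs_singleton h2.
    have rb : \rank (bet z) = r.
      apply/eqP; rewrite eqn_leq rank_leq_row /=.
      have := mxrankM_maxl (bet z) T; by rewrite betT // mxrank1.
    by rewrite -rb (betpsi z hY) -e; apply/esym/eqP.
  subst r'.
  have nearY : \forall t \near (z : C^o), Y < Im t.
    apply/nearC; exists (Im z - Y); first by rewrite subr_gt0.
    move=> t ht; have := @cabs_Im R (t - z); have -> : Im (t - z) = Im t - Im z by case: t ht => ? ?; case: (z) => ? ?.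
    by move=> h; have := le_lt_trans h ht; rewrite ltr_norml => /andP[]; lra.
  have u' t : Y < Im t -> row_free (b' t) /\ (b' t :=: psi (covering t) p)%MS -> b' t *m T \in unitmx /\ bet t = invmx (b' t *m T) *m b' t.
    move=> ht [f e].
    have /submxP[Z EZ] : (b' t <= bet t)%MS by rewrite (betpsi t ht) e.
    have ZE : b' t *m T = Z by rewrite EZ -mulmxA betT // mulmx1.
    have uZ : Z \in unitmx.
      rewrite -row_free_unit /row_free eqn_leq rank_leq_row /=.
      by move/eqP: f => {1}<-; rewrite EZ mxrankM_maxl.
    by rewrite ZE; split => //; rewrite EZ mulmxA mulVmx // mul1mx.
  have [uz ez] := u' z hY (nbhs_singleton h2).
  have [dY HdY] := mdiff_inv uz (mdiff_Mr T h1).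
  have h4 := mdiffM HdY h1.
  exists (dY *m b' z + invmx (b' z *m T) *m db'); split.
    apply: mdiff_near h4; apply: filterS (filterI nearY h2) => t [k1 k2].
    by have [_ ->] := u' t k1 k2.
  rewrite ez -addrA -mulmxA -mulmxDr addmx_sub //; last by rewrite (submx_trans (submxMl _ _)).
  rewrite (submx_trans (submxMl _ _)) //.
  have [f e] := nbhs_singleton h2; rewrite e.
  rewrite (Hpsi hz p) (Hpsi hz (p - 1)) submxMr // /liftF submxMr //.
  by have [_ _ [Fd _ _] _ _] := v_mhs H (covering_disk hz); apply: Fd; lia.
pose S (z : C) : set 'M[C]_(r, n) := fun D =>
  mdiff bet z D /\ ((D + bet z *m cplx N)%R <= psi (covering z) (p - 1))%MS.
exists bet, (fun z => xget 0 (S z)), Y.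
have keyx z : Y < Im z -> S z (xget 0 (S z)).
  by move=> /key[D HD]; exact: (@xgetI _ 0 (S z) D HD).
split.
- by move=> z /keyx[].
- by move=> z; rewrite /bet /A coveringDr1.
- move=> e e0.
  (* bet - B = (A^-1 - 1) b + (b - B), with A^-1 - 1 = A^-1 (B - b) T *)
  pose K := 2 * mnorm (1%:M : 'M[C]_r) * mnorm T * (mnorm B + 1) + 1.
  have K0 : 0 < K by rewrite ltr_pwDr // !mulr_ge0 ?addr_ge0 ?mnorm_ge0.
  have e1 : 0 < Order.min 1 (e / K) by rewrite lt_min ltr01 divr_gt0.
  have := ev_and mA (mD _ e1); apply: ev_mono => z [/near1_mnorm[u nu]].
  rewrite le_min => /andP[d1 d2] i j.
  have -> : bet z i j - B i j = (bet z - B) i j by rewrite [RHS]mxE [X in _ = _ + X]mxE.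
  apply: (le_trans (mnorm_ge _ i j)).
  have -> : bet z - B = invmx (A z) *m (B - b (covering z)) *m T *m b (covering z) + (b (covering z) - B).
    rewrite -[_ *m _ *m T]mulmxA mulmxBl HT -/(A z) mulmxBr mulmx1 mulVmx // mulmxBl mul1mx.
    by rewrite /bet addrA subrK.
  have nb : mnorm (b (covering z)) <= mnorm B + 1.
    have -> : b (covering z) = B + (b (covering z) - B) by rewrite addrC subrK.
    by apply: (le_trans (mnormD _ _)); rewrite lerD2l.
  apply: (le_trans (mnormD _ _)).
  apply: (@le_trans _ _ (2 * mnorm (1%:M : 'M[C]_r) * mnorm (b (covering z) - B) * mnorm T * (mnorm B + 1) + mnorm (b (covering z) - B))).
    rewrite lerD2r; apply: (le_trans (mnormM _ _)); apply: ler_pM; rewrite ?mnorm_ge0 //.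
    apply: (le_trans (mnormM _ _)); rewrite ler_wpM2r ?mnorm_ge0 //.
    apply: (le_trans (mnormM _ _)).
    by rewrite -[mnorm (B - _)]mnormN opprB ler_wpM2r ?mnorm_ge0.
  have -> : 2 * mnorm (1%:M : 'M[C]_r) * mnorm (b (covering z) - B) * mnorm T * (mnorm B + 1) + mnorm (b (covering z) - B) = mnorm (b (covering z) - B) * K.
    by rewrite /K; ring.
  by rewrite -ler_pdivlMr.
- exact: betpsi.
- by move=> z /keyx[].
Qed.

Lemma frame_rapid p : exists (bet dbet : C -> 'M[C]_(\rank (Finf p), n)),
  [/\ mrapid (fun z => bet z - row_base (Finf p)), mrapid dbet,
      ev (fun z => (bet z :=: psi (covering z) p)%MS)
    & ev (fun z => ((dbet z + bet z *m cplx N)%R <= psi (covering z) (p - 1))%MS)].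
Proof.
have [bet [dbet [Y [h1 h2 h3 h4 h5]]]] := frame p.
have hr i j : rapid (fun z => bet z i j - row_base (Finf p) i j) /\ rapid (fun z => dbet z i j).
  apply: (rapid_decay (Y := Y)).
  - by move=> z /h1; exact.
  - by move=> z; rewrite h2.
  - by move=> e /h3; apply: ev_mono => z; exact.
exists bet, dbet; split.
- by move=> i j; have [h _] := hr i j; apply: eq_rapid h; apply: ev_all => z; rewrite [RHS]mxE [X in _ = _ + X]mxE.
- by move=> i j; have [_ h] := hr i j.
- by exists Y.
- by exists Y.
Qed.

(** * The limit Hodge filtration *)

Hypothesis Hdual : compact_dual W (liftQ H Phi z0) (hodge_number W (liftF H Phi z0)) Finf.

Let Wf : increasing_filtration W := W_filtration.
Let WN2 : forall k, (W k *m N <= W (k - 2))%MS := W_N2 Wf HM W_N1.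
Let Winc k l : k <= l -> (W k <= W l)%MS. Proof. by case: Wf => h _ _; exact: h. Qed.
Let Nn : (cplx N) ^+ n = 0 := cN_nilp.

Lemma cW_N1 k : (cplx (W k) *m cplx N <= cplx (W (k - 1)))%MS.
Proof. by rewrite -map_mxM cplx_sub W_N1. Qed.

Lemma cW_N2 k : (cplx (W k) *m cplx N <= cplx (W (k - 2)))%MS.
Proof. by rewrite -map_mxM cplx_sub WN2. Qed.

Lemma cW_dec1 k : (cplx (W (k - 1)) <= cplx (W k))%MS.
Proof. by rewrite cplx_sub Winc //; lia. Qed.

Lemma cW_exp k (a : C) : (cplx (W k) *m nilexp (a *: cplx N) <= cplx (W k))%MS.
Proof. by apply: nilexp_stable; exact: submx_trans (cW_N1 k) (cW_dec1 k). Qed.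

Lemma cW_exp1 k (a : C) : (cplx (W k) *m (nilexp (a *: cplx N) - 1%:M) <= cplx (W (k - 1)))%MS.
Proof. by apply: nilexp_sub1 (cW_N1 k) (cW_dec1 k). Qed.

Lemma cW_expE k (a : C) : (cplx (W k) *m nilexp (a *: cplx N) :=: cplx (W k))%MS.
Proof.
apply/eqmxP/andP; split; first exact: cW_exp.
rewrite -{1}(mulmx1 (cplx (W k))) -(nilexpK (- a) Nn) opprK mulmxA.
by apply: submxMr; exact: cW_exp.
Qed.

Lemma liftF_pure : pure_on_Gr W (liftF H Phi z0).
Proof.
have [_ _ _ h _] := v_mhs H (covering_disk (zbaseP R)).
by apply: pure_transport h; rewrite unitmx_inv (Phi_unit (zbaseP R)).
Qed.

Lemma liftF_dec z : upper_half_plane z -> decreasing_filtration (liftF H Phi z).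
Proof.
move=> hz; have [_ _ h _ _] := v_mhs H (covering_disk hz).
apply: (dec_transport (U := cplx (invmx (Phi z))) _ _ h) => // .
by rewrite map_unitmx unitmx_inv (Phi_unit hz).
Qed.

Lemma gr_rank_const z k p : upper_half_plane z ->
  \rank (grF W (liftF H Phi z) k p) = \rank (grF W (liftF H Phi z0) k p).
Proof.
move=> hz; apply: eqmx_rank.
by rewrite !(gr_const) //; exact: zbaseP.
Qed.

Lemma cap_rank_const z p k : upper_half_plane z ->
  \rank (liftF H Phi z p :&: cplx (W k)) = \rank (liftF H Phi z0 p :&: cplx (W k)).
Proof. by move=> hz; apply: grF_cap_rank => // q l; exact: gr_rank_const. Qed.

Lemma psi_cap z p k : upper_half_plane z ->
  (psi (covering z) p :&: cplx (W k) :=: (liftF H Phi z p :&: cplx (W k)) *m nilexp (- z *: cplx N))%MS.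
Proof.
move=> hz; apply: eqmx_trans (eqmx_sym (cap_unitM _ _ (nilexp_unit (- z) Nn))).
by apply: cap_eqmx; [exact: Hpsi | exact: eqmx_sym (cW_expE _ _)].
Qed.

Lemma psi_cap_rank z p k : upper_half_plane z ->
  \rank (psi (covering z) p :&: cplx (W k)) = \rank (liftF H Phi z0 p :&: cplx (W k)).
Proof.
by move=> hz; rewrite (psi_cap p k hz) rank_unitM ?nilexp_unit // cap_rank_const.
Qed.

(** An automorphism preserving W carries the limit to a mixed Hodge
    structure with the Hodge numbers of the fibres. *)
Lemma Finf_data : decreasing_filtration Finf /\
  forall p k, \rank (Finf p :&: cplx (W k)) = \rank (liftF H Phi z0 p :&: cplx (W k)).
Proof.
have [F0 [g [[[_ _ Fd Fp _] Hh] [ug Wg _] HF]]] := Hdual.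
split; first exact: dec_transport ug HF Fd.
move=> p k; rewrite -(hodge_number_cap_rank Wf Fd (liftF_dec (zbaseP R)) Fp liftF_pure Hh).
rewrite -(rank_unitM (F0 p :&: cplx (W k))%MS ug); apply: eqmx_rank; apply/eqmxP.
apply: eqmx_trans (eqmx_sym (cap_unitM _ _ ug)).
by apply: cap_eqmx; [exact: HF | exact: eqmx_sym (Wg k)].
Qed.

Lemma lower_psi p : lower (fun z => psi (covering z) p) (Finf p).
Proof.
have [bet [dbet [h1 h2 h3 h4]]] := frame_rapid p.
have /submxP[X EX] : (Finf p <= row_base (Finf p))%MS by rewrite eq_row_base.
exists (fun z => X *m (bet z - row_base (Finf p))).
  exact: mrapidMl (mpolyb_cst X) h1.
move: h3; apply: ev_mono => z h.
by rewrite {1}EX -mulmxDr addrC subrK (submx_trans (submxMl _ _)) // h.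
Qed.

Lemma upper_psi p : upper (fun z => psi (covering z) p) (Finf p).
Proof.
apply: lower_upper (lower_psi p) _.
have [bet [dbet [h1 h2 h3 h4]]] := frame_rapid p.
by move: h3; apply: ev_mono => z <-; exact: rank_leq_row.
Qed.

Lemma upper_psi_cap p k : upper (fun z => psi (covering z) p :&: cplx (W k))%MS (Finf p :&: cplx (W k))%MS.
Proof. exact: upper_cap (upper_psi p) (upper_cst _). Qed.

(** Intersections only preserve [upper]; the equality of ranks restores
    [lower]. *)
Lemma lower_psi_cap p k : lower (fun z => psi (covering z) p :&: cplx (W k))%MS (Finf p :&: cplx (W k))%MS.
Proof.
apply: upper_lower (upper_psi_cap p k) _; have := ev_uhp R; apply: ev_mono => z hz.
by rewrite psi_cap_rank // (Finf_data.2 p k).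
Qed.

(** The twist e^(-zN) is trivial on Gr^W, where the Hodge filtration is
    constant; so is its limit, up to equality of ranks. *)
Lemma Finf_gr k p : (grF W Finf k p :=: grF W (liftF H Phi z0) k p)%MS.
Proof.
have le : (grF W Finf k p <= grF W (liftF H Phi z0) k p)%MS.
  rewrite {1}/grF addsmx_sub addsmxSr andbT.
  apply: lower_limit (lower_psi_cap p k) _; have := ev_uhp R; apply: ev_mono => z hz.
  apply: submx_trans (gr_const _ _ hz (zbaseP R)).
  rewrite (psi_cap p k hz); set P := (_ :&: _)%MS.
  have -> : P *m nilexp (- z *: cplx N) = P + P *m (nilexp (- z *: cplx N) - 1%:M).
    by rewrite mulmxBr mulmx1 addrC subrK.
  apply: addmx_sub_adds; first exact: submx_refl.
  by apply: submx_trans (cW_exp1 k (- z)); apply: submxMr; exact: capmxSr.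
have [Fd Hr] := Finf_data.
apply/eqmxP; rewrite le -(geq_leqif (mxrank_leqif_sup le)).
have h1 := @grF_rank _ _ W Finf Wf k p; have h2 := @grF_rank _ _ W (liftF H Phi z0) Wf k p.
by rewrite !Hr in h1; lia.
Qed.

Lemma Finf_pure : pure_on_Gr W Finf.
Proof.
move=> k p; have [h1 h2] := liftF_pure k p; split.
  by apply: eqmx_trans h1; apply: adds_eqmx; [exact: Finf_gr | apply: conjM_eqmx; exact: Finf_gr].
by apply: eqmx_trans h2; apply: cap_eqmx; [exact: Finf_gr | apply: conjM_eqmx; exact: Finf_gr].
Qed.

(** The relation dbet + bet N <= psi^(p-1) in the limit, where dbet tends to
    0. *)
Lemma Finf_N p : (Finf p *m cplx N <= Finf (p - 1))%MS.
Proof.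
have [bet [dbet [h1 h2 h3 h4]]] := frame_rapid p.
have [E HE HA] := upper_psi (p - 1).
set rb := row_base (Finf p) in h1 *; set c := cokermx (Finf (p - 1)) in HA *.
apply: (@submx_trans _ _ _ _ _ _ (rb *m cplx N)); first by rewrite submxMr // /rb eq_row_base.
rewrite submxE -/c -mulmxA; apply/eqP; apply: mrapid_cst.
apply: (@eq_mrapid _ _ _ (fun z => - ((bet z - rb) *m (cplx N *m c)) - dbet z *m c - (dbet z + bet z *m cplx N) *m E z)).
  have := ev_and h4 HA; apply: ev_mono => z [/submxP[X EX] hz].
  have : (dbet z + bet z *m cplx N) *m (c + E z) = 0 by rewrite EX -mulmxA hz mulmx0.
  rewrite mulmxDr => /eqP; rewrite addrC addr_eq0 => /eqP ->.
  rewrite mulmxBl mulmxDl -[bet z *m _ *m c]mulmxA.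
  move: (cplx N *m c) => Nc; move: (bet z *m Nc) (dbet z *m c) (rb *m Nc) => x y w.
  by rewrite opprK opprB -addrA addKr subrK.
have pb : mpolyb bet.
  have := mpolybD (mrapid_polyb h1) (mpolyb_cst rb).
  by move=> hh i j; apply: eq_polyb (hh i j); apply: ev_all => z; rewrite subrK.
apply: mrapidB.
  apply: mrapidB; last exact: mrapidMr (mpolyb_cst _).
  by apply: mrapidN; exact: mrapidMr (mpolyb_cst _).
apply: mrapidMl HE; apply: mpolybD; first exact: mrapid_polyb.
exact: mpolybM (mpolyb_cst _).
Qed.

Variable k0 : int.
Hypothesis W0 : (W k0 :=: (0 : 'M[R]_n))%MS.

(** N lowers F by one step and W by two, so that the piece of weight l is
    sent into that of weight l - 2. With N W_k <= W_(k-1) only, the step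
    from k to k - 1 would fail, the levels changing there. *)
Lemma Uinf_N p j : (Uspace W k0 Finf p j *m cplx N <= Uspace W k0 Finf p j)%MS.
Proof.
rewrite /Uspace; set e := hodge_step p (k0 + j%:Z).
have [Fd _] := Finf_data; have Fdec : forall p q, p <= q -> (Finf q <= Finf p)%MS by case: Fd.
suff key i : (i <= j)%N -> (fsum W k0 (fun l => conjM (Finf (l - e l + 1))) i *m cplx N <=
    fsum W k0 (fun l => conjM (Finf (l - e l + 1))) j)%MS by exact: key.
elim: i => [|i IH] ij; first by rewrite /= mul0mx sub0mx.
rewrite [fsum _ _ _ i.+1]/= addsmxMr addsmx_sub IH ?(ltnW ij) //=.
set l := (k0 + i.+1%:Z)%R.
apply: (@submx_trans _ _ _ _ _ _ (conjM (Finf (l - e l)) :&: cplx (W (l - 2)))%MS).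
  rewrite (submx_trans (capmxMr _ _ _)) // capmxS ?cW_N2 //.
  rewrite -{1}[cplx N]conj_cplx -conjM_mul conjM_sub.
  by have := Finf_N (l - e l + 1); rewrite addrK.
have [lk|lk] := lerP (l - 2) k0; first by rewrite (cW_0 Winc W0 lk) capmx0 sub0mx.
have [i' Hi'] : exists i' : nat, l - 2 = k0 + i'%:Z by exists (absz (l - 2 - k0)%R); lia.
have ij' : (i' <= j)%N by rewrite /l in Hi'; lia.
apply: submx_trans (fsum_sup Winc W0 _ ij'); rewrite -Hi'; apply: capmxS => //.
rewrite conjM_sub; apply: Fdec; have := hodge_step_le p (k0 + j%:Z) (l - 2) l; rewrite -/e; lia.
Qed.

(** * Convergence of the bigradings *)

(** From the fibre at covering z to the space of the frame, followed by the
    untwisting that defines psi. *)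
Definition flatten_at z : 'M[C]_n := cplx (invmx (Phi z)) *m nilexp (- z *: cplx N).

Lemma flatten_at_unit z : upper_half_plane z -> flatten_at z \in unitmx.
Proof.
by move=> hz; rewrite unitmx_mul nilexp_unit // map_unitmx unitmx_inv (Phi_unit hz).
Qed.

Lemma vW_low z : upper_half_plane z -> (vW H (covering z) k0 :=: (0 : 'M[R]_n))%MS.
Proof.
move=> hz; apply: eqmx_trans (eqmx_sym (W_Phi k0 hz)) _.
by apply: eqmx_trans (eqmxMr _ W0) _; rewrite mul0mx.
Qed.

Lemma vcap_lift z p k : upper_half_plane z ->
  ((vF H (covering z) p :&: cplx (vW H (covering z) k)) *m cplx (invmx (Phi z)) :=:
   liftF H Phi z p :&: cplx (W k))%MS.
Proof.
move=> hz; apply: eqmx_trans (F_cap_unit _ _ _) _; first by rewrite unitmx_inv (Phi_unit hz).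
apply: cap_eqmx => //; have h := liftW_const k hz.
by apply/eqmxP; rewrite /liftF !cplx_sub !h !submx_refl.
Qed.

Lemma vcap_rank z p k : upper_half_plane z ->
  \rank (vF H (covering z) p :&: cplx (vW H (covering z) k)) = \rank (Finf p :&: cplx (W k)).
Proof.
move=> hz; rewrite (Finf_data).2 -(cap_rank_const p k hz).
rewrite -(vcap_lift p k hz) rank_unitM // map_unitmx unitmx_inv (Phi_unit hz) //.
Qed.

(** Conjugation turns the untwisting by e^(-zN) into one by the conjugate of
    z; the quotient of the two grows polynomially in Im z. *)
Lemma piece_twist z m l : upper_half_plane z ->
  ((conjM (psi (covering z) m) :&: cplx (W l)) *m nilexp ((z^* - z) *: cplx N) <=
   (conjM (vF H (covering z) m) :&: cplx (vW H (covering z) l)) *m flatten_at z)%MS.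
Proof.
move=> hz; rewrite -(eqmxMr _ (conj_cap (psi (covering z) m) (W l))).
rewrite -(eqmxMr _ (conj_cap (vF H (covering z) m) (vW H (covering z) l))).
have h : (conjM (psi (covering z) m :&: cplx (W l))%MS <=
    conjM (vF H (covering z) m :&: cplx (vW H (covering z) l))%MS *m cplx (invmx (Phi z)) *m nilexp (- z^* *: cplx N))%MS.
  have -> : - z^* = (- z)^* by rewrite rmorphN.
  rewrite -conj_nilexp -[cplx (invmx _)]conj_cplx -!conjM_mul conjM_sub.
  by rewrite (psi_cap m l hz); apply: submxMr; rewrite (vcap_lift m l hz).
apply: (submx_trans (submxMr _ h)); rewrite /flatten_at; move: (conjM (vF _ _ _ :&: _)%MS) => V.
rewrite -[_ *m _ *m nilexp ((_ - _) *: _)]mulmxA nilexpD // addrA addNr add0r mulmxA.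
exact: submx_refl.
Qed.

Section Upper.
Variables (p : int) (j : nat).
Let e := hodge_step p (k0 + j%:Z).

Lemma lower_Upsi : lower (fun z => Uspace W k0 (psi (covering z)) p j) (Uspace W k0 Finf p j).
Proof.
rewrite /Uspace -/e.
have: forall i, lower (fun z => fsum W k0 (fun l => conjM (psi (covering z) (l - e l + 1))) i)
  (fsum W k0 (fun l => conjM (Finf (l - e l + 1))) i).
  elim=> [|i IH] /=.
    by exists (fun=> 0); [exact: mrapid0 | apply: ev_all => z; rewrite addr0 submx_refl].
  apply: lower_add IH _; set l := (k0 + _)%R; set m := (l - e l + 1).
  have := lower_conj (lower_psi_cap m l).
  move=> h; apply: lower_sub (lowerS _ h); first by rewrite conj_cap.
  by apply: ev_all => z; rewrite conj_cap.
by apply.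
Qed.

(** The twist of [piece_twist] preserves the limit by [Uinf_N], so
    [lower_twist] applies; the ranks are constant. *)
Lemma upper_U : upper (fun z => Uspace (vW H (covering z)) k0 (vF H (covering z)) p j *m flatten_at z)
  (Uspace W k0 Finf p j).
Proof.
have Fd := (Finf_data).1.
have e1 := hodge_step_mono p (k0 + j%:Z).
apply: lower_upper; last first.
  have := ev_uhp R; apply: ev_mono => z hz; rewrite rank_unitM ?flatten_at_unit //.
  have [[inc _ _] _ [dec _ _] _ _] := v_mhs H (covering_disk hz).
  have [dec' _ _] := Fd.
  rewrite eq_leq //; apply: fsum_rank_eq => //.
  - exact: vW_low.
  - by move=> l; rewrite conjM_sub; apply: dec; have := e1 l; lia.
  - by move=> l; rewrite conjM_sub; apply: dec'; have := e1 l; lia.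
  - by move=> m k; rewrite !rank_conj_cap vcap_rank.
have := lower_twist Nn (polyb_conjB R) (Uinf_N p j) lower_Upsi.
apply: lowerS; have := ev_uhp R; apply: ev_mono => z hz; rewrite /Uspace -/e.
elim: {1 2}j => [|i IH] /=; first by rewrite mul0mx sub0mx.
rewrite addsmxMr addsmx_sub; apply/andP; split.
  by apply: (submx_trans IH); rewrite submxMr // addsmxSl.
by apply: (submx_trans (piece_twist _ _ hz)); rewrite submxMr // addsmxSr.
Qed.

(** Asymptotically I^(p,q) is in the subspace that Deligne's formula
    associates with the limit filtration. *)
Lemma upper_J (I : C -> int -> int -> 'M[C]_n) (q : int) :
  (forall s, punctured_disk s -> deligne_bigrading (vW H s) (vF H s) (I s)) -> p + q = k0 + j%:Z ->
  upper (fun z => I (covering z) p q *m flatten_at z) (Jspace W Finf k0 p j).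
Proof.
move=> HI pq; apply: upperS (upper_cap (upper_psi_cap p (k0 + j%:Z)) upper_U).
have := ev_uhp R; apply: ev_mono => z hz; have HIs := HI _ (covering_disk hz).
have [[inc _ _] _ [dec _ _] _ _] := v_mhs H (covering_disk hz).
rewrite sub_capmx; apply/andP; split; last by rewrite submxMr // (bigrading_U inc (vW_low hz) dec HIs).
rewrite (psi_cap p _ hz) /flatten_at mulmxA submxMr //.
by rewrite -(vcap_lift p _ hz) submxMr // sub_capmx (bigrading_F HIs) -pq (bigrading_W HIs).
Qed.

End Upper.
(** * Boundedness of the norm *)

Lemma flatten_W z k (x : 'rV[C]_n) : upper_half_plane z -> (x <= cplx (vW H (covering z) k))%MS ->
  (x *m cplx (invmx (Phi z)) <= cplx (W k))%MS.
Proof.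
move=> hz hx; apply: (submx_trans (submxMr _ hx)).
by rewrite -map_mxM -[X in (X <= _)%MS]/(cplx _) cplx_sub -(liftW_const k hz) submx_refl.
Qed.

(** The forms are flat, and untwisting changes a vector of W_k by an element
    of W_(k-1), hence of the radical of Q_k. *)
Lemma sesq_flat z k (x : 'rV[C]_n) : upper_half_plane z -> (x <= cplx (vW H (covering z) k))%MS ->
  sesq (cplx (vQ H (covering z) k)) x x =
  sesq (cplx (liftQ H Phi z0 k)) (x *m flatten_at z) (x *m flatten_at z).
Proof.
move=> hz hx; have uP := Phi_unit hz.
have [[inc _ _] gf _ _ _] := v_mhs H (covering_disk hz).
have hx' := flatten_W hz hx.
rewrite /flatten_at mulmxA; set x' := x *m _ in hx' *; set y := x' *m _.
have hy : (y <= cplx (W k))%MS.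
  exact: submx_trans (submxMr _ hx') (cW_exp k (- z)).
transitivity (sesq (cplx (vQ H (covering z) k)) (y *m cplx (Phi z)) (y *m cplx (Phi z))); last first.
  transitivity (sesq (cplx (liftQ H Phi z k)) y y).
    by rewrite /sesq /liftQ /cplx !map_mxM -map_trmx bil_trans [conjM _]map_mxM -!/(conjM _) -!/(cplx _) conj_cplx.
  apply: (@bil_cplx _ _ _ _ (W k) (W k)); rewrite ?conjM_sub2 ?conj_cplx //.
  by move=> a b ha hb; apply: liftQ_const.
have xE : x = x' *m cplx (Phi z) by rewrite /x' -mulmxA cplxVK // mulmx1.
have -> : y *m cplx (Phi z) = x + x' *m (nilexp (- z *: cplx N) - 1%:M) *m cplx (Phi z).
  by rewrite mulmxBr mulmx1 mulmxBl -xE addrC subrK.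
symmetry; apply: graded_forms_cplx gf _ hx _; first by apply: inc; lia.
apply: (@submx_trans _ _ _ _ _ _ (cplx (W (k - 1)) *m cplx (Phi z))).
  by apply: submxMr; exact: submx_trans (submxMr _ hx') (cW_exp1 k (- z)).
by rewrite -map_mxM -[X in (X <= _)%MS]/(cplx _) cplx_sub (W_Phi (k - 1) hz).
Qed.

Lemma flatten_section (v : C -> 'rV[C]_n) z : flat_section H v -> upper_half_plane z ->
  v (covering z) *m flatten_at z = v (covering z0) *m cplx (invmx (Phi z0)).
Proof.
move=> Hv hz; rewrite /flatten_at mulmxA (section_const Hv hz).
have := flat_section_N Hv; set c := v (covering z0) *m _ => cN.
apply/eqP; rewrite -subr_eq0 -{2}(mulmx1 c) -mulmxBr -submx0.
by apply: nilexp_sub1; rewrite ?cN sub0mx.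
Qed.

Lemma vF_rank z p : upper_half_plane z -> \rank (vF H (covering z) p) = \rank (Finf p).
Proof.
move=> hz; have [_ _ [k1 W1]] := W_filtration.
have c1 (A : 'M[C]_n) (V : 'M[R]_n) : (V :=: 1%:M)%MS -> \rank (A :&: cplx V) = \rank A.
  move=> V1; apply: eqmx_rank; apply/andP; split; first exact: capmxSl.
  rewrite sub_capmx submx_refl (submx_trans (submx1 _)) // -(map_mx1 (real_complex R)).
  by rewrite -[X in (X <= _)%MS]/(cplx _) cplx_sub V1 submx_refl.
have := vcap_rank p k1 hz.
rewrite !c1 //; apply: eqmx_trans (eqmx_sym (W_Phi k1 hz)) _.
apply: eqmx_trans (eqmxMr _ W1) _; rewrite mul1mx; apply/eqmxP.
by rewrite submx1 sub1mx row_full_unit (Phi_unit hz).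
Qed.

(** The flattened components of v have a fixed sum and lie near independent
    subspaces. They are therefore bounded, and so are their norms, computed
    from fixed forms. *)
Lemma norm_bounded (v : C -> 'rV[C]_n) (h : C -> 'M[C]_n) (I : C -> int -> int -> 'M[C]_n) :
  flat_section H v ->
  (forall s, punctured_disk s -> metric_bigrading (vW H s) (vQ H s) (vF H s) (h s) (I s)) ->
  exists B : R, ev (fun z => metric_norm (h (covering z)) (v (covering z)) <= B).
Proof.
move=> Hv HI; have [_ _ [k1 W1]] := W_filtration.
have [[Fdec [p1 F1] [p0 F0]] _] := Finf_data.
pose a := absz (p1 - p0)%R; pose b := absz (k1 - k0)%R.
pose pt (t : 'I_a * 'I_b) : int := p0 + (t.1 : nat)%:Z.
pose qt (t : 'I_a * 'I_b) : int := k0 + (t.2 : nat).+1%:Z - pt t.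
have ptqt t : pt t + qt t = k0 + (t.2 : nat).+1%:Z by rewrite /qt; lia.
have box z : upper_half_plane z -> (1%:M <= \sum_t I (covering z) (pt t) (qt t))%MS.
  move=> hz; have [HIs _ _] := HI _ (covering_disk hz).
  have [[inc _ _] _ [dec _ _] _ _] := v_mhs H (covering_disk hz).
  apply: (bigrading_box HIs inc _ _ dec).
  - exact: (vW_low hz).
  - apply: eqmx_trans (eqmx_sym (W_Phi _ hz)) _; apply/eqmxP; rewrite submx1 /=.
    rewrite sub1mx row_full_unit unitmx_mul (Phi_unit hz) andbT -row_full_unit -sub1mx -W1 Winc //.
    by rewrite /b; lia.
  - apply/eqmxP; rewrite sub0mx andbT submx0 -mxrank_eq0 vF_rank // mxrank_eq0 -submx0 -F1 Fdec //.
    by rewrite /a; lia.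
  - by apply/eqmxP; rewrite submx1 /= sub1mx /row_full vF_rank // F0 mxrank1.
pose A (t : 'I_a * 'I_b) z := I (covering z) (pt t) (qt t) *m flatten_at z.
have HA t : upper (A t) (Jspace W Finf k0 (pt t) (t.2 : nat).+1).
  apply: (upper_J) (ptqt t) => s hs.
  by case: (HI s hs).
have indep : forall x : 'I_a * 'I_b -> 'rV[C]_n,
    (forall t, (x t <= Jspace W Finf k0 (pt t) (t.2 : nat).+1)%MS) -> \sum_t x t = 0 -> forall t, x t = 0.
  exact: (J_indep Winc W0 Fdec Finf_pure).
have [K HK] := bounded_components HA indep.
set c := v (covering z0) *m cplx (invmx (Phi z0)).
pose kap (t : 'I_a * 'I_b) := mnorm (cplx (liftQ H Phi z0 (pt t + qt t))).
exists (Num.sqrt (\sum_t kap t * (K * mnorm c) ^+ 2)).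
have := ev_and (ev_uhp R) HK; apply: ev_mono => z [hz {}HK].
have [HIs Ho Hd] := HI _ (covering_disk hz).
have [u Hu] := sub_sumsmxP (submx_trans (submx1 (v (covering z))) (box z hz)).
pose x t := u t *m I (covering z) (pt t) (qt t).
have xI t : (x t <= I (covering z) (pt t) (qt t))%MS by exact: submxMl.
have vx : v (covering z) = \sum_t x t by [].
have yK t : mnorm (x t *m flatten_at z) <= K * mnorm c.
  rewrite -[c](flatten_section Hv hz) vx mulmx_suml.
  by apply: (HK (fun t => x t *m flatten_at z)) => t'; exact: submxMr.
rewrite /metric_norm ler_wsqrtr // vx sesq_sum_orth; last first.
  move=> t t' tt; apply: (Ho _ _ _ _ _ _ _ (xI t) (xI t')); apply: contraNN tt => /eqP[E1 E2].
  case: t t' E1 E2 => i j [i' j']; rewrite /qt /pt /= => E1 E2.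
  by apply/eqP; congr (_, _); apply: val_inj => /=; lia.
apply: le_trans (ler_norm _) _; apply: le_trans (cabs_Re _) _; apply: le_trans (cabs_sum _ _ _) _.
apply: ler_sum => t _; rewrite (Hd _ _ _ _ (xI t) (xI t)) cabsM cabs_iexp mul1r.
rewrite sesq_flat //; last exact: submx_trans (xI t) (bigrading_W HIs _ _).
apply: (le_trans (sesq_bound _ _)); rewrite ler_wpM2l ?mnorm_ge0 // ler_pXn2r ?nnegrE ?mnorm_ge0 //.
exact: le_trans (mnorm_ge0 _) (yK t).
Qed.

End Variation.

Theorem theorem5p5p4 (R : realType) (n : nat) (H : gpvmhs R n)
    (v : R[i] -> 'rV[R[i]]_n) (h : R[i] -> 'M[R[i]]_n)
    (Hadm : admissible H) (Hunip : unipotent_variation H)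
    (Hv : flat_section H v)
    (Hh : forall s, punctured_disk s ->
            mixed_hodge_metric (vW H s) (vQ H s) (vF H s) (h s)) :
  exists B : R, \forall s \near (0 : R[i]^o)^', metric_norm (h s) (v s) <= B.
Proof.
have [Phi [N [HPhi HN [Finf [psi [Hpsi Hcvg]] Hdual] [M HM]]]] := Hadm.
have [I HI] : exists I : R[i] -> int -> int -> 'M[R[i]]_n, forall s, punctured_disk s ->
    metric_bigrading (vW H s) (vQ H s) (vF H s) (h s) (I s).
  suff /choice[I HI] : forall s, exists I, punctured_disk s ->
    metric_bigrading (vW H s) (vQ H s) (vF H s) (h s) I by exists I.
  move=> s.
  have [hs|hs] := pselect (punctured_disk s); last by exists (fun _ _ => 0).
  by have [I hI [h1 h2]] := Hh _ hs; exists I.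
have [_ [k0 W0] _] := W_filtration HPhi.
have [B HB] := norm_bounded HPhi HN Hunip (HM _ (zbaseP R)) Hpsi Hcvg (Hdual _ (zbaseP R)) W0 Hv HI.
by exists B; exact: near0_of_ev HB.
Qed.
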